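(* Let $H$ be the ring of Hurwitz integers and let $L=\{\mathbf b_0m_0+\mathbf b_1m_1:m_0,m_1\in H\}\subset\mathbb H^2$ be a random lattice, where $\mathbf b_0,\mathbf b_1$ are the columns of $g\in\mathrm{SL}_2(\mathbb H)$ and the coset $g\,\mathrm{SL}_2(H)$ is distributed according to the invariant probability measure on $\mathrm{SL}_2(\mathbb H)/\mathrm{SL}_2(H)$. Then for $0<t<1$ the probability density function of the length $t$ of the shortest nonzero vector of $L$ equals $$\frac1{\mathrm{vol}\,\Gamma_{4,H}}\;\frac{t^7}{2},$$ where $$\mathrm{vol}\,\Gamma_{4,H}=\int_{t>0,\ X\in\mathcal V,\ 1-1/t^4\le|X|^2}t^7\,dt\,dX_0\,dX_1\,dX_2\,dX_3 ,\qquad \mathcal V=\Big\{X\in\mathbb R^4:\ |X_l|\le\tfrac12\ (l=0,\dots,3),\ \sum_{l=0}^3|X_l|\le1\Big\}.$$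
   Context: The Hurwitz integers $H$ are the quaternions $a_0+a_1\mathrm i+a_2\mathrm j+a_3\mathrm k$ with $a_0,\dots,a_3$ either all integers or all half-integers; $\mathcal V$ is the Voronoi cell of the origin for $H$ viewed as a lattice in $\mathbb R^4$. Representing each quaternion $z+w\mathrm j$ ($z,w\in\mathbb C$) as the $2\times2$ complex matrix $\begin{bmatrix}z&w\\-\overline w&\overline z\end{bmatrix}$, $\mathrm{SL}_2(\mathbb H)$ is the group of $2\times2$ quaternion matrices whose $4\times4$ complex representation has determinant $1$, and $\mathrm{SL}_2(H)$ is its subgroup of matrices with Hurwitz entries. Lengths are $\|(v_1,v_2)\|=(|v_1|^2+|v_2|^2)^{1/2}$. In Gram–Schmidt coordinates, where the shortest reduced basis is $\boldsymbol\alpha=(t,0)$, $\boldsymbol\beta=(t\,(X_0+X_1\mathrm i+X_2\mathrm j+X_3\mathrm k),1/t)$, the normalised invariant measure restricted to shortest reduced bases is $(\mathrm{vol}\,\Gamma_{4,H})^{-1}t^7\,dt\prod_{l=0}^3dX_l$ on $\{t>0,\ X\in\mathcal V,\ 1-1/t^4\le|X|^2\}$. *)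

(* Defs.v *)
From HB Require Import structures.
From mathcomp Require Import all_boot all_order all_algebra.
From mathcomp Require Import all_classical all_reals all_analysis.
From mathcomp Require Import generic_quotient complex ring.

Set Implicit Arguments.
Unset Strict Implicit.
Unset Printing Implicit Defensive.

Import Order.TTheory GRing.Theory Num.Theory.
Import numFieldNormedType.Exports.

Local Open Scope classical_set_scope.
Local Open Scope ring_scope.
Local Open Scope complex_scope.
Local Open Scope quotient_scope.

(* [(a0, a1, a2, a3)] stands for [a0 + a1 i + a2 j + a3 k]; the additive group
   and the topology are those of R^4. *)
Definition quat (R : realType) : Type := (R * R * R * R)%type.

Section Quaternions.
Context {R : realType}.

HB.instance Definition _ := GRing.Zmodule.copy (quat R) (R * R * R * R)%type.
HB.instance Definition _ := Topological.copy (quat R) (R * R * R * R)%type.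

Definition quat1 : quat R := (1, 0, 0, 0).

Definition quat_mul (p q : quat R) : quat R :=
  let: (a0, a1, a2, a3) := p in
  let: (b0, b1, b2, b3) := q in
  (a0 * b0 - a1 * b1 - a2 * b2 - a3 * b3,
   a0 * b1 + a1 * b0 + a2 * b3 - a3 * b2,
   a0 * b2 - a1 * b3 + a2 * b0 + a3 * b1,
   a0 * b3 + a1 * b2 - a2 * b1 + a3 * b0).

Let quatE (a b c d a' b' c' d' : R) : a = a' -> b = b' -> c = c' -> d = d' ->
  (a, b, c, d) = (a', b', c', d').
Proof. by move=> -> -> -> ->. Qed.

Let quat_mulA : associative quat_mul.
Proof.
by case=> [[[? ?] ?] ?] [[[? ?] ?] ?] [[[? ?] ?] ?]; apply: quatE; ring.
Qed.

Let quat_mul1l : left_id quat1 quat_mul.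
Proof. by case=> [[[? ?] ?] ?]; apply: quatE; ring. Qed.

Let quat_mul1r : right_id quat1 quat_mul.
Proof. by case=> [[[? ?] ?] ?]; apply: quatE; ring. Qed.

Let quat_mulDl : left_distributive quat_mul +%R.
Proof.
by case=> [[[? ?] ?] ?] [[[? ?] ?] ?] [[[? ?] ?] ?]; apply: quatE => /=; ring.
Qed.

Let quat_mulDr : right_distributive quat_mul +%R.
Proof.
by case=> [[[? ?] ?] ?] [[[? ?] ?] ?] [[[? ?] ?] ?]; apply: quatE => /=; ring.
Qed.

Let quat1_neq0 : quat1 != 0.
Proof. by apply/eqP => -[] /eqP; rewrite oner_eq0. Qed.

HB.instance Definition _ := GRing.Zmodule_isNzRing.Build (quat R)
  quat_mulA quat_mul1l quat_mul1r quat_mulDl quat_mulDr quat1_neq0.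

Definition quat_sqnorm (q : quat R) : R :=
  let: (a0, a1, a2, a3) := q in a0 ^+ 2 + a1 ^+ 2 + a2 ^+ 2 + a3 ^+ 2.

(* Euclidean length on H^2 = R^8, not the sup norm of the matrix library. *)
Definition quat_length (v : 'cV[quat R]_2) : R :=
  Num.sqrt (quat_sqnorm (v 0 0) + quat_sqnorm (v 1 0)).

Definition hurwitz : set (quat R) :=
  [set q | let: (a0, a1, a2, a3) := q in
     all (fun a => a \is a Num.int) [:: a0; a1; a2; a3]
  || all (fun a => a - 2^-1 \is a Num.int) [:: a0; a1; a2; a3]].

(* q = z + w j with z = a0 + a1 i and w = a2 + a3 i *)
Definition quat_mx (q : quat R) : 'M[R[i]]_2 :=
  let: (a0, a1, a2, a3) := q in
  let z := a0 +i* a1 in let w := a2 +i* a3 in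
  block_mx z%:M w%:M (- conjc w)%:M (conjc z)%:M : 'M[R[i]]_(1 + 1).

Definition complex_rep (g : 'M[quat R]_2) : 'M[R[i]]_4 :=
  block_mx (quat_mx (g 0 0)) (quat_mx (g 0 1))
           (quat_mx (g 1 0)) (quat_mx (g 1 1)) : 'M[R[i]]_(2 + 2).

Lemma quat_mxM p q : quat_mx (p * q) = quat_mx p *m quat_mx q.
Proof.
case: p q => [[[a0 a1] a2] a3] [[[b0 b1] b2] b3].
apply: etrans (esym (@mulmx_block _ 1 1 1 1 1 1 _ _ _ _ _ _ _ _)).
rewrite /quat_mx /= -!scalar_mxM -!raddfD /=.
by congr (block_mx _%:M _%:M _%:M _%:M); apply/eqP; rewrite eq_complex /=;
  apply/andP; split; apply/eqP; ring.
Qed.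

Lemma quat_mxD p q : quat_mx (p + q) = quat_mx p + quat_mx q.
Proof.
case: p q => [[[a0 a1] a2] a3] [[[b0 b1] b2] b3].
apply: etrans (esym (@add_block_mx _ 1 1 1 1 _ _ _ _ _ _ _ _)).
rewrite /quat_mx /= -!raddfD /=.
by congr (block_mx _%:M _%:M _%:M _%:M); apply/eqP; rewrite eq_complex /=;
  apply/andP; split; apply/eqP; ring.
Qed.

Lemma quat_mx0 : quat_mx 0 = 0.
Proof. by apply: (addrI (quat_mx 0)); rewrite -quat_mxD !addr0. Qed.

Lemma quat_mx1 : quat_mx 1 = 1%:M.
Proof.
apply: etrans (esym (@scalar_mx_block _ 1 1 1)).
rewrite -(raddf0 (@scalar_mx R[i] 1)).
by congr (block_mx _%:M _%:M _%:M _%:M); apply/eqP;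
  rewrite eq_complex /= ?oppr0 !eqxx.
Qed.

Lemma complex_repM g h : complex_rep (g * h) = complex_rep g *m complex_rep h.
Proof.
apply: etrans (esym (@mulmx_block _ 2 2 2 2 2 2 _ _ _ _ _ _ _ _)).
rewrite -!quat_mxM -!quat_mxD /complex_rep !mxE !big_ord_recl !big_ord0 !addr0.
by rewrite (_ : lift 0 0 = 1 :> 'I_2) //; apply: val_inj.
Qed.

Lemma complex_rep1 : complex_rep 1 = 1%:M.
Proof.
apply: etrans (esym (@scalar_mx_block _ 2 2 1)).
by rewrite /complex_rep !mxE; congr block_mx; rewrite (quat_mx1, quat_mx0).
Qed.

End Quaternions.

Definition SL2H_set (R : realType) : set 'M[quat R]_2 :=
  [set g | \det (complex_rep g) = 1].
Arguments SL2H_set R : clear implicits.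

Definition SL2H (R : realType) : Type := set_type (SL2H_set R).

Section SpecialLinear.
Context {R : realType}.

HB.instance Definition _ := SubType.copy (SL2H R) (set_type (SL2H_set R)).
HB.instance Definition _ := Topological.copy (SL2H R) (set_type (SL2H_set R)).

Definition SL2H_mx (g : SL2H R) : 'M[quat R]_2 := \val g.

Let SL2H_mul_subproof (g h : SL2H R) : SL2H_mx g * SL2H_mx h \in SL2H_set R.
Proof.
apply/mem_set; rewrite /SL2H_set /= complex_repM det_mulmx.
by rewrite (set_mem (valP g)) (set_mem (valP h)) mulr1.
Qed.

Definition SL2H_mul (g h : SL2H R) : SL2H R :=
  exist _ (SL2H_mx g * SL2H_mx h) (SL2H_mul_subproof g h).

Let SL2H_one_subproof : (1 : 'M[quat R]_2) \in SL2H_set R.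
Proof. by apply/mem_set; rewrite /SL2H_set /= complex_rep1 det1. Qed.

Definition SL2H_one : SL2H R := exist _ 1 SL2H_one_subproof.

HB.instance Definition _ := isPointed.Build (SL2H R) SL2H_one.

Definition SL2Hurwitz : set (SL2H R) :=
  [set g | forall i j, hurwitz (SL2H_mx g i j)].

Definition lcoset_Hurwitz (g : SL2H R) : set (SL2H R) :=
  [set SL2H_mul g u | u in SL2Hurwitz].

Definition same_coset (g h : SL2H R) : bool :=
  `[< lcoset_Hurwitz g = lcoset_Hurwitz h >].

Let same_coset_refl : reflexive same_coset.
Proof. by move=> g; apply/asboolP. Qed.

Let same_coset_sym : symmetric same_coset.
Proof. by move=> g h; apply/asboolP/asboolP => ->. Qed.

Let same_coset_trans : transitive same_coset.
Proof. by move=> h g k /asboolP gh /asboolP hk; apply/asboolP; rewrite gh. Qed.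

Canonical same_coset_equiv :=
  EquivRel same_coset same_coset_refl same_coset_sym same_coset_trans.

End SpecialLinear.

(* SL_2(H)/SL_2(Hurwitz), with the quotient topology *)
Definition coset_space (R : realType) : Type :=
  quotient_topology {eq_quot (@same_coset_equiv R)}.

Section CosetSpace.
Context {R : realType}.

HB.instance Definition _ := PointedTopological.on (coset_space R).

Definition mkcoset (g : SL2H R) : coset_space R :=
  \pi_(quotient_topology {eq_quot (@same_coset_equiv R)}) g.

Definition coset_repr (q : coset_space R) : SL2H R :=
  repr (q : quotient_topology {eq_quot (@same_coset_equiv R)}).

(* left translation h SL_2(Hurwitz) |-> g h SL_2(Hurwitz) *)
Definition coset_translate (g : SL2H R) (q : coset_space R) : coset_space R :=
  mkcoset (SL2H_mul g (coset_repr q)).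

Lemma coset_translateE g h :
  coset_translate g (mkcoset h) = mkcoset (SL2H_mul g h).
Proof.
have mulE a b : lcoset_Hurwitz (SL2H_mul a b) = SL2H_mul a @` lcoset_Hurwitz b.
  have mulA u : SL2H_mul (SL2H_mul a b) u = SL2H_mul a (SL2H_mul b u).
    by apply: val_inj; rewrite /= /SL2H_mx /= -mulrA.
  apply/seteqP; split=> [_ [u Hu <-]|_ [_ [u Hu <-] <-]].
    by exists (SL2H_mul b u); [exists u | rewrite mulA].
  by exists u.
apply/eqmodP/asboolP; rewrite !mulE; congr (_ @` _).
by have /eqmodP/asboolP : mkcoset (coset_repr (mkcoset h)) = mkcoset h
  by exact: reprK.
Qed.

(* the right Hurwitz module generated by b0 and b1 *)
Definition lattice (b0 b1 : 'cV[quat R]_2) : set 'cV[quat R]_2 :=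
  [set v | exists m0 m1 : quat R, [/\ hurwitz m0, hurwitz m1 &
     v = b0 *m m0%:M + b1 *m m1%:M]].

(* Independent of the representative, as u H^2 = H^2 for u in SL_2(H), where
   H denotes the Hurwitz integers. *)
Definition coset_lattice (q : coset_space R) : set 'cV[quat R]_2 :=
  lattice (col 0 (SL2H_mx (coset_repr q))) (col 1 (SL2H_mx (coset_repr q))).

Definition shortest_vectors (L : set 'cV[quat R]_2) : set 'cV[quat R]_2 :=
  [set v | [/\ L v, v != 0 &
     forall w, L w -> w != 0 -> quat_length v <= quat_length w]].

(* All shortest vectors have the same length; the default 0 is never used for
   a lattice, as shortest vectors exist by discreteness. *)
Definition shortest_length (L : set 'cV[quat R]_2) : R :=
  xget 0 (quat_length @` shortest_vectors L).

End CosetSpace.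

Definition coset_borel (R : realType) :=
  g_sigma_algebraType (@open (coset_space R)).

Definition left_invariant (R : realType) (P : set (coset_borel R) -> \bar R) :=
  forall (g : SL2H R) (A : set (coset_borel R)), measurable A ->
    P (coset_translate g @^-1` A) = P A.

Definition is_pdf (R : realType) (d : measure_display) (T : measurableType d)
    (P : probability T R) (X : T -> R) (f : R -> R) : Prop :=
  [/\ measurable_fun setT X, measurable_fun setT f, forall x, 0 <= f x &
      forall A : set R, measurable A ->
        P (X @^-1` A) = (\int[lebesgue_measure]_(x in A) (f x)%:E)%E].

(* a 24-cell, the Voronoi cell of 0 for the Hurwitz integers *)
Definition voronoi_cell (R : realType) : set (quat R) :=
  [set X | let: (X0, X1, X2, X3) := X in
     all (fun x => `|x| <= 2^-1) [:: X0; X1; X2; X3] /\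
     `|X0| + `|X1| + `|X2| + `|X3| <= 1].

(* the points (t, X0, X1, X2, X3) for which the columns (t, 0) and
   (t (X0 + X1 i + X2 j + X3 k), 1/t) form a shortest reduced basis *)
Definition Gamma_region (R : realType) : set (R * R * R * R * R) :=
  [set p | let: (t, X0, X1, X2, X3) := p in
     [/\ 0 < t, voronoi_cell (X0, X1, X2, X3) &
         1 - 1 / t ^+ 4 <= quat_sqnorm (X0, X1, X2, X3)]].

Definition vol_Gamma (R : realType) : R :=
  let mu := @lebesgue_measure R in
  \int[(mu \x mu \x mu \x mu \x mu)%E]_(p in @Gamma_region R)
    (let: (t, _, _, _, _) := p in t ^+ 7).

(* Main.v *)
Require Import Defs.
From HB Require Import structures.
From mathcomp Require Import all_boot all_order all_algebra.
From mathcomp Require Import finmap all_classical all_reals all_analysis.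
From mathcomp Require Import measurable_realfun complex zify ring lra.

Set Implicit Arguments.
Unset Strict Implicit.
Unset Printing Implicit Defensive.

Import Order.TTheory GRing.Theory Num.Theory.
Import numFieldNormedType.Exports.

Local Open Scope classical_set_scope.
Local Open Scope ring_scope.

(* A lattice L = g H^2 is described by the set of its bases, the matrices g u
   with u in SL_2(H). Averaging over L the number of bases lying in a set E of
   matrices of norm 1 gives a left-invariant measure m, and by uniqueness m(E)
   is proportional to the Lebesgue measure of the truncated cone over E.
   Linear changes of variables and polar coordinates in H^2 turn the latter,
   for the set of bases whose Gram-Schmidt coordinates (t, X) lie in Y, into a
   multiple of the integral of t^7 vol {X | (t, X) in Y} dt.
   Every lattice has a reduced basis, and its first vector is shortest.
   Outside a null set the reduced bases are strictly reduced, and the strictly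
   reduced bases of a lattice form a single orbit of diag(u, v), u and v ranging
   over the finitely many units of H. So m of the strictly reduced bases with
   t in A is a constant times P(length in A), and total mass 1 fixes the
   constant to be 1 / vol Gamma. For t < 1 the condition 1 - 1/t^4 <= |X|^2 is
   void and the density is t^7 vol V / vol Gamma, with vol V = 1/2: exchanging
   the halves of each side of the unit cube maps {sum |X_l| < 1} to
   {sum |X_l| > 1}. *)

(** * Maps that scale a measure *)

(** Only left invariance of [P] is given, and no Haar measure is constructed. The obstacle is that
    the matrices of norm 1 form a Lebesgue-null hypersurface of R^16; normalising a matrix commutes
    with left and right multiplication by matrices of norm 1, so cones over subsets of this
    hypersurface can stand in for the subsets. Comparing [m] with Lebesgue measure requires the
    latter to be invariant under multiplication on both sides, although [m] is only known to be
    invariant on the left. Over noncommuting entries the determinant is replaced by the real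
    polynomial [mat_norm], equal to the determinant of the complex representation and homogeneous of
    degree 4 over the reals. No Jacobian is computed as a determinant: Jacobians come from
    triangular factorisations and from the uniqueness of translation-invariant measures on R^4. The
    exponent 7 is that of r^7 dr in R^8, where the first column lives. The volume of the unit ball
    of R^8, the integral of the cone weight and the number of pairs of units enter only as positive
    finite numbers. *)

(* [m1 \x m2] with its sigma-finite structure, which canonical inference on
   [product_measure1] only finds for subprobability measures. *)
Section SigmaFiniteProduct.
Local Open Scope ereal_scope.
Context {R : realType} d1 d2 (T1 : measurableType d1) (T2 : measurableType d2).
Variables (m1 : {sigma_finite_measure set T1 -> \bar R})
  (m2 : {sigma_finite_measure set T2 -> \bar R}).

Definition product_function : set (T1 * T2) -> \bar R := m1 \x m2.

HB.instance Definition _ := Measure.copy product_function (m1 \x m2).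

Lemma product_function_sigma_finite : sigma_finite setT product_function.
Proof.
have /sigma_finiteP[F [TF ndF Foo]] := sigma_finiteT m1.
have /sigma_finiteP[G [TG ndG Goo]] := sigma_finiteT m2.
exists (fun n => F n `*` G n) => [|k]; last first.
  have [mF Fk] := Foo k; have [mG Gk] := Goo k; split; first exact: measurableX.
  rewrite /product_function product_measure1E// lte_mul_pinfty//.
  by rewrite ge0_fin_numE.
apply/seteqP; split=> // -[x y] _.
have [n _ Fnx] : (\bigcup_i F i) x by rewrite -TF.
have [k _ Gky] : (\bigcup_i G i) y by rewrite -TG.
exists (maxn n k) => //; split.
  by move: x Fnx; exact/subsetPset/ndF/leq_maxl.
by move: y Gky; exact/subsetPset/ndG/leq_maxr.
Qed.

HB.instance Definition _ := Measure_isSigmaFinite.Build _ _ _ product_function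
  product_function_sigma_finite.

Definition sprod : {sigma_finite_measure set (T1 * T2)%type -> \bar R} :=
  product_function.

End SigmaFiniteProduct.

Section PackSigmaFinite.
Context {R : realType} d (T : measurableType d).
Variables (m : {measure set T -> \bar R}) (sf : sigma_finite setT m).

(** The proof is an argument of the function, so that the canonical structure declared below can
    recover it. *)
Definition sigma_finite_function of sigma_finite setT m : set T -> \bar R := m.

HB.instance Definition _ := Measure.copy (sigma_finite_function sf) m.
HB.instance Definition _ :=
  Measure_isSigmaFinite.Build _ _ _ (sigma_finite_function sf) sf.

Definition pack_sigma_finite : {sigma_finite_measure set T -> \bar R} :=
  sigma_finite_function sf.

End PackSigmaFinite.

Section ScalingMaps.
Context {R : realType}.
Local Open Scope ereal_scope.

(** Preimages are measured, so for an invertible linear map [c] is the inverse of the absolute value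
    of its determinant. *)
Definition scaling d1 d2 (T1 : measurableType d1) (T2 : measurableType d2)
    (c : R) (mu : {measure set T1 -> \bar R}) (nu : {measure set T2 -> \bar R})
    (f : T1 -> T2) : Prop :=
  measurable_fun setT f /\
  forall A, measurable A -> mu (f @^-1` A) = c%:E * nu A.

Definition image_measure d1 d2 (T1 : measurableType d1) (T2 : measurableType d2)
    (mu : {measure set T1 -> \bar R}) (f : T1 -> T2)
    (mf : measurable_fun setT f) : {measure set T2 -> \bar R} :=
  measure_function_pushforward__canonical__measure_function_Measure mu mf.

Lemma scaling_id d (T : measurableType d) (mu : {measure set T -> \bar R}) :
  scaling 1 mu mu id.
Proof. by split => [|A mA]; [exact: measurable_id | rewrite mul1e]. Qed.

Lemma scaling_comp d1 d2 d3 (T1 : measurableType d1) (T2 : measurableType d2)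
    (T3 : measurableType d3) c c' (mu : {measure set T1 -> \bar R})
    (nu : {measure set T2 -> \bar R}) (la : {measure set T3 -> \bar R})
    (f : T1 -> T2) (g : T2 -> T3) :
  scaling c mu nu f -> scaling c' nu la g -> scaling (c * c')%R mu la (g \o f).
Proof.
move=> [mf sf] [mg sg]; split=> [|A mA]; first exact: measurableT_comp.
rewrite comp_preimage sf ?sg ?EFinM ?muleA//.
by rewrite -[X in measurable X]setTI; exact: mg.
Qed.

Lemma integral_scaling d1 d2 (T1 : measurableType d1) (T2 : measurableType d2)
    c (mu : {measure set T1 -> \bar R}) (nu : {measure set T2 -> \bar R})
    (f : T1 -> T2) (phi : T2 -> \bar R) :
  (0 <= c)%R -> scaling c mu nu f -> measurable_fun setT phi ->
  (forall y, 0 <= phi y) ->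
  \int[mu]_x phi (f x) = c%:E * \int[nu]_y phi y.
Proof.
move=> c0 [mf sf] mphi phi0.
have := @ge0_integral_pushforward _ _ _ _ _ _ mf mu setT phi measurableT mphi.
rewrite preimage_setT => <-; last by move=> y _; exact: phi0.
rewrite -(@ge0_integral_mscale _ _ _ nu setT measurableT (NngNum c0))//.
by apply: eq_measure_integral => A mA _; rewrite /= /pushforward sf.
Qed.

(** The product measure is defined by integrating over the first factor; slicing along the second
    rests on the uniqueness of product measures. *)
Lemma measure_fubini d1 d2 (T1 : measurableType d1) (T2 : measurableType d2)
    (m1 : {sigma_finite_measure set T1 -> \bar R})
    (m2 : {sigma_finite_measure set T2 -> \bar R}) (A : set (T1 * T2)) :
  measurable A -> (sprod m1 m2) A = \int[m2]_y m1 [set x | A (x, y)].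
Proof.
move=> mA; transitivity ((m1 \x^ m2) A).
  by apply: product_measure_unique => // X Y mX mY; exact: product_measure2E.
by apply: eq_integral => y _ /=; rewrite ysectionE.
Qed.

Lemma measure_fubini1 d1 d2 (T1 : measurableType d1) (T2 : measurableType d2)
    (m1 : {sigma_finite_measure set T1 -> \bar R})
    (m2 : {sigma_finite_measure set T2 -> \bar R}) (A : set (T1 * T2)) :
  (sprod m1 m2) A = \int[m1]_x m2 [set y | A (x, y)].
Proof. by apply: eq_integral => x _ /=; rewrite xsectionE. Qed.

Lemma measurable_slice1 d1 d2 (T1 : measurableType d1) (T2 : measurableType d2)
    (A : set (T1 * T2)) x : measurable A -> measurable [set y | A (x, y)].
Proof. by move=> mA; have := measurable_xsection x mA; rewrite xsectionE. Qed.

Lemma measurable_slice2 d1 d2 (T1 : measurableType d1) (T2 : measurableType d2)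
    (A : set (T1 * T2)) y : measurable A -> measurable [set x | A (x, y)].
Proof. by move=> mA; have := measurable_ysection y mA; rewrite ysectionE. Qed.

Lemma measurable_measure_slice1 d1 d2 (T1 : measurableType d1)
    (T2 : measurableType d2) (m2 : {sigma_finite_measure set T2 -> \bar R})
    (A : set (T1 * T2)) :
  measurable A -> measurable_fun setT (fun x => m2 [set y | A (x, y)]).
Proof.
move=> mA; have := measurable_fun_xsection m2 mA.
by congr measurable_fun; apply/funext => x /=; rewrite xsectionE.
Qed.

Lemma scaling_swap d1 d2 (T1 : measurableType d1) (T2 : measurableType d2)
    (m1 : {sigma_finite_measure set T1 -> \bar R})
    (m2 : {sigma_finite_measure set T2 -> \bar R}) :
  scaling 1 (sprod m1 m2) (sprod m2 m1) (fun p => (p.2, p.1)).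
Proof.
have ms : measurable_fun setT (fun p : T1 * T2 => (p.2, p.1)).
  by apply: measurable_fun_pair; [exact: measurable_snd|exact: measurable_fst].
split=> // A mA; rewrite mul1e [RHS]measure_fubini1 [LHS]measure_fubini//.
by rewrite -[X in measurable X]setTI; exact: ms.
Qed.

(** The workhorse for triangular maps: by Fubini, the factor of the fibre maps [g x] and that of the
    base map [f] multiply, however [g x] depends on [x]. *)
Lemma scaling_skew d1 d2 d3 d4 (T1 : measurableType d1) (T2 : measurableType d2)
    (T3 : measurableType d3) (T4 : measurableType d4) c c'
    (m1 : {sigma_finite_measure set T1 -> \bar R})
    (m2 : {sigma_finite_measure set T2 -> \bar R})
    (m3 : {sigma_finite_measure set T3 -> \bar R})
    (m4 : {sigma_finite_measure set T4 -> \bar R})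
    (f : T1 -> T3) (g : T1 -> T2 -> T4) :
  (0 <= c)%R -> (0 <= c')%R -> scaling c m1 m3 f ->
  measurable_fun setT (fun p => g p.1 p.2) ->
  (forall x, scaling c' m2 m4 (g x)) ->
  scaling (c * c')%R (sprod m1 m2) (sprod m3 m4) (fun p => (f p.1, g p.1 p.2)).
Proof.
move=> c0 c'0 sf mg sg; split=> [|A mA].
  by apply: measurable_fun_pair => //; exact: measurableT_comp sf.1 _.
rewrite [LHS]measure_fubini1 [X in _ = _ * X]measure_fubini1.
under eq_integral => x _.
  rewrite (_ : m2 _ = m2 (g x @^-1` [set y | A (f x, y)]))//.
  rewrite (sg x).2; last exact: measurable_slice1.
  over.
have mm : measurable_fun setT (fun u => m4 [set y | A (u, y)]).
  exact: measurable_measure_slice1.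
rewrite ge0_integralZl//; last first.
  exact: (measurableT_comp (f := fun u => m4 [set y | A (u, y)]) mm sf.1).
by rewrite (integral_scaling c0 sf mm)// muleA -EFinM mulrC.
Qed.

Lemma scaling_prod d1 d2 d3 d4 (T1 : measurableType d1) (T2 : measurableType d2)
    (T3 : measurableType d3) (T4 : measurableType d4) c c'
    (m1 : {sigma_finite_measure set T1 -> \bar R})
    (m2 : {sigma_finite_measure set T2 -> \bar R})
    (m3 : {sigma_finite_measure set T3 -> \bar R})
    (m4 : {sigma_finite_measure set T4 -> \bar R})
    (f : T1 -> T3) (g : T2 -> T4) :
  (0 <= c)%R -> (0 <= c')%R -> scaling c m1 m3 f -> scaling c' m2 m4 g ->
  scaling (c * c')%R (sprod m1 m2) (sprod m3 m4) (fun p => (f p.1, g p.2)).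
Proof.
move=> c0 c'0 sf sg; apply: (scaling_skew (g := fun=> g)) => //.
exact: measurableT_comp sg.1 _.
Qed.

End ScalingMaps.

(** * Quaternions *)

HB.instance Definition _ (R : realType) :=
  Measurable.copy (quat R)
    (measurableTypeR R * measurableTypeR R * measurableTypeR R *
     measurableTypeR R)%type.

Section QuaternionAlgebra.
Context {R : realType}.
Implicit Types p q : quat R.
Local Notation sqn := (@quat_sqnorm R).

Lemma quat_eq (a b c d a' b' c' d' : R) : a = a' -> b = b' -> c = c' -> d = d' ->
  (a, b, c, d) = (a', b', c', d').
Proof. by move=> -> -> -> ->. Qed.

Definition quat_conj q : quat R :=
  let: (a0, a1, a2, a3) := q in (a0, - a1, - a2, - a3).

Definition quat_real (k : R) : quat R := (k, 0, 0, 0).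

Definition quat_re q : R := q.1.1.1.

Definition quat_inv q : quat R := quat_real (sqn q)^-1 * quat_conj q.

Lemma quat_addE (a0 a1 a2 a3 b0 b1 b2 b3 : R) :
  ((a0, a1, a2, a3) : quat R) + ((b0, b1, b2, b3) : quat R) =
  (a0 + b0, a1 + b1, a2 + b2, a3 + b3).
Proof. by []. Qed.

Lemma quat_oppE (a0 a1 a2 a3 : R) :
  - ((a0, a1, a2, a3) : quat R) = (- a0, - a1, - a2, - a3).
Proof. by []. Qed.

Lemma quat_mulE (a0 a1 a2 a3 b0 b1 b2 b3 : R) :
  ((a0, a1, a2, a3) : quat R) * ((b0, b1, b2, b3) : quat R) =
  (a0 * b0 - a1 * b1 - a2 * b2 - a3 * b3,
   a0 * b1 + a1 * b0 + a2 * b3 - a3 * b2,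
   a0 * b2 - a1 * b3 + a2 * b0 + a3 * b1,
   a0 * b3 + a1 * b2 - a2 * b1 + a3 * b0).
Proof. by []. Qed.

Lemma quat_zeroE : (0 : quat R) = (0, 0, 0, 0).
Proof. by []. Qed.

Lemma quat_oneE : (1 : quat R) = (1, 0, 0, 0).
Proof. by []. Qed.

(** Euler's four-square identity. *)
Lemma sqnM p q : sqn (p * q) = sqn p * sqn q.
Proof.
case: p q => [[[a0 a1] a2] a3] [[[b0 b1] b2] b3].
by rewrite quat_mulE /quat_sqnorm; ring.
Qed.

Lemma sqn0 : sqn 0 = 0.
Proof. by rewrite quat_zeroE /quat_sqnorm; ring. Qed.

Lemma sqn1 : sqn 1 = 1.
Proof. by rewrite quat_oneE /quat_sqnorm; ring. Qed.

Lemma sqnN q : sqn (- q) = sqn q.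
Proof. by case: q => [[[a0 a1] a2] a3]; rewrite quat_oppE /quat_sqnorm; ring. Qed.

Lemma sqn_ge0 q : 0 <= sqn q.
Proof.
by case: q => [[[a0 a1] a2] a3]; rewrite /quat_sqnorm !addr_ge0 ?sqr_ge0.
Qed.

Lemma sqn_eq0 q : (sqn q == 0) = (q == 0).
Proof.
apply/eqP/eqP => [|->]; last exact: sqn0.
case: q => [[[a0 a1] a2] a3]; rewrite /quat_sqnorm => /eqP.
rewrite !paddr_eq0 ?addr_ge0 ?sqr_ge0// !sqrf_eq0.
by move=> /andP[/andP[/andP[/eqP-> /eqP->] /eqP->] /eqP->].
Qed.

Lemma sqn_gt0 q : (0 < sqn q) = (q != 0).
Proof. by rewrite lt_def sqn_ge0 andbT sqn_eq0. Qed.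

Lemma sqn_conj q : sqn (quat_conj q) = sqn q.
Proof. by case: q => [[[a0 a1] a2] a3]; rewrite /quat_sqnorm/=; ring. Qed.

Lemma sqn_real k : sqn (quat_real k) = k ^+ 2.
Proof. by rewrite /quat_sqnorm/=; ring. Qed.

Lemma quat_conjK q : quat_conj (quat_conj q) = q.
Proof. by case: q => [[[a0 a1] a2] a3]; rewrite /= !opprK. Qed.

Lemma quat_conjM p q : quat_conj (p * q) = quat_conj q * quat_conj p.
Proof.
case: p q => [[[a0 a1] a2] a3] [[[b0 b1] b2] b3].
by rewrite quat_mulE /= quat_mulE; apply: quat_eq; ring.
Qed.

Lemma mul_quat_conj q : q * quat_conj q = quat_real (sqn q).
Proof.
by case: q => [[[a0 a1] a2] a3]; rewrite /= quat_mulE; apply: quat_eq; ring.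
Qed.

Lemma mul_conj_quat q : quat_conj q * q = quat_real (sqn q).
Proof. by rewrite -{2}[q]quat_conjK mul_quat_conj sqn_conj. Qed.

Lemma quat_realM k l : quat_real (k * l) = quat_real k * quat_real l.
Proof. by rewrite quat_mulE; apply: quat_eq; ring. Qed.

Lemma quat_real1 : quat_real 1 = 1.
Proof. by []. Qed.

Lemma quat_realC k q : quat_real k * q = q * quat_real k.
Proof.
by case: q => [[[a0 a1] a2] a3]; rewrite !quat_mulE; apply: quat_eq; ring.
Qed.

Lemma quat_mulV q : q != 0 -> q * quat_inv q = 1.
Proof.
rewrite -sqn_eq0 => q0; rewrite /quat_inv mulrA -quat_realC -mulrA.
by rewrite mul_quat_conj -quat_realM mulVf.
Qed.

Lemma quat_Vmul q : q != 0 -> quat_inv q * q = 1.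
Proof.
rewrite -sqn_eq0 => q0; rewrite /quat_inv -mulrA mul_conj_quat.
by rewrite -quat_realM mulVf.
Qed.

Lemma sqnV q : q != 0 -> sqn (quat_inv q) = (sqn q)^-1.
Proof.
move=> q0; apply: (mulfI (x := sqn q)); first by rewrite sqn_eq0.
by rewrite -sqnM quat_mulV// sqn1 divff// sqn_eq0.
Qed.

End QuaternionAlgebra.

(** * Lebesgue measure under elementary maps of R and R^4 *)

Section LebesgueMeasureInvariance.
Context {R : realType}.
Local Notation mu := (@lebesgue_measure R).

(** Half-open intervals determine Lebesgue measure; uniqueness is applied to the image measure
    divided by [c]. *)
Lemma scaling_itv c (f : R -> R) : 0 < c -> measurable_fun setT f ->
  (forall a b : R, a < b ->
    mu (f @^-1` `]a, b]%classic) = (c * (b - a))%:E) ->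
  scaling c mu mu f.
Proof.
move=> c0 mf fab; split=> // A mA.
have ci0 : 0 <= c^-1 by rewrite invr_ge0 ltW.
pose m : {measure set (measurableTypeR R) -> \bar R} :=
  mscale (NngNum ci0)
      (@image_measure _ _ _ _ (measurableTypeR R) mu f mf).
have mE : mu A = m A.
  apply: lebesgue_measure_unique => // _ [[a b]] _ <- /=.
  rewrite /m /mscale /= /pushforward.
  have [ab|ba] := ltP a b.
    by rewrite fab// -EFinM mulrA mulVf ?gt_eqF// mul1r lebesgue_measure_itv/= lte_fin ab EFinB.
  by rewrite set_itv_ge -?leNgt ?bnd_simp// preimage_set0 !measure0 mule0.
transitivity (c%:E * m A)%E; last by rewrite -mE.
by rewrite /m /mscale /= /pushforward muleA -EFinM divff ?gt_eqF// mul1e.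
Qed.

Lemma scaling_addR a : scaling 1 mu mu (fun x => a + x).
Proof.
apply: scaling_itv => // [|b c bc]; first exact: measurable_funD.
rewrite (_ : _ @^-1` _ = `]b - a, c - a]%classic); last first.
  by apply/seteqP; split=> x /=; rewrite !in_itv/= => /andP[? ?]; apply/andP; split; lra.
rewrite lebesgue_measure_itv/= lte_fin ltrD2r bc -EFinB; congr EFin; ring.
Qed.

Lemma scaling_oppR : scaling 1 mu mu (fun x => - x).
Proof.
apply: scaling_itv => // [|b c bc]; first exact: measurable_funN.
rewrite (_ : _ @^-1` _ = `[- c, - b[%classic); last first.
  by apply/seteqP; split=> x /=; rewrite !in_itv/= => /andP[? ?]; apply/andP; split; lra.
rewrite lebesgue_measure_itv/= lte_fin ltrN2 bc -EFinB; congr EFin; ring.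
Qed.

Lemma scaling_mulR k : 0 < k -> scaling k^-1 mu mu (fun x => k * x).
Proof.
move=> k0; apply: scaling_itv => // [||b c bc]; first by rewrite invr_gt0.
  exact: mulrl_measurable.
rewrite (_ : _ @^-1` _ = `](b / k), (c / k)]%classic); last first.
  apply/seteqP; split=> x /=; rewrite !in_itv/= ltr_pdivrMr// ler_pdivlMr//;
  by rewrite ![x * _]mulrC.
rewrite lebesgue_measure_itv/= lte_fin ltr_pM2r ?invr_gt0// bc -EFinB.
by congr EFin; ring.
Qed.

Definition quat_lebesgue : {sigma_finite_measure set (quat R) -> \bar R} :=
  sprod (sprod (sprod mu mu) mu) mu.
Local Notation lam := quat_lebesgue.

Lemma scaling_quat c (f0 f1 f2 f3 : R -> R) : 0 <= c ->
  scaling c mu mu f0 -> scaling c mu mu f1 -> scaling c mu mu f2 ->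
  scaling c mu mu f3 ->
  scaling (c ^+ 4) lam lam
    (fun q : quat R => (f0 q.1.1.1, f1 q.1.1.2, f2 q.1.2, f3 q.2) : quat R).
Proof.
move=> c0 s0 s1 s2 s3; rewrite (_ : c ^+ 4 = c * c * c * c); last by ring.
have cc0 : 0 <= c * c by exact: mulr_ge0.
have ccc0 : 0 <= c * c * c by exact: mulr_ge0.
exact: scaling_prod ccc0 c0 (scaling_prod cc0 c0 (scaling_prod c0 c0 s0 s1) s2) s3.
Qed.

Lemma scaling_quat_add a : scaling 1 lam lam (fun x => a + x).
Proof.
case: a => [[[a0 a1] a2] a3].
have := scaling_quat ler01 (scaling_addR a0) (scaling_addR a1) (scaling_addR a2)
  (scaling_addR a3).
by rewrite expr1n; congr scaling; apply/funext => -[[[x0 x1] x2] x3].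
Qed.

Lemma scaling_quat_opp : scaling 1 lam lam (fun x => - x).
Proof.
have := scaling_quat ler01 scaling_oppR scaling_oppR scaling_oppR scaling_oppR.
by rewrite expr1n; congr scaling; apply/funext => -[[[x0 x1] x2] x3].
Qed.

Lemma scaling_quat_conj : scaling 1 lam lam (@quat_conj R).
Proof.
have := scaling_quat ler01 (scaling_id mu) scaling_oppR scaling_oppR scaling_oppR.
by rewrite expr1n; congr scaling; apply/funext => -[[[x0 x1] x2] x3].
Qed.

Lemma scaling_quat_real k : 0 < k ->
  scaling (k ^- 4) lam lam (fun x => quat_real k * x).
Proof.
move=> k0; have ki : 0 <= k^-1 by rewrite invr_ge0 ltW.
have := scaling_quat ki (scaling_mulR k0) (scaling_mulR k0) (scaling_mulR k0)
  (scaling_mulR k0).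
rewrite exprVn; congr scaling; apply/funext => -[[[x0 x1] x2] x3] /=.
by rewrite quat_mulE; apply: quat_eq; ring.
Qed.

End LebesgueMeasureInvariance.

Section MeasurabilityOfQuaternionOperations.
Context {R : realType}.
Local Notation sqn := (@quat_sqnorm R).

Lemma measurable_invr : measurable_fun [set: R] (@GRing.inv R).
Proof.
rewrite -(setUv [set 0]); apply/measurable_funU => //.
  by apply: measurableC; exact: measurable_set1.
split; first exact: measurable_fun_set1.
apply: open_continuous_measurable_fun.
  by apply: closed_openC; apply: accessible_closed_set1; exact: hausdorff_accessible.
by apply/in_setP => x /= /eqP x0; exact: inv_continuous.
Qed.

Lemma measurable_sqrt : measurable_fun [set: R] (@Num.sqrt R).
Proof. by apply: continuous_measurable_fun; exact: sqrt_continuous. Qed.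

Context d (T : measurableType d).
Implicit Types f g : T -> quat R.

Lemma measurable_quat_tuple (f0 f1 f2 f3 : T -> R) :
  measurable_fun setT f0 -> measurable_fun setT f1 -> measurable_fun setT f2 ->
  measurable_fun setT f3 ->
  measurable_fun setT (fun x => (f0 x, f1 x, f2 x, f3 x) : quat R).
Proof.
move=> m0 m1 m2 m3.
by do 3!(apply: measurable_fun_pair => //).
Qed.

Lemma measurable_quat_coords f : measurable_fun setT f ->
  [/\ measurable_fun setT (fun x => (f x).1.1.1 : R),
      measurable_fun setT (fun x => (f x).1.1.2 : R),
      measurable_fun setT (fun x => (f x).1.2 : R) &
      measurable_fun setT (fun x => (f x).2 : R)].
Proof.
move=> mf.
have m3 := measurableT_comp (@measurable_fst _ _ _ _) mf.
have m2 := measurableT_comp (@measurable_fst _ _ _ _) m3.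
split; first exact: measurableT_comp (@measurable_fst _ _ _ _) m2.
- exact: measurableT_comp (@measurable_snd _ _ _ _) m2.
- exact: measurableT_comp (@measurable_snd _ _ _ _) m3.
- exact: measurableT_comp (@measurable_snd _ _ _ _) mf.
Qed.

Lemma measurable_quat_add f g : measurable_fun setT f -> measurable_fun setT g ->
  measurable_fun setT (fun x => f x + g x).
Proof.
move=> /measurable_quat_coords[f0 f1 f2 f3] /measurable_quat_coords[g0 g1 g2 g3].
have := measurable_quat_tuple (measurable_funD f0 g0) (measurable_funD f1 g1)
  (measurable_funD f2 g2) (measurable_funD f3 g3).
by congr measurable_fun; apply/funext => x /=; case: (f x) (g x) => [[[? ?] ?] ?] [[[? ?] ?] ?].
Qed.

Lemma measurable_quat_mul f g : measurable_fun setT f -> measurable_fun setT g ->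
  measurable_fun setT (fun x => f x * g x).
Proof.
move=> /measurable_quat_coords[f0 f1 f2 f3] /measurable_quat_coords[g0 g1 g2 g3].
rewrite (_ : (fun x => _) = fun x =>
  ((f x).1.1.1 * (g x).1.1.1 - (f x).1.1.2 * (g x).1.1.2
     - (f x).1.2 * (g x).1.2 - (f x).2 * (g x).2,
   (f x).1.1.1 * (g x).1.1.2 + (f x).1.1.2 * (g x).1.1.1
     + (f x).1.2 * (g x).2 - (f x).2 * (g x).1.2,
   (f x).1.1.1 * (g x).1.2 - (f x).1.1.2 * (g x).2
     + (f x).1.2 * (g x).1.1.1 + (f x).2 * (g x).1.1.2,
   (f x).1.1.1 * (g x).2 + (f x).1.1.2 * (g x).1.2
     - (f x).1.2 * (g x).1.1.2 + (f x).2 * (g x).1.1.1)); last first.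
  by apply/funext => x; case: (f x) (g x) => [[[? ?] ?] ?] [[[? ?] ?] ?].
by apply: measurable_quat_tuple;
  repeat (apply: measurable_funB || apply: measurable_funD || apply: measurable_funM).
Qed.

Lemma measurable_quat_conj f : measurable_fun setT f ->
  measurable_fun setT (fun x => quat_conj (f x)).
Proof.
move=> /measurable_quat_coords[f0 f1 f2 f3].
have := measurable_quat_tuple f0 (measurable_funN f1) (measurable_funN f2)
  (measurable_funN f3).
by congr measurable_fun; apply/funext => x /=; case: (f x) => [[[? ?] ?] ?].
Qed.

Lemma measurable_quat_real (k : T -> R) : measurable_fun setT k ->
  measurable_fun setT (fun x => quat_real (k x)).
Proof. by move=> mk; apply: measurable_quat_tuple. Qed.

Lemma measurable_quat_opp f : measurable_fun setT f ->
  measurable_fun setT (fun x => - f x).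
Proof.
move=> /measurable_quat_coords[f0 f1 f2 f3].
have := measurable_quat_tuple (measurable_funN f0) (measurable_funN f1)
  (measurable_funN f2) (measurable_funN f3).
by congr measurable_fun; apply/funext => x /=; case: (f x) => [[[? ?] ?] ?].
Qed.

Lemma measurable_sqn f : measurable_fun setT f ->
  measurable_fun setT (fun x => sqn (f x)).
Proof.
move=> /measurable_quat_coords[f0 f1 f2 f3].
have := measurable_funD (measurable_funD (measurable_funD
  (measurable_funX 2 f0) (measurable_funX 2 f1)) (measurable_funX 2 f2))
  (measurable_funX 2 f3).
by congr measurable_fun; apply/funext => x /=; case: (f x) => [[[? ?] ?] ?].
Qed.

Lemma measurable_quat_re f : measurable_fun setT f ->
  measurable_fun setT (fun x => quat_re (f x)).
Proof. by case/measurable_quat_coords. Qed.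

End MeasurabilityOfQuaternionOperations.

(** * Multiplication by a quaternion as a map of R^4 *)

Section QuaternionScaling.
Context {R : realType}.
Local Notation sqn := (@quat_sqnorm R).
Local Notation mu := (@lebesgue_measure R).
Local Notation lam := (@quat_lebesgue R).

Lemma sprodE d1 d2 (T1 : measurableType d1) (T2 : measurableType d2)
    (m1 : {sigma_finite_measure set T1 -> \bar R})
    (m2 : {sigma_finite_measure set T2 -> \bar R}) A B :
  measurable A -> measurable B -> sprod m1 m2 (A `*` B) = (m1 A * m2 B)%E.
Proof. by move=> mA mB; exact: product_measure1E. Qed.

Definition quat_box (r : R) : set (quat R) :=
  `[- r, r]%classic `*` `[- r, r]%classic `*` `[- r, r]%classic `*` `[- r, r]%classic.

Lemma measurable_quat_box r : measurable (quat_box r).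
Proof. by do 3!(apply: measurableX => //). Qed.

Lemma quat_lebesgue_box r : 0 < r -> lam (quat_box r) = ((r *+ 2) ^+ 4)%:E.
Proof.
move=> r0; rewrite /quat_lebesgue /quat_box.
have mi : (mu : {sigma_finite_measure set _ -> \bar R}) `[- r, r]%classic =
    (r *+ 2)%:E.
  rewrite [LHS]lebesgue_measure_itv/= lte_fin gtrN// -EFinD; congr EFin.
  by rewrite opprK -mulr2n.
rewrite !sprodE//; do ?exact: measurableX.
  by rewrite mi -!EFinM; congr EFin; ring.
by do 2!(apply: measurableX => //).
Qed.

Definition quat_ball (r : R) : set (quat R) := [set x | sqn x <= r].

Lemma measurable_quat_ball r : measurable (quat_ball r).
Proof.
have /(_ measurableT `]-oo, r]%classic) := measurable_sqn (@measurable_id _ (quat R) setT).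
rewrite setTI => /(_ (measurable_itv _)); congr measurable.
Qed.

Lemma quat_ball_lty : (lam (quat_ball 1) < +oo)%E.
Proof.
apply: (@le_lt_trans _ _ (lam (quat_box 1))); last first.
  by rewrite quat_lebesgue_box// ltry.
apply: le_measure; rewrite ?inE; [exact: measurable_quat_ball|exact: measurable_quat_box|].
move=> [[[a b] c] e]; rewrite /quat_ball /quat_box /= => h.
by rewrite !in_itv/=; do !split; apply/andP; split; nra.
Qed.

Lemma quat_ball_gt0 : (0 < lam (quat_ball 1))%E.
Proof.
(* The corners of the cube of half-side 1/2 have squared norm 4 * 1/4 = 1. *)
apply: (@lt_le_trans _ _ (lam (quat_box 2^-1))).
  by rewrite quat_lebesgue_box// lte_fin.
apply: le_measure; rewrite ?inE; [exact: measurable_quat_box|exact: measurable_quat_ball|].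
move=> [[[a b] c] e]; rewrite /quat_ball /quat_box /= !in_itv/=.
by move=> [[[/andP[? ?] /andP[? ?]] /andP[? ?]] /andP[? ?]]; nra.
Qed.

(* Translation invariance of both measures makes [(x, y) |-> (x, x + y)] and
   [(x, y) |-> (x - y, y)] preserve the product; they relate
   [S `*` A] to the set of pairs with [x \in S] and [x + y \in A]. *)
Lemma quat_lebesgue_unique (nu : {sigma_finite_measure set (quat R) -> \bar R}) :
  (forall a, scaling 1 nu nu (fun x => a + x)) ->
  forall S A, measurable S -> measurable A ->
  (nu S * lam A = nu A * lam S)%E.
Proof.
move=> nuinv S A mS mA.
have m1 : measurable_fun setT (fun p : quat R * quat R => p.1 + p.2).
  by apply: measurable_quat_add; [exact: measurable_fst|exact: measurable_snd].
have m3 : measurable_fun setT (fun p : quat R * quat R => p.1 - p.2).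
  apply: measurable_quat_add; first exact: measurable_fst.
  by apply: measurable_quat_opp; exact: measurable_snd.
have := scaling_skew (g := fun x y : quat R => x + y) ler01 ler01
  (scaling_id nu) m1 (@scaling_quat_add R).
rewrite mulr1 => s1.
have negtr a : scaling 1 lam lam (fun x => a - x).
  have := scaling_comp (@scaling_quat_opp R) (scaling_quat_add a).
  by rewrite mulr1.
have := scaling_skew (g := fun x y : quat R => x - y) ler01 ler01
  (scaling_id nu) m3 negtr.
rewrite mulr1 => s3.
have m2' : measurable_fun setT (fun p : quat R * quat R => - p.1 + p.2).
  apply: measurable_quat_add; last exact: measurable_snd.
  by apply: measurable_quat_opp; exact: measurable_fst.
have := scaling_skew (g := fun x y : quat R => - x + y) ler01 ler01
  (scaling_id lam) m2' (fun x => nuinv (- x)).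
rewrite mulr1 => s2.
have := scaling_comp (scaling_comp (scaling_swap nu lam) s2) (scaling_swap lam nu).
rewrite !mulr1 => s2'.
rewrite -[LHS](sprodE nu lam mS mA) -[RHS](sprodE nu lam mA mS).
have mSA : measurable (S `*` A) by exact: measurableX.
have mAS : measurable (A `*` S) by exact: measurableX.
set f1 := (fun p => (p.1, p.1 + p.2)) in s1.
set f3 := (fun p => (p.1, p.1 - p.2)) in s3.
set f2 := (fun p => (p.2, p.1)) \o _ in s2'.
have mB : measurable (f1 @^-1` (S `*` A)).
  by rewrite -[X in measurable X]setTI; exact: s1.1.
transitivity (sprod nu lam (f1 @^-1` (S `*` A))).
  by rewrite (s1.2 _ mSA) mul1e.
transitivity (sprod nu lam (f2 @^-1` (f1 @^-1` (S `*` A)))).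
  by rewrite (s2'.2 _ mB) mul1e.
transitivity (sprod nu lam (f3 @^-1` (A `*` S))); last first.
  by rewrite (s3.2 _ mAS) mul1e.
congr (sprod nu lam _); apply/seteqP; split=> -[x y].
  by rewrite /f1 /f2 /f3 /= [- y + x]addrC subrK => -[? ?].
by rewrite /f1 /f2 /f3 /= [- y + x]addrC subrK => -[? ?].
Qed.

(** The image of [lam] under multiplication by [q] is again translation invariant, hence a multiple
    of [lam]. The factor is read off the unit ball, on which [q] has the same preimage as the real
    dilation by [|q|]; the dilation contributes [|q|^-4]. *)
Lemma scaling_quat_mull (q : quat R) : q != 0 ->
  scaling (sqn q ^- 2) lam lam (fun x => q * x).
Proof.
move=> q0.
have q1 : sqn q != 0 by rewrite sqn_eq0.
have mq a : measurable_fun setT (fun x : quat R => a * x).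
  by apply: measurable_quat_mul; [exact: measurable_cst|exact: measurable_id].
pose m := image_measure lam (mq q).
have sf : sigma_finite setT m.
  have /sigma_finiteP[F [TF ndF Foo]] := sigma_finiteT lam.
  exists (fun n => (fun x => quat_inv q * x) @^-1` F n).
    by rewrite -preimage_bigcup -TF preimage_setT.
  move=> n; have [mF Fn] := Foo n; split.
    by rewrite -[X in measurable X]setTI; exact: (mq _).
  rewrite /m /image_measure /= /pushforward -comp_preimage.
  rewrite (_ : _ \o _ = id)// funeqE => x /=; by rewrite mulrA quat_Vmul// mul1r.
pose nu := pack_sigma_finite sf.
have nuinv a : scaling 1 nu nu (fun x => a + x).
  split=> [|A mA]; first exact: (scaling_quat_add a).1.
  rewrite mul1e /nu /= /pushforward.
  have mA' : measurable ((fun x => q * x) @^-1` A).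
    by rewrite -[X in measurable X]setTI; exact: (mq _).
  have := (scaling_quat_add (quat_inv q * a)).2 _ mA'; rewrite mul1e => <-.
  by congr (lam _); apply/seteqP; split=> x /=; rewrite mulrDr mulrA quat_mulV// mul1r.
split; first exact: (mq q).
move=> A mA.
have := quat_lebesgue_unique nuinv (measurable_quat_ball 1) mA.
have k0 : 0 < Num.sqrt (sqn q) by rewrite sqrtr_gt0 sqn_gt0.
have -> : nu (quat_ball 1) = ((sqn q ^- 2)%:E * lam (quat_ball 1))%E.
  have := (scaling_quat_real k0).2 _ (measurable_quat_ball 1).
  rewrite (_ : Num.sqrt (sqn q) ^- 4 = sqn q ^- 2); last first.
    by rewrite (_ : 4%N = (2 * 2)%N)// exprM sqr_sqrtr// sqn_ge0.
  move=> <-; rewrite /nu /= /pushforward; congr (lam _).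
  by apply/seteqP; split=> x; rewrite /quat_ball /= !sqnM sqn_real sqr_sqrtr// sqn_ge0.
have Bfin : lam (quat_ball 1) \is a fin_num.
  by rewrite ge0_fin_numE// quat_ball_lty.
have := quat_ball_gt0; rewrite -(fineK Bfin) lte_fin => l0 h.
transitivity (nu A * (fine (lam (quat_ball 1)))%:E *
    (fine (lam (quat_ball 1)))^-1%:E)%E.
  by rewrite -muleA -EFinM divff ?gt_eqF// mule1.
by rewrite -h [X in (X * _)%E]muleAC -[LHS]muleA -EFinM divff ?gt_eqF// mule1.
Qed.

(** Conjugation preserves [lam] and exchanges left and right multiplication. *)
Lemma scaling_quat_mulr (q : quat R) : q != 0 ->
  scaling (sqn q ^- 2) lam lam (fun x => x * q).
Proof.
move=> q0; have q1 : quat_conj q != 0 by rewrite -sqn_eq0 sqn_conj sqn_eq0.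
have := scaling_comp (scaling_comp (@scaling_quat_conj R) (scaling_quat_mull q1))
  (@scaling_quat_conj R).
rewrite mul1r mulr1 sqn_conj; congr scaling.
by apply/funext => x /=; rewrite quat_conjM !quat_conjK.
Qed.

End QuaternionScaling.

(** * Quaternion matrices *)

Section BlockScaling.
Context {R : realType} d (T : measurableType d).
Variables (mu : {sigma_finite_measure set T -> \bar R}) (add : T -> T -> T).
Hypothesis madd : forall d' (T' : measurableType d') (f g : T' -> T),
  measurable_fun setT f -> measurable_fun setT g ->
  measurable_fun setT (fun x => add (f x) (g x)).
Hypothesis scaling_add : forall u, scaling 1 mu mu (add u).

Let measurable_comp_fst (f : T -> T) : measurable_fun setT f ->
  measurable_fun setT (fun p : T * T => f p.1).
Proof. by move=> mf; exact: measurableT_comp mf (@measurable_fst _ _ _ _). Qed.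

Let measurable_comp_snd (f : T -> T) : measurable_fun setT f ->
  measurable_fun setT (fun p : T * T => f p.2).
Proof. by move=> mf; exact: measurableT_comp mf (@measurable_snd _ _ _ _). Qed.

(** Stated for an abstract addition because it is used at two levels: on the entries of a column,
    for left multiplication, and on the columns of a matrix, for right multiplication. *)
Lemma scaling_shear c c' (f s e : T -> T) : 0 <= c -> 0 <= c' ->
  scaling c mu mu f -> scaling c' mu mu s -> measurable_fun setT e ->
  scaling (c * c') (sprod mu mu) (sprod mu mu)
    (fun p => (f p.1, add (e p.1) (s p.2))).
Proof.
move=> c0 c'0 sf ss me.
apply: (scaling_skew (g := fun x y => add (e x) (s y))) => //.
  by apply: madd; [exact: measurable_comp_fst|apply: measurable_comp_snd; exact: ss.1].
by move=> x; have := scaling_comp ss (scaling_add (e x)); rewrite mulr1.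
Qed.

Lemma scaling_antishear c c' (f s e : T -> T) : 0 <= c -> 0 <= c' ->
  scaling c mu mu f -> scaling c' mu mu s -> measurable_fun setT e ->
  scaling (c * c') (sprod mu mu) (sprod mu mu)
    (fun p => (f p.2, add (e p.2) (s p.1))).
Proof.
move=> c0 c'0 sf ss me.
have := scaling_comp (scaling_swap mu mu) (scaling_shear c0 c'0 sf ss me).
by rewrite mul1r.
Qed.

(** The LU factorisation of a 2x2 block map: [u] is the new first coordinate, and the second is
    expressed through [u] and the old second one. Each of the two antishears exchanges the factors,
    so the exchanges cancel. *)
Lemma scaling_pivot c c' (f s e b : T -> T) : 0 <= c -> 0 <= c' ->
  scaling c mu mu f -> scaling c' mu mu s ->
  measurable_fun setT e -> measurable_fun setT b ->
  scaling (c * c') (sprod mu mu) (sprod mu mu)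
    (fun p => let u := add (b p.2) (f p.1) in (u, add (e u) (s p.2))).
Proof.
move=> c0 c'0 sf ss me mb.
have s1 := scaling_antishear ler01 c0 (scaling_id mu) sf mb.
have s2 := scaling_antishear ler01 c'0 (scaling_id mu) ss me.
by have := scaling_comp s1 s2; rewrite !mul1r.
Qed.

End BlockScaling.

Section Matrices.
Context {R : realType}.
Local Notation sqn := (@quat_sqnorm R).
Local Notation lam := (@quat_lebesgue R).
Local Notation vec := (quat R * quat R)%type.
Local Notation mat := (vec * vec)%type.
Implicit Types (g h k : mat) (u v w : vec) (a : quat R).

(* [((a, c), (b, d))] stands for the matrix with columns [(a, c)], [(b, d)] *)
Definition mat_vec g v : vec :=
  (g.1.1 * v.1 + g.2.1 * v.2, g.1.2 * v.1 + g.2.2 * v.2).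

Definition mat_mul g h : mat := (mat_vec g h.1, mat_vec g h.2).

Definition mat_one : mat := ((1, 0), (0, 1)).

Definition vec_scale v a : vec := (v.1 * a, v.2 * a).

(** The Study determinant, that is the determinant of [complex_rep] as a real polynomial in the
    entries (see [det_complex_rep]). *)
Definition mat_norm g : R :=
  sqn g.1.1 * sqn g.2.2 + sqn g.2.1 * sqn g.1.2 -
  2 * quat_re (g.1.1 * quat_conj g.1.2 * g.2.2 * quat_conj g.2.1).

(** The inverse multiplied by [mat_norm g]. Having no division, it is polynomial and preserves
    Hurwitz entries. *)
Definition mat_adj g : mat :=
  let: ((a, c), (b, d)) := g in
  ((quat_conj a * (d * quat_conj d) - quat_conj c * d * quat_conj b,
    quat_conj b * (c * quat_conj c) - quat_conj d * c * quat_conj a),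
   (quat_conj c * (b * quat_conj b) - quat_conj a * b * quat_conj d,
    quat_conj d * (a * quat_conj a) - quat_conj b * a * quat_conj c)).

Lemma mat_vecD g u v : mat_vec g (u + v) = mat_vec g u + mat_vec g v.
Proof.
by case: u v => [u1 u2] [v1 v2]; rewrite /mat_vec /= !mulrDr; congr pair;
  rewrite addrACA.
Qed.

Lemma mat_vec_scale g v a : mat_vec g (vec_scale v a) = vec_scale (mat_vec g v) a.
Proof. by rewrite /mat_vec /vec_scale /= !mulrDl !mulrA. Qed.

Lemma mat_vecE g v : mat_vec g v = vec_scale g.1 v.1 + vec_scale g.2 v.2.
Proof. by []. Qed.

Lemma mat_vec_mul g h v : mat_vec (mat_mul g h) v = mat_vec g (mat_vec h v).
Proof. by rewrite [in RHS](mat_vecE h) mat_vecD !mat_vec_scale. Qed.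

Lemma mat_mulA g h k : mat_mul g (mat_mul h k) = mat_mul (mat_mul g h) k.
Proof. by rewrite /mat_mul !mat_vec_mul. Qed.

Lemma mat_vec1 v : mat_vec mat_one v = v.
Proof. by case: v => x y; rewrite /mat_vec /= !mul1r !mul0r addr0 add0r. Qed.

Lemma mat_mul1 g : mat_mul mat_one g = g.
Proof. by rewrite /mat_mul !mat_vec1; case: g. Qed.

Lemma mat_mulr1 g : mat_mul g mat_one = g.
Proof.
by case: g => -[a c] [b d]; rewrite /mat_mul /mat_vec /= !mulr1 !mulr0 !addr0 !add0r.
Qed.

Lemma quat_reC (x y : quat R) : quat_re (x * y) = quat_re (y * x).
Proof.
case: x y => [[[a0 a1] a2] a3] [[[b0 b1] b2] b3].
by rewrite !quat_mulE /quat_re /=; ring.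
Qed.

Lemma quat_re_conj (x : quat R) : quat_re (quat_conj x) = quat_re x.
Proof. by case: x => [[[a0 a1] a2] a3]. Qed.

Lemma quat_add_conj (x : quat R) : x + quat_conj x = quat_real (2 * quat_re x).
Proof.
by case: x => [[[a0 a1] a2] a3]; rewrite quat_addE; apply: quat_eq; rewrite /quat_re /=; ring.
Qed.

Lemma quat_realD (r s : R) : quat_real (r + s) = quat_real r + quat_real s.
Proof. by rewrite quat_addE; apply: quat_eq; ring. Qed.

Lemma quat_realB (r s : R) : quat_real (r - s) = quat_real r - quat_real s.
Proof. by rewrite quat_oppE quat_addE; apply: quat_eq; ring. Qed.

Lemma mat_mul_adj g : mat_mul g (mat_adj g) =
  ((quat_real (mat_norm g), 0), (0, quat_real (mat_norm g))).
Proof.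
case: g => -[a c] [b d].
(* A norm [p * quat_conj p] is real and therefore central. *)
have swap (x y p : quat R) : x * (y * (p * quat_conj p)) = p * (quat_conj p * x * y).
  by rewrite mul_quat_conj -quat_realC mulrA -quat_realC -mulrA -mul_quat_conj !mulrA.
have nn (x y : quat R) : x * (quat_conj x * (y * quat_conj y)) =
    quat_real (sqn x * sqn y).
  by rewrite mulrA !mul_quat_conj quat_realM.
have offdiag (x y : quat R) : x - y + (y - x) = 0 by rewrite subrKA subrr.
have diag r s (z : quat R) : quat_real r - z + (quat_real s - quat_conj z) =
    quat_real (r + s - 2 * quat_re z).
  by rewrite addrACA -opprD quat_add_conj quat_realB quat_realD.
rewrite /mat_mul /mat_vec /mat_norm /= !mulrBr !nn.
rewrite (swap c (quat_conj a) d) (swap d (quat_conj b) c).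
rewrite (swap a (quat_conj c) b) (swap b (quat_conj d) a) !offdiag.
have -> : b * (quat_conj d * c * quat_conj a) =
    quat_conj (a * (quat_conj c * d * quat_conj b)).
  by rewrite !quat_conjM !quat_conjK !mulrA.
have -> : d * (quat_conj b * a * quat_conj c) =
    quat_conj (c * (quat_conj a * b * quat_conj d)).
  by rewrite !quat_conjM !quat_conjK !mulrA.
rewrite !diag; congr (quat_real _, _, (_, quat_real _)); first by rewrite !mulrA.
have -> : quat_re (c * (quat_conj a * b * quat_conj d)) =
    quat_re (a * quat_conj c * d * quat_conj b).
  rewrite -quat_re_conj !quat_conjM !quat_conjK -[in RHS]mulrA [RHS]quat_reC.
  by rewrite !mulrA.
by congr (_ - _); rewrite addrC [sqn d * _]mulrC [sqn c * _]mulrC.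
Qed.

Lemma sqnB_real (x y : quat R) (k : R) :
  sqn (x - quat_real k * y) =
  sqn x + k ^+ 2 * sqn y - 2 * k * quat_re (quat_conj x * y).
Proof.
case: x y => [[[a0 a1] a2] a3] [[[b0 b1] b2] b3].
by rewrite /quat_real /quat_conj !quat_mulE quat_oppE quat_addE /quat_re /quat_sqnorm /=; ring.
Qed.

(** The quaternion in the second factor is the Schur complement of the upper left entry. *)
Lemma mat_norm_pivot g : g.1.1 != 0 -> mat_norm g =
  sqn g.1.1 * sqn (g.2.2 - g.1.2 * quat_inv g.1.1 * g.2.1).
Proof.
move=> a0; have := a0; rewrite -sqn_eq0 => s0.
rewrite /quat_inv mulrA -quat_realC -!mulrA sqnB_real !sqnM sqn_conj.
have -> : quat_re (quat_conj g.2.2 * (g.1.2 * (quat_conj g.1.1 * g.2.1))) =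
    quat_re (g.1.1 * quat_conj g.1.2 * g.2.2 * quat_conj g.2.1).
  by rewrite -quat_re_conj !quat_conjM !quat_conjK -!mulrA quat_reC !mulrA.
by rewrite /mat_norm; field.
Qed.

Lemma mat_norm_antipivot g : g.1.1 = 0 -> mat_norm g = sqn g.2.1 * sqn g.1.2.
Proof.
move=> a0; rewrite /mat_norm a0 sqn0 !mul0r.
by rewrite /quat_re quat_zeroE /=; ring.
Qed.

Definition vec_lebesgue : {sigma_finite_measure set vec -> \bar R} :=
  sprod lam lam.

Definition mat_lebesgue : {sigma_finite_measure set mat -> \bar R} :=
  sprod vec_lebesgue vec_lebesgue.

Lemma invr_sqr_ge0 (r : R) : 0 <= r ^- 2.
Proof. by rewrite invr_ge0 sqr_ge0. Qed.

Lemma measurable_quat_mull (q : quat R) : measurable_fun setT (fun x : quat R => q * x).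
Proof.
by apply: measurable_quat_mul; [exact: measurable_cst|exact: measurable_id].
Qed.

(** As a real linear map of R^8, [mat_vec g] has determinant [mat_norm g ^+ 2]. A nonzero upper left
    entry allows the LU factorisation; otherwise the map is antitriangular. *)
Lemma mat_norm_scaling g : mat_norm g != 0 ->
  scaling (mat_norm g ^- 2) vec_lebesgue vec_lebesgue (mat_vec g).
Proof.
have madd := @measurable_quat_add R.
have tr := @scaling_quat_add R.
have [a0|a0] := eqVneq g.1.1 0 => N0.
  have := N0; rewrite mat_norm_antipivot// mulf_eq0 !sqn_eq0 negb_or => /andP[b0 c0].
  have := @scaling_antishear _ _ _ _ _ madd tr _ _ _ _ _
    (invr_sqr_ge0 _) (invr_sqr_ge0 _)
    (scaling_quat_mull b0) (scaling_quat_mull c0) (measurable_quat_mull g.2.2).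
  rewrite -invfM -exprMn; congr scaling; apply/funext => -[x y] /=.
  by rewrite /mat_vec /= a0 mul0r add0r addrC.
have := N0; rewrite mat_norm_pivot// mulf_eq0 !sqn_eq0 negb_or => /andP[_ s0].
have := @scaling_pivot _ _ _ _ _ madd tr _ _ _ _ _ _
    (invr_sqr_ge0 _) (invr_sqr_ge0 _)
    (scaling_quat_mull a0) (scaling_quat_mull s0)
    (measurable_quat_mull (g.1.2 * quat_inv g.1.1)) (measurable_quat_mull g.2.1).
rewrite -invfM -exprMn; congr scaling; apply/funext => -[x y] /=.
rewrite /mat_vec /= [g.2.1 * y + _]addrC; congr pair.
rewrite mulrDr mulrBl (_ : g.1.2 * quat_inv g.1.1 * (g.1.1 * x) = g.1.2 * x).
  by rewrite -addrA !mulrA; congr (_ + _); rewrite addrCA subrr addr0.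
by rewrite -mulrA [quat_inv _ * _]mulrA quat_Vmul// mul1r.
Qed.

End Matrices.

Section MatrixInvariance.
Context {R : realType}.
Local Notation sqn := (@quat_sqnorm R).
Local Notation vec := (quat R * quat R)%type.
Local Notation mat := (vec * vec)%type.
Implicit Types (g h k : mat) (u v w : vec) (a b c d : quat R).
Local Notation mlam := (@mat_lebesgue R).
Local Notation vlam := (@vec_lebesgue R).

Lemma scaling_mat_mull g : mat_norm g = 1 ->
  scaling 1 mlam mlam (mat_mul g).
Proof.
move=> N1; have N0 : mat_norm g != 0 by rewrite N1 oner_neq0.
have s := mat_norm_scaling N0.
have := scaling_prod (invr_sqr_ge0 _) (invr_sqr_ge0 _) s s.
by rewrite N1 expr1n invr1 mulr1.
Qed.

Lemma scaling_vec_add u : scaling 1 vlam vlam (+%R u).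
Proof.
have := scaling_prod ler01 ler01 (scaling_quat_add u.1) (scaling_quat_add u.2).
by rewrite mulr1; congr scaling; apply/funext => v; case: u v => [? ?] [? ?].
Qed.

Lemma scaling_vec_scale a : a != 0 ->
  scaling (sqn a ^- 4) vlam vlam (fun v => vec_scale v a).
Proof.
move=> a0; have s := scaling_quat_mulr a0.
have := scaling_prod (invr_sqr_ge0 _) (invr_sqr_ge0 _) s s.
by rewrite -invfM -exprD.
Qed.

Lemma measurable_vec_add disp (T : measurableType disp) (f g : T -> vec) :
  measurable_fun setT f -> measurable_fun setT g ->
  measurable_fun setT (fun x => f x + g x).
Proof.
move=> mf mg.
have f1 := measurableT_comp (@measurable_fst _ _ _ _) mf.
have f2 := measurableT_comp (@measurable_snd _ _ _ _) mf.
have g1 := measurableT_comp (@measurable_fst _ _ _ _) mg.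
have g2 := measurableT_comp (@measurable_snd _ _ _ _) mg.
exact: measurable_fun_pair (measurable_quat_add f1 g1) (measurable_quat_add f2 g2).
Qed.

Lemma measurable_vec_scale a : measurable_fun setT (fun v : vec => vec_scale v a).
Proof.
apply: measurable_fun_pair; apply: measurable_quat_mul.
- exact: measurable_fst.
- exact: measurable_cst.
- exact: measurable_snd.
- exact: measurable_cst.
Qed.

Lemma vec_scaleD v a b : vec_scale v (a + b) = vec_scale v a + vec_scale v b.
Proof. by case: v => x y; rewrite /vec_scale /= !mulrDr. Qed.

Lemma vec_scaleDl u v a : vec_scale (u + v) a = vec_scale u a + vec_scale v a.
Proof. by case: u v => [x y] [z t]; rewrite /vec_scale /= !mulrDl. Qed.

Lemma vec_scaleN v a : vec_scale v (- a) = - vec_scale v a.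
Proof. by case: v => x y; rewrite /vec_scale /= !mulrN. Qed.

Lemma vec_scaleA v a b : vec_scale (vec_scale v a) b = vec_scale v (a * b).
Proof. by case: v => x y; rewrite /vec_scale /= !mulrA. Qed.

Lemma vec_scale0 v : vec_scale v 0 = 0.
Proof. by case: v => x y; rewrite /vec_scale /= !mulr0. Qed.

Lemma vec_scale1 v : vec_scale v 1 = v.
Proof. by case: v => x y; rewrite /vec_scale /= !mulr1. Qed.

Lemma invr_exp_ge0 n (r : R) : 0 <= r -> 0 <= r ^- n.
Proof. by move=> r0; rewrite invr_ge0 exprn_ge0. Qed.

(** The factorisation used for [mat_norm_scaling], with whole columns as blocks. Together with
    [scaling_mat_mull] it plays the part of unimodularity in the uniqueness argument. *)
Lemma scaling_mat_mulr g : mat_norm g = 1 ->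
  scaling 1 mlam mlam (fun h => mat_mul h g).
Proof.
have madd := @measurable_vec_add.
have tr := scaling_vec_add.
have p4 a : 0 <= sqn a ^- 4 by apply: invr_exp_ge0; exact: sqn_ge0.
have [a0|a0] := eqVneq g.1.1 0 => N1.
  have : mat_norm g != 0 by rewrite N1 oner_neq0.
  rewrite mat_norm_antipivot// mulf_eq0 !sqn_eq0 negb_or => /andP[b0 c0].
  have := @scaling_antishear _ _ _ _ _ madd tr _ _ _ _ _
    (p4 _) (p4 _) (scaling_vec_scale c0) (scaling_vec_scale b0)
    (measurable_vec_scale g.2.2).
  rewrite -invfM -exprMn [sqn _ * _]mulrC -mat_norm_antipivot// N1 expr1n invr1.
  congr scaling; apply/funext => -[x y] /=.
  by rewrite /mat_mul !mat_vecE /= a0 vec_scale0 add0r addrC.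
have : mat_norm g != 0 by rewrite N1 oner_neq0.
rewrite mat_norm_pivot// mulf_eq0 !sqn_eq0 negb_or => /andP[_ s0].
have := @scaling_pivot _ _ _ _ _ madd tr _ _ _ _ _ _
    (p4 _) (p4 _) (scaling_vec_scale a0) (scaling_vec_scale s0)
    (measurable_vec_scale (quat_inv g.1.1 * g.2.1)) (measurable_vec_scale g.1.2).
rewrite -invfM -exprMn -mat_norm_pivot// N1 expr1n invr1.
congr scaling; apply/funext => -[x y] /=.
rewrite /mat_mul !mat_vecE /= [vec_scale y g.1.2 + _]addrC; congr pair.
rewrite vec_scaleDl !vec_scaleA vec_scaleD vec_scaleN (mulrA g.1.1) quat_mulV// mul1r (mulrA g.1.2).
by rewrite -addrA; congr (_ + _); rewrite addrCA subrr addr0.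
Qed.

Local Open Scope complex_scope.

Lemma det_mx22 (K : comRingType) (M : 'M[K]_2) :
  \det M = M 0 0 * M 1 1 - M 0 1 * M 1 0.
Proof.
rewrite (expand_det_row _ 0) !big_ord_recl big_ord0 /cofactor !det_mx11 !mxE.
have -> : lift 0 0 = 1 :> 'I_2 by apply: val_inj.
have -> : lift 1 0 = 0 :> 'I_2 by apply: val_inj.
by rewrite /= addr0 expr0 mul1r expr1 mulN1r mulrN.
Qed.

Lemma mat_normM_det a b c d :
  \det (block_mx (quat_mx a) (quat_mx b) (quat_mx c) (quat_mx d) : 'M[R[i]]_(2 + 2)) =
  (mat_norm ((a, c), (b, d)))%:C.
Proof.
have quat_mxN q : quat_mx (- q) = - quat_mx q :> 'M[R[i]]_2.
  by apply: (addrI (quat_mx q)); rewrite -quat_mxD !subrr quat_mx0.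
have det_quat q : \det (quat_mx q) = (sqn q)%:C.
  case: q => [[[q0 q1] q2] q3]; rewrite /quat_mx /=.
  set z := (_ +i* _)%:M; set w := (_ +i* _)%:M; set w' := (- _)%:M.
  set z' := (_ +i* _)%:M.
  have e0 : 0 = lshift 1 0 :> 'I_(1 + 1) by apply: val_inj.
  have e1 : 1 = rshift 1 0 :> 'I_(1 + 1) by apply: val_inj.
  have m00 : block_mx z w w' z' 0 0 = z 0 0 by rewrite e0 block_mxEul.
  have m01 : block_mx z w w' z' 0 1 = w 0 0 by rewrite e0 e1 block_mxEur.
  have m10 : block_mx z w w' z' 1 0 = w' 0 0 by rewrite e0 e1 block_mxEdl.
  have m11 : block_mx z w w' z' 1 1 = z' 0 0 by rewrite e1 block_mxEdr.
  rewrite det_mx22 m00 m01 m10 m11 !mxE /= !mulr1n.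
  by apply/eqP; rewrite eq_complex /=; apply/andP; split; apply/eqP; ring.
have det_pivot a' b' c' d' : a' != 0 ->
    \det (block_mx (quat_mx a') (quat_mx b') (quat_mx c') (quat_mx d') : 'M[R[i]]_(2 + 2)) =
    (mat_norm ((a', c'), (b', d')))%:C.
  move=> a0; rewrite mat_norm_pivot//=.
  have := @mulmx_block _ 2 2 2 2 2 2 1%:M 0 (quat_mx (- (c' * quat_inv a'))) 1%:M
    (quat_mx a') (quat_mx b') (quat_mx c') (quat_mx d').
  rewrite !mul1mx !mul0mx !addr0 -!quat_mxM -!quat_mxD.
  rewrite !mulNr -[_ * a']mulrA quat_Vmul// mulr1 addNr quat_mx0.
  move=> /(congr1 (fun M => \det M)); rewrite det_mulmx det_lblock !det1 !mul1r.
  by rewrite det_ublock !det_quat [- _ + _]addrC => ->; rewrite -rmorphM.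
have [a0|/det_pivot//] := eqVneq a 0.
have [c0|c0] := eqVneq c 0.
  rewrite a0 c0 quat_mx0 det_ublock det0 ?mul0r//.
  by rewrite mat_norm_antipivot// [X in _ * X]sqn0 mulr0.
(* Adding the second block row to the first makes the pivot nonzero without changing the
   determinant. *)
have := @mulmx_block _ 2 2 2 2 2 2 1%:M 1%:M 0 1%:M
    (quat_mx a) (quat_mx b) (quat_mx c) (quat_mx d).
rewrite !mul1mx !mul0mx !add0r -!quat_mxD.
move=> /(congr1 (fun M => \det M)); rewrite det_mulmx det_ublock !det1 !mul1r => ->.
rewrite a0 add0r det_pivot// mat_norm_pivot// mat_norm_antipivot//.
rewrite [X in sqn _ * sqn X](_ : _ = - b); first by rewrite [X in _ * X]sqnN mulrC.
by rewrite /= quat_mulV// mul1r opprD addrCA subrr addr0.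
Qed.

Definition mx_mat (A : 'M[quat R]_2) : mat := ((A 0 0, A 1 0), (A 0 1, A 1 1)).

Definition mat_mx g : 'M[quat R]_2 :=
  \matrix_(i, j) (if j == 0 then (if i == 0 then g.1.1 else g.1.2)
                  else (if i == 0 then g.2.1 else g.2.2)).

Lemma mat_mxK : cancel mat_mx mx_mat.
Proof. by case=> -[a c] [b d]; rewrite /mx_mat !mxE. Qed.

Lemma mx_matK : cancel mx_mat mat_mx.
Proof.
move=> A; apply/matrixP => i j; rewrite mxE /=.
by case: i j => -[|[|//]] ? -[[|[|//]] ?] /=; congr (A _ _); exact: val_inj.
Qed.

Lemma mx_matM (A B : 'M[quat R]_2) : mx_mat (A * B) = mat_mul (mx_mat A) (mx_mat B).
Proof.
rewrite /mx_mat !mxE !big_ord_recl !big_ord0 !addr0.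
by have -> : lift 0 0 = 1 :> 'I_2 by apply: val_inj.
Qed.

Lemma mx_mat1 : mx_mat 1 = @mat_one R.
Proof. by rewrite /mx_mat !mxE. Qed.

Lemma det_complex_rep (A : 'M[quat R]_2) :
  \det (complex_rep A) = (mat_norm (mx_mat A))%:C.
Proof. exact: mat_normM_det. Qed.

(** Inherited from the multiplicativity of the complex determinant, instead of expanding a
    polynomial identity in 32 real variables. *)
Lemma mat_normM g h : mat_norm (mat_mul g h) = mat_norm g * mat_norm h.
Proof.
have : (mat_norm (mx_mat (mat_mx g * mat_mx h)))%:C =
    (mat_norm (mx_mat (mat_mx g)) * mat_norm (mx_mat (mat_mx h)))%:C.
  by rewrite rmorphM /= -!det_complex_rep complex_repM det_mulmx.
by rewrite mx_matM !mat_mxK => -[].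
Qed.

Lemma mat_norm1 : mat_norm (@mat_one R) = 1.
Proof.
have := det_complex_rep 1; rewrite complex_rep1 det1 mx_mat1.
by move=> /(congr1 (@complex.Re _)).
Qed.

Lemma mat_mul_adjr g : mat_norm g = 1 -> mat_mul g (mat_adj g) = @mat_one R.
Proof. by move=> N1; rewrite mat_mul_adj N1. Qed.

Lemma mat_norm_adj g : mat_norm g = 1 -> mat_norm (mat_adj g) = 1.
Proof.
by move=> N1; have := mat_normM g (mat_adj g);
  rewrite mat_mul_adjr// N1 mul1r mat_norm1.
Qed.

Lemma mat_adj_mul g : mat_norm g = 1 -> mat_mul (mat_adj g) g = @mat_one R.
Proof.
move=> N1; have N2 := mat_norm_adj N1.
(* Every matrix of norm 1 has a right inverse of norm 1; applied to [mat_adj g] itself, this makes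
   right inverses two-sided. *)
rewrite -[X in mat_mul _ X]mat_mulr1 -(mat_mul_adjr N2) !mat_mulA.
by rewrite -(mat_mulA _ g) mat_mul_adjr// mat_mulr1 mat_mul_adjr.
Qed.

End MatrixInvariance.

(** * Hurwitz integers and the Voronoi cell *)

Section HurwitzIntegers.
Context {R : realType}.
Local Notation sqn := (@quat_sqnorm R).
Local Notation hw := (@hurwitz R).
Implicit Types (p q h X : quat R).

(* coordinates in the basis [(1 + i + j + k) / 2], [i], [j], [k] *)
Definition hurwitz_comb (n0 n1 n2 n3 : int) : quat R :=
  (n0%:~R / 2, n0%:~R / 2 + n1%:~R, n0%:~R / 2 + n2%:~R, n0%:~R / 2 + n3%:~R).

(** With integer coordinates, closure under the ring operations amounts to exhibiting integer
    polynomials. *)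
Lemma hurwitzP q : hw q <-> exists n0 n1 n2 n3, q = hurwitz_comb n0 n1 n2 n3.
Proof.
have half2 : 2^-1 + 2^-1 = 1 :> R by field.
split=> [|[n0 [n1 [n2 [n3 ->]]]]]; rewrite /hurwitz /=.
  case: q => [[[a0 a1] a2] a3] /orP[] /and5P[/intrP[m0 e0] /intrP[m1 e1] /intrP[m2 e2] /intrP[m3 e3] _].
    exists (2 * m0), (m1 - m0), (m2 - m0), (m3 - m0).
    by rewrite /hurwitz_comb e0 e1 e2 e3 !rmorphB !rmorphM /=; apply: quat_eq; field.
  exists (2 * m0 + 1), (m1 - m0), (m2 - m0), (m3 - m0).
  rewrite /hurwitz_comb !rmorphB !rmorphD !rmorphM /= -e0 -e1 -e2 -e3.
  by apply: quat_eq; field.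
have n0E : n0%:~R = (n0 %/ 2)%Z%:~R * 2 + (n0 %% 2)%Z%:~R :> R.
  by rewrite [in LHS](divz_eq n0 2) rmorphD rmorphM.
(* The parity of [n0] decides between integer and half-integer coordinates. *)
have : (n0 %% 2)%Z = 0 \/ (n0 %% 2)%Z = 1.
  have := modz_ge0 n0 (isT : (2 : int) != 0); have := ltz_pmod n0 (isT : (0 : int) < 2).
  by case: (n0 %% 2)%Z => // -[|[|]] //; [left|right].
move: n0E => /[swap] -[] -> ->.
  apply/orP; left.
  rewrite addr0 mulfK// !rpredD ?intr_int//.
apply/orP; right.
have -> : ((n0 %/ 2)%Z%:~R * 2 + 1%:~R) / 2 = (n0 %/ 2)%Z%:~R + 2^-1 :> R by field.
by apply/and5P; split=> //; rewrite [_ + 2^-1 + _]addrAC ?addrK ?subrK ?rpredD ?intr_int.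
Qed.

Lemma hurwitz0 : hw 0.
Proof. by apply/hurwitzP; exists 0, 0, 0, 0; apply: quat_eq; rewrite ?mul0r ?addr0. Qed.

Lemma hurwitz1 : hw 1.
Proof. by apply/hurwitzP; exists 2, (-1), (-1), (-1); apply: quat_eq; field. Qed.

Lemma hurwitzN q : hw q -> hw (- q).
Proof.
move=> /hurwitzP[n0 [n1 [n2 [n3 ->]]]]; apply/hurwitzP.
by exists (- n0), (- n1), (- n2), (- n3); apply: quat_eq; rewrite /= !rmorphN /=; field.
Qed.

Lemma hurwitzD p q : hw p -> hw q -> hw (p + q).
Proof.
move=> /hurwitzP[n0 [n1 [n2 [n3 ->]]]] /hurwitzP[m0 [m1 [m2 [m3 ->]]]].
apply/hurwitzP; exists (n0 + m0), (n1 + m1), (n2 + m2), (n3 + m3).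
by apply: quat_eq; rewrite /= !rmorphD /=; field.
Qed.

Lemma hurwitzB p q : hw p -> hw q -> hw (p - q).
Proof. by move=> hp hq; apply: hurwitzD => //; exact: hurwitzN. Qed.

Lemma hurwitz_conj q : hw q -> hw (quat_conj q).
Proof.
move=> /hurwitzP[n0 [n1 [n2 [n3 ->]]]]; apply/hurwitzP.
exists n0, (- n0 - n1), (- n0 - n2), (- n0 - n3).
by apply: quat_eq; rewrite /= ?rmorphB ?rmorphN /=; field.
Qed.

Lemma hurwitzM p q : hw p -> hw q -> hw (p * q).
Proof.
move=> /hurwitzP[n0 [n1 [n2 [n3 ->]]]] /hurwitzP[m0 [m1 [m2 [m3 ->]]]].
apply/hurwitzP; pose s := n1 * m1 + n2 * m2 + n3 * m3.
(* The first coordinate is twice the real part of the product; each of the others is the matching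
   imaginary part minus the real part. *)
exists (- n0 * m0 - n0 * (m1 + m2 + m3) - m0 * (n1 + n2 + n3) - 2 * s).
exists (n0 * m0 + n0 * (m1 + m3) + m0 * (n1 + n2) + n2 * m3 - n3 * m2 + s).
exists (n0 * m0 + n0 * (m2 + m1) + m0 * (n2 + n3) + n3 * m1 - n1 * m3 + s).
exists (n0 * m0 + n0 * (m3 + m2) + m0 * (n3 + n1) + n1 * m2 - n2 * m1 + s).
rewrite /s /hurwitz_comb quat_mulE; apply: quat_eq;
  by rewrite ?(rmorphB, rmorphD, rmorphM, rmorphN) /=; field.
Qed.

Lemma hurwitz_sqn q : hw q -> sqn q \is a Num.int.
Proof.
move=> /hurwitzP[n0 [n1 [n2 [n3 ->]]]]; rewrite /hurwitz_comb /quat_sqnorm.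
rewrite (_ : _ + _ = (n0 ^+ 2 + n0 * (n1 + n2 + n3) + (n1 ^+ 2 + n2 ^+ 2 + n3 ^+ 2))%:~R).
  exact: intr_int.
by rewrite ?(rmorphD, rmorphM, rmorphXn) /=; field.
Qed.

Lemma hurwitz_sqn_ge1 q : hw q -> q != 0 -> 1 <= sqn q.
Proof.
move=> /hurwitz_sqn /intrP[n qn]; rewrite -sqn_gt0 qn.
by rewrite ltr0z ler1z.
Qed.

Lemma hurwitz_sqn_ge2 q : hw q -> q != 0 -> sqn q != 1 -> 2 <= sqn q.
Proof.
move=> hq q0; have := hurwitz_sqn_ge1 hq q0.
have /intrP[n ->] := hurwitz_sqn hq.
rewrite ler1z => n1; rewrite -[1]/(1%:~R) eqr_int => n1'.
by rewrite -[2]/(2%:~R) ler_int; lia.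
Qed.

Lemma hurwitz_int_ge1 (x : R) : x \is a Num.int -> x != 0 -> 1 <= `|x|.
Proof.
move=> /intrP[n ->]; rewrite intr_eq0 -intr_norm => n0.
by rewrite -[1]/(1%:~R) ler_int; lia.
Qed.

Lemma hurwitz_half_ge (x : R) : x - 2^-1 \is a Num.int -> 2^-1 <= `|x|.
Proof.
move=> /intrP[n xn]; have -> : x = n%:~R + 2^-1 by rewrite -xn subrK.
have [n0|n0] := leP 0 n.
  by apply: (le_trans _ (ler_norm _)); rewrite lerDr ler0z.
have : n%:~R <= -1 :> R by rewrite -[-1]/((-1)%:~R) ler_int; lia.
move=> nm; apply: (@le_trans _ _ (- (n%:~R + 2^-1))); first lra.
by rewrite -normrN ler_norm.
Qed.

End HurwitzIntegers.

Section VoronoiCell.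
Context {R : realType}.
Local Notation sqn := (@quat_sqnorm R).
Local Notation hw := (@hurwitz R).
Local Notation V := (@voronoi_cell R).
Implicit Types (p q h X : quat R).

Definition voronoi_interior : set (quat R) :=
  [set X | let: (X0, X1, X2, X3) := X in
     all (fun x => `|x| < 2^-1) [:: X0; X1; X2; X3] /\
     `|X0| + `|X1| + `|X2| + `|X3| < 1].

Lemma voronoi_interior_sub : voronoi_interior `<=` V.
Proof.
move=> [[[X0 X1] X2] X3] /= [/and5P[? ? ? ? _] ?].
by split; [apply/and5P; split=> //|]; exact: ltW.
Qed.

(** The coordinates separate, so the Voronoi inequalities can be checked one coordinate at a
    time. *)
Lemma sqnB_sub X h : sqn (X - h) - sqn X =
  (h.1.1.1 ^+ 2 - 2 * X.1.1.1 * h.1.1.1) + (h.1.1.2 ^+ 2 - 2 * X.1.1.2 * h.1.1.2) +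
  (h.1.2 ^+ 2 - 2 * X.1.2 * h.1.2) + (h.2 ^+ 2 - 2 * X.2 * h.2).
Proof.
case: X h => [[[X0 X1] X2] X3] [[[h0 h1] h2] h3].
by rewrite quat_oppE quat_addE /quat_sqnorm /=; ring.
Qed.

Lemma mul_le_norm (x y : R) : x * y <= `|x| * `|y|.
Proof. by rewrite -normrM ler_norm. Qed.

Lemma sqr_sub_int (x n : R) : n \is a Num.int -> `|x| <= 2^-1 ->
  0 <= n ^+ 2 - 2 * x * n.
Proof.
move=> ni xh; have [->|n0] := eqVneq n 0; first by rewrite expr0n/= mulr0 subrr.
have := hurwitz_int_ge1 ni n0; have := mul_le_norm x n; have := real_normK (num_real n).
by move=> <-; have := normr_ge0 x; nra.
Qed.

Lemma sqr_sub_int_gt (x n : R) : n \is a Num.int -> `|x| < 2^-1 -> n != 0 ->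
  0 < n ^+ 2 - 2 * x * n.
Proof.
move=> ni xh n0.
have := hurwitz_int_ge1 ni n0; have := mul_le_norm x n; have := real_normK (num_real n).
by move=> <-; have := normr_ge0 x; nra.
Qed.

(** Summed over the four coordinates the lower bounds give [1 - sum |X_l|]: this is how the
    condition on the sum in the Voronoi cell handles the half-integer points. *)
Lemma sqr_sub_half (x n : R) : n - 2^-1 \is a Num.int -> `|x| <= 2^-1 ->
  4^-1 - `|x| <= n ^+ 2 - 2 * x * n.
Proof.
move=> ni xh.
have := hurwitz_half_ge ni; have := mul_le_norm x n; have := real_normK (num_real n).
by move=> <-; have := normr_ge0 x; nra.
Qed.

Lemma voronoi_le X h : V X -> hw h -> sqn X <= sqn (X - h).
Proof.
rewrite -subr_ge0 sqnB_sub; case: X h => [[[X0 X1] X2] X3] [[[h0 h1] h2] h3] /=.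
move=> [/and5P[x0 x1 x2 x3 _] xs] /orP[] /and5P[i0 i1 i2 i3 _] /=.
  have := sqr_sub_int i0 x0; have := sqr_sub_int i1 x1.
  by have := sqr_sub_int i2 x2; have := sqr_sub_int i3 x3; lra.
have := sqr_sub_half i0 x0; have := sqr_sub_half i1 x1.
by have := sqr_sub_half i2 x2; have := sqr_sub_half i3 x3; lra.
Qed.

Lemma voronoi_lt X h : voronoi_interior X -> hw h -> h != 0 -> sqn X < sqn (X - h).
Proof.
rewrite -subr_gt0 sqnB_sub; case: X h => [[[X0 X1] X2] X3] [[[h0 h1] h2] h3] /=.
move=> [/and5P[x0 x1 x2 x3 _] xs] /orP[] /and5P[i0 i1 i2 i3 _] hn0.
  have p0 := sqr_sub_int i0 (ltW x0); have p1 := sqr_sub_int i1 (ltW x1).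
  have p2 := sqr_sub_int i2 (ltW x2); have p3 := sqr_sub_int i3 (ltW x3).
  have [h00|h0n] := eqVneq h0 0; last by have := sqr_sub_int_gt i0 x0 h0n; lra.
  have [h10|h1n] := eqVneq h1 0; last by have := sqr_sub_int_gt i1 x1 h1n; lra.
  have [h20|h2n] := eqVneq h2 0; last by have := sqr_sub_int_gt i2 x2 h2n; lra.
  have [h30|h3n] := eqVneq h3 0; last by have := sqr_sub_int_gt i3 x3 h3n; lra.
  by move: hn0; rewrite h00 h10 h20 h30 eqxx.
have := sqr_sub_half i0 (ltW x0); have := sqr_sub_half i1 (ltW x1).
by have := sqr_sub_half i2 (ltW x2); have := sqr_sub_half i3 (ltW x3); lra.
Qed.

(** The value at 0 is [1/2], so that [sign_unit X] is a unit for every [X]. *)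
Definition half_sign (x : R) : R := if 0 <= x then 2^-1 else - 2^-1.

Lemma half_sign_mul x : 2 * x * half_sign x = `|x|.
Proof.
rewrite /half_sign; case: ifPn => x0; first by rewrite ger0_norm//; field.
by rewrite ltr0_norm ?ltNge//; field.
Qed.

Lemma half_sign_sqr x : half_sign x ^+ 2 = 4^-1.
Proof. by rewrite /half_sign; case: ifPn => _; field. Qed.

Lemma half_sign_int x : half_sign x - 2^-1 \is a Num.int.
Proof.
rewrite /half_sign; case: ifPn => _; first by rewrite subrr rpred0.
by rewrite (_ : _ - _ = - 1) ?rpredN ?rpred1//; field.
Qed.

Definition sign_unit X : quat R :=
  (half_sign X.1.1.1, half_sign X.1.1.2, half_sign X.1.2, half_sign X.2).

Lemma hurwitz_sign_unit X : hw (sign_unit X).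
Proof. by apply/orP; right; apply/and5P; split=> //; exact: half_sign_int. Qed.

Lemma sqnB_sign_unit X : sqn (X - sign_unit X) - sqn X =
  1 - (`|X.1.1.1| + `|X.1.1.2| + `|X.1.2| + `|X.2|).
Proof.
by rewrite sqnB_sub /= !half_sign_sqr !half_sign_mul; lra.
Qed.

Definition axis_unit (i : 'I_4) (s : R) : quat R :=
  (if val i == 0%N then s else 0, if val i == 1%N then s else 0,
   if val i == 2%N then s else 0, if val i == 3%N then s else 0).

Definition quat_coord (i : 'I_4) X : R :=
  match val i with 0%N => X.1.1.1 | 1%N => X.1.1.2 | 2%N => X.1.2 | _ => X.2 end.

Lemma hurwitz_axis_unit i b : hw (axis_unit i ((-1) ^+ nat_of_bool b)).
Proof.
by apply/orP; left; apply/and5P; split=> //; case: ifP => _;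
  rewrite ?rpred0// rpredX// rpredN rpred1.
Qed.

Lemma sqnB_axis_unit X i b : sqn (X - axis_unit i ((-1) ^+ nat_of_bool b)) - sqn X =
  1 - 2 * quat_coord i X * (-1) ^+ nat_of_bool b.
Proof.
rewrite sqnB_sub /quat_coord; case: i => -[|[|[|[|//]]]] ? /=;
by case: b; rewrite /=; ring.
Qed.

Lemma norm_sign (x : R) : exists b : bool, x * (-1) ^+ nat_of_bool b = `|x|.
Proof.
have [x0|x0] := leP 0 x; first by exists false; rewrite mulr1 ger0_norm.
by exists true; rewrite expr1 mulrN1 ltr0_norm.
Qed.

(** Nine units suffice as tests for a given [X]: the eight units on the axes bound the coordinates,
    and the half-integer unit with the signs of [X] bounds the sum. This metric description, unlike
    the coordinates, is visibly invariant under multiplication by units. *)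
Lemma lt_voronoi X :
  (forall h, hw h -> h != 0 -> sqn X < sqn (X - h)) -> voronoi_interior X.
Proof.
move=> H.
have s0 b : (-1) ^+ nat_of_bool b != 0 :> R by rewrite expf_neq0// oppr_eq0 oner_eq0.
have axis_neq0 i b : axis_unit i ((-1) ^+ nat_of_bool b) != 0.
  apply: contra (s0 b) => /eqP; case: i => -[|[|[|[|//]]]] ? [];
  by move=> -> //.
have coord i : `|quat_coord i X| < 2^-1.
  have [b <-] := norm_sign (quat_coord i X).
  have := H _ (hurwitz_axis_unit i b) (axis_neq0 i b).
  by rewrite -subr_gt0 sqnB_axis_unit -mulrA; lra.
have su0 : sign_unit X != 0.
  apply/eqP => -[/eqP]; rewrite -sqrf_eq0 half_sign_sqr.
  by rewrite invr_eq0 pnatr_eq0.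
have := H _ (hurwitz_sign_unit X) su0; rewrite -subr_gt0 sqnB_sign_unit.
case: X H coord su0 => [[[X0 X1] X2] X3] H coord su0 /= Hs; split; last lra.
apply/and5P; split=> //.
- exact: (coord (@Ordinal 4 0 isT)).
- exact: (coord (@Ordinal 4 1 isT)).
- exact: (coord (@Ordinal 4 2 isT)).
- exact: (coord (@Ordinal 4 3 isT)).
Qed.

(** From [x^2 <= |x| / 2] for [|x| <= 1/2]. That the squared covering radius 1/2 is less than 1 is
    what bounds [t] for reduced bases. *)
Lemma voronoi_sqn X : V X -> sqn X <= 2^-1.
Proof.
case: X => [[[X0 X1] X2] X3] /= [/and5P[x0 x1 x2 x3 _] xs].
have le (x : R) : `|x| <= 2^-1 -> x ^+ 2 <= 2^-1 * `|x|.
  by move=> xh; rewrite -(real_normK (num_real x)) expr2 ler_wpM2r.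
by have := le _ x0; have := le _ x1; have := le _ x2; have := le _ x3; lra.
Qed.

(* Rounding each coordinate to an integer leaves [|x_l| <= 1/2]; if the sum of
   the [|x_l|] exceeds 1, subtracting the unit with the same signs turns each
   [|x_l|] into [1/2 - |x_l|]. *)
Lemma voronoi_cover X : exists2 h, hw h & V (X - h).
Proof.
have round (x : R) : exists2 n : R, n \is a Num.int & `|x - n| <= 2^-1.
  exists (Num.floor (x + 2^-1))%:~R; first exact: intr_int.
  have /andP[] := floor_itv (x + 2^-1); rewrite intrD1 => ? ?.
  by rewrite ler_norml; apply/andP; split; lra.
case: X => [[[X0 X1] X2] X3].
have [n0 i0 e0] := round X0; have [n1 i1 e1] := round X1.
have [n2 i2 e2] := round X2; have [n3 i3 e3] := round X3.
have hn : hw (n0, n1, n2, n3) by apply/orP; left; apply/and5P.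
have [sle|slt] := leP (`|X0 - n0| + `|X1 - n1| + `|X2 - n2| + `|X3 - n3|) 1.
  by exists (n0, n1, n2, n3) => //; split=> //; apply/and5P.
pose Y : quat R := (X0 - n0, X1 - n1, X2 - n2, X3 - n3).
exists ((n0, n1, n2, n3) + sign_unit Y).
  by apply: hurwitzD => //; exact: hurwitz_sign_unit.
have flip (x : R) : `|x| <= 2^-1 -> `|x - half_sign x| = 2^-1 - `|x|.
  rewrite /half_sign; case: ifPn => x0 xh.
    rewrite (ger0_norm x0) in xh *.
    by rewrite ler0_norm ?opprB// subr_le0.
  move: x0; rewrite -ltNge => x0; rewrite (ltr0_norm x0) in xh *.
  by rewrite ger0_norm; lra.
rewrite opprD addrA -/Y.
have -> : (X0, X1, X2, X3) - (n0, n1, n2, n3) = Y by [].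
rewrite /Y /sign_unit quat_oppE quat_addE /=.
split; last by rewrite !flip//; lra.
by apply/and5P; split=> //; rewrite flip// gerBl.
Qed.

Lemma sqn_unit_mul (u v : quat R) X h : sqn u = 1 -> sqn v = 1 ->
  sqn (u * X * v - h) = sqn (X - quat_conj u * h * quat_conj v).
Proof.
move=> u1 v1.
have -> : u * X * v - h = u * (X - quat_conj u * h * quat_conj v) * v.
  rewrite mulrBr mulrBl !mulrA mul_quat_conj u1 quat_real1 mul1r.
  by rewrite -[h * _ * _]mulrA mul_conj_quat v1 quat_real1 mulr1.
by rewrite !sqnM u1 v1 mul1r mulr1.
Qed.

(** Moving [u] and [v] from [X] to the lattice point replaces [h] by
    [quat_conj u * h * quat_conj v], again a nonzero Hurwitz integer. *)
Lemma voronoi_interior_unit (u v : quat R) X :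
  hw u -> hw v -> sqn u = 1 -> sqn v = 1 ->
  voronoi_interior X -> voronoi_interior (u * X * v).
Proof.
move=> hu hv u1 v1 VX; apply: lt_voronoi => h hh h0.
rewrite sqn_unit_mul// !sqnM u1 v1 mul1r mulr1; apply: voronoi_lt => //.
  by apply: hurwitzM; [apply: hurwitzM|] => //; exact: hurwitz_conj.
by rewrite -sqn_eq0 !sqnM !sqn_conj u1 v1 mul1r mulr1 sqn_eq0.
Qed.

Lemma finite_hurwitz_ball (C : R) : finite_set [set q | hw q /\ sqn q <= C].
Proof.
(* Doubled coordinates are integers, and [|x| <= x^2 + 1/4] keeps them below [K + 1] in absolute
   value. *)
pose K := Num.trunc (2 * (C + 1)).
pose I : set R := [set x | exists2 k : nat, (k < 2 * K.+1)%N & x = (k%:R - K.+1%:R) / 2].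
have finI : finite_set I.
  apply: (sub_finite_set (B := (fun k : nat => (k%:R - K.+1%:R) / 2 : R) @` `I_(2 * K.+1))).
    by move=> x [k kK ->]; exists k.
  exact/finite_image/finite_II.
have memI (x : R) : (2 * x) \is a Num.int -> x ^+ 2 <= C -> I x.
  move=> /intrP[n xn] xC.
  have nK : `|2 * x| < K.+1%:R.
    apply: le_lt_trans (truncnS_gt _).
    rewrite normrM ger0_norm// ler_pM2l//.
    have := sqr_ge0 (`|x| - 2^-1); have := real_normK (num_real x); nra.
  have : `|n| < K.+1%:Z.
    by rewrite -(@ltr_int R) intr_norm -xn.
  move=> nK'; exists (absz (n + K.+1%:Z)); first lia.
  have -> : (absz (n + K.+1%:Z))%:R = (n + K.+1%:Z)%:~R :> R.
    by rewrite -[_%:R]/((absz (n + K.+1%:Z))%:Z%:~R); congr (_%:~R); lia.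
  by rewrite rmorphD /= -xn; field.
apply: (sub_finite_set (B := (I `*` I `*` I `*` I : set (quat R)))); last first.
  by do 3!(apply: finite_setX => //).
move=> [[[a0 a1] a2] a3] [hq qC].
have [A0 [A1 [A2 A3]]] : a0 ^+ 2 <= C /\ a1 ^+ 2 <= C /\ a2 ^+ 2 <= C /\ a3 ^+ 2 <= C.
  move: qC; rewrite /quat_sqnorm.
  by have := sqr_ge0 a0; have := sqr_ge0 a1; have := sqr_ge0 a2; have := sqr_ge0 a3; lra.
have dbl (x : R) : x \is a Num.int -> 2 * x \is a Num.int.
  by move=> ?; rewrite rpredM ?rpred_nat.
have dblh (x : R) : x - 2^-1 \is a Num.int -> 2 * x \is a Num.int.
  by move=> ?; rewrite (_ : 2 * x = 2 * (x - 2^-1) + 1) ?rpredD ?rpredM ?rpred1 ?rpred_nat//; field.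
by move: hq => /orP[] /and5P[i0 i1 i2 i3 _]; do !split; apply: memI => //;
  (exact: dbl || exact: dblh).
Qed.

End VoronoiCell.

(** * Volume of the Voronoi cell *)

Section VoronoiVolume.
Context {R : realType}.
Local Notation sqn := (@quat_sqnorm R).
Local Notation lam := (@quat_lebesgue R).
Local Notation mu := (@lebesgue_measure R).
Local Notation V := (@voronoi_cell R).

Lemma le_dilation (a b : R) : 0 <= b ->
  (forall s, 0 < s < 1 -> s ^+ 4 * a <= b) -> a <= b.
Proof.
move=> b0 le; rewrite leNgt; apply/negP => lt.
have a0 : 0 < a by exact: le_lt_trans lt.
(* For [s = 1 - e], the bound [s^4 >= 1 - 4 e] yields [s^4 a >= (a + b) / 2], which exceeds [b]. *)
pose e := (a - b) / (8 * a).
have ea : e * (8 * a) = a - b by rewrite /e divfK// gt_eqF// mulr_gt0.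
have e0 : 0 < e by rewrite divr_gt0 ?mulr_gt0// subr_gt0.
have e1 : e <= 8^-1 by rewrite -(@ler_pM2r _ (8 * a)) ?mulr_gt0// ea; lra.
have := le (1 - e); have -> : 0 < 1 - e < 1 by apply/andP; split; lra.
move=> /(_ isT); apply/negP; rewrite -ltNge.
have h : 1 - 4 * e <= (1 - e) ^+ 4.
  by rewrite (exprM _ 2 2); clear -e0 e1; nra.
apply: (@lt_le_trans _ _ ((1 - 4 * e) * a)); first by clear -ea lt; lra.
by rewrite ler_pM2r.
Qed.

(** The hypothesis puts [s A] inside [B], hence [s^4 lam A <= lam B] for all [s < 1]; letting [s]
    tend to 1 leaves no room for [A] minus [B]. Serves both for the boundary of the cell and for
    spheres. *)
Lemma null_dilation (A B : set (quat R)) : measurable A -> measurable B ->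
  (lam A < +oo)%E -> B `<=` A ->
  (forall s x, 0 < s < 1 -> A x -> B (quat_real s * x)) -> lam (A `\` B) = 0%E.
Proof.
move=> mA mB Ay BA sAB.
have AE : (lam A = lam (A `\` B) + lam B)%E.
  apply: etrans; first exact: (measureDI lam mA mB).
  by congr (_ + lam _)%E; exact: setIidr.
have sc s : 0 < s < 1 -> ((s ^+ 4)%:E * lam A <= lam B)%E.
  move=> s01; have /andP[s0 _] := s01.
  have si : 0 < s^-1 by rewrite invr_gt0.
  have [mf sc] := scaling_quat_real si.
  have := sc _ mA; rewrite exprVn invrK => <-.
  apply: le_measure; rewrite ?inE//.
    by rewrite -[X in measurable X]setTI; exact: mf.
  move=> x /= /(sAB _ _ s01); rewrite mulrA -quat_realM divff ?gt_eqF//.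
  by rewrite quat_real1 mul1r.
have D0 : (0 <= lam (A `\` B))%E by exact: measure_ge0.
have B0 : (0 <= lam B)%E by exact: measure_ge0.
move: (lam A) (lam B) (lam (A `\` B)) => a b e in Ay AE sc D0 B0 *.
case: e => [e| |] in D0 AE *; last by [].
- case: b => [b| |] in B0 AE sc *; [|by rewrite AE in Ay|by []].
  rewrite {}AE -EFinD in sc Ay *; congr EFin; apply/eqP.
  rewrite lee_fin in D0; rewrite lee_fin in B0.
  rewrite eq_le D0 andbT -(@lerD2r _ b) add0r; apply: le_dilation => [|s s01]; first exact: B0.
  by have := sc s s01; rewrite -EFinM lee_fin.
- by move: Ay; rewrite AE; case: b B0 {AE sc}.
Qed.

Lemma measurable_voronoi_norms : let sum (X : quat R) :=
    `|X.1.1.1| + `|X.1.1.2| + `|X.1.2| + `|X.2| in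
  [/\ measurable_fun setT (fun X : quat R => `|X.1.1.1|),
      measurable_fun setT (fun X : quat R => `|X.1.1.2|),
      measurable_fun setT (fun X : quat R => `|X.1.2|),
      measurable_fun setT (fun X : quat R => `|X.2|) & measurable_fun setT sum].
Proof.
have [m0 m1 m2 m3] := measurable_quat_coords (@measurable_id _ (quat R) setT).
have n (f : quat R -> R) : measurable_fun setT f -> measurable_fun setT (fun X => `|f X|).
  by move=> mf; exact: measurableT_comp (@normr_measurable _ _) mf.
have M0 := n _ m0; have M1 := n _ m1; have M2 := n _ m2; have M3 := n _ m3.
split; [exact: M0|exact: M1|exact: M2|exact: M3|].
exact: measurable_funD (measurable_funD (measurable_funD M0 M1) M2) M3.
Qed.

Lemma measurable_voronoi : measurable V.
Proof.
have [m0 m1 m2 m3 ms] := measurable_voronoi_norms.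
rewrite (_ : V = (fun X : quat R => [&& `|X.1.1.1| <= 2^-1, `|X.1.1.2| <= 2^-1,
    `|X.1.2| <= 2^-1, `|X.2| <= 2^-1 & `|X.1.1.1| + `|X.1.1.2| + `|X.1.2| + `|X.2| <= 1])
    @^-1` [set true]).
  rewrite -[X in measurable X]setTI.
  have le (f : quat R -> R) c : measurable_fun setT f -> measurable_fun setT (fun X => f X <= c).
    by move=> mf; exact: measurable_fun_ler mf (@measurable_cst _ _ _ _ _ c).
  have mf := measurable_and (le _ 2^-1 m0) (measurable_and (le _ 2^-1 m1)
    (measurable_and (le _ 2^-1 m2) (measurable_and (le _ 2^-1 m3) (le _ 1 ms)))).
  exact: mf.
apply/seteqP; split=> -[[[x0 x1] x2] x3] /=.
  by move=> [/and5P[-> -> -> -> _] ->].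
by move=> /and5P[-> -> -> -> ->].
Qed.

Lemma measurable_voronoi_interior : measurable (@voronoi_interior R).
Proof.
have [m0 m1 m2 m3 ms] := measurable_voronoi_norms.
rewrite (_ : @voronoi_interior R = (fun X : quat R => [&& `|X.1.1.1| < 2^-1,
    `|X.1.1.2| < 2^-1, `|X.1.2| < 2^-1, `|X.2| < 2^-1 &
    `|X.1.1.1| + `|X.1.1.2| + `|X.1.2| + `|X.2| < 1]) @^-1` [set true]).
  rewrite -[X in measurable X]setTI.
  have lt (f : quat R -> R) c : measurable_fun setT f -> measurable_fun setT (fun X => f X < c).
    by move=> mf; exact: measurable_fun_ltr mf (@measurable_cst _ _ _ _ _ c).
  have mf := measurable_and (lt _ 2^-1 m0) (measurable_and (lt _ 2^-1 m1)
    (measurable_and (lt _ 2^-1 m2) (measurable_and (lt _ 2^-1 m3) (lt _ 1 ms)))).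
  exact: mf.
apply/seteqP; split=> -[[[x0 x1] x2] x3] /=.
  by move=> [/and5P[-> -> -> -> _] ->].
by move=> /and5P[-> -> -> -> ->].
Qed.

Lemma voronoi_boundary_null : lam (V `\` @voronoi_interior R) = 0%E.
Proof.
apply: null_dilation.
- exact: measurable_voronoi.
- exact: measurable_voronoi_interior.
- apply: (@le_lt_trans _ _ (lam (quat_ball 1))); last exact: quat_ball_lty.
  apply: le_measure; rewrite ?inE; [exact: measurable_voronoi|exact: measurable_quat_ball|].
  by move=> x /voronoi_sqn; rewrite /quat_ball /=; lra.
- exact: voronoi_interior_sub.
move=> s [[[x0 x1] x2] x3] /andP[s0 s1].
have -> : quat_real s * ((x0, x1, x2, x3) : quat R) = (s * x0, s * x1, s * x2, s * x3).
  by rewrite quat_mulE; apply: quat_eq; ring.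
move=> [/= /and5P[h0 h1 h2 h3 _] h4].
have c x : `|x| <= 2^-1 -> `|s * x| < 2^-1.
  by move=> h; rewrite normrM gtr0_norm//; nra.
split; first by rewrite /= !c.
by rewrite !normrM gtr0_norm// -!mulrDr; nra.
Qed.

Lemma origin_null : lam [set 0] = 0%E.
Proof.
have -> : [set (0 : quat R)] = [set 0 : R] `*` [set 0 : R] `*` [set 0 : R] `*` [set 0 : R].
  by apply/seteqP; split=> [_ ->//|[[[a b] c] e] [[[/= -> ->] ->] ->]].
apply: etrans; first by apply: sprodE => //; do 2!(apply: measurableX => //).
by apply: etrans (mule0 _); congr (_ * _)%E; exact: lebesgue_measure_set1.
Qed.

Lemma sphere_null r : lam [set x | sqn x = r] = 0%E.
Proof.
have [r0|r0|->] := ltgtP r 0.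
- rewrite (_ : [set _ | _] = set0) ?measure0//; apply/seteqP; split=> x //= xr.
  by have := sqn_ge0 x; rewrite xr leNgt r0.
- pose B := [set x : quat R | sqn x < r].
  have mB : measurable B.
    rewrite (_ : B = sqn @^-1` `]-oo, r[%classic).
      rewrite -[X in measurable X]setTI.
      by apply: measurable_sqn => //; exact: measurable_id.
    by apply/seteqP; split=> x; rewrite /B /= in_itv.
  have <- : lam (quat_ball r `\` B) = 0%E.
    apply: null_dilation => //; first exact: measurable_quat_ball.
    + have sr : 0 < (Num.sqrt r)^-1 by rewrite invr_gt0 sqrtr_gt0.
      have [_ sc] := scaling_quat_real sr.
      have := sc _ (measurable_quat_ball 1); rewrite (_ : _ @^-1` _ = quat_ball r).
        move=> ->; apply: lte_mul_pinfty => //; last exact: quat_ball_lty.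
      have E x : (sqn (quat_real (Num.sqrt r)^-1 * x) <= 1) = (sqn x <= r).
        rewrite sqnM sqn_real exprVn sqr_sqrtr; last exact: ltW.
        by rewrite ler_pdivrMl// mulr1.
      by apply/seteqP; split=> x h; [rewrite /quat_ball /mkset -E|rewrite /quat_ball /preimage /mkset E].
    + by move=> x; rewrite /B /quat_ball /= => /ltW.
    + move=> s x /andP[s0 s1]; rewrite /B /quat_ball /= sqnM sqn_real => xr.
      apply: (@le_lt_trans _ _ (s ^+ 2 * r)); first by rewrite ler_wpM2l ?sqr_ge0.
      by rewrite gtr_pMl// exprn_ilt1// ltW.
  congr (lam _); apply/seteqP; split=> x; rewrite /quat_ball /B /=.
    by move=> ->; split=> //; rewrite ltxx.
  by move=> [? /negP]; rewrite -leNgt => ?; apply/eqP; rewrite eq_le; apply/andP.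
rewrite -origin_null; congr (lam _); apply/seteqP; split=> x /=.
  by move=> /eqP; rewrite sqn_eq0 => /eqP.
by move=> ->; rewrite sqn0.
Qed.

(* Measure preserving, and replaces [|x|] by [1/2 - |x|] on ]-1/2, 1/2]. *)
Definition swap_halves (x : R) : R :=
  if (- 2^-1 < x) && (x <= 0) then x + 2^-1
  else if (0 < x) && (x <= 2^-1) then x - 2^-1 else x.

(** The line is cut into [I1], [I2] and the rest: translations by 1/2 exchange the first two pieces,
    and the rest is fixed pointwise. *)
Lemma scaling_swap_halves : scaling 1 mu mu swap_halves.
Proof.
have ms : measurable_fun setT swap_halves.
  apply: measurable_fun_ifT.
    by apply: measurable_and; [apply: measurable_fun_ltr|apply: measurable_fun_ler].
  - exact: measurable_funD.
  apply: measurable_fun_ifT; [|exact: measurable_funB|exact: measurable_id].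
  by apply: measurable_and; [apply: measurable_fun_ltr|apply: measurable_fun_ler].
split=> // A mA; rewrite mul1e.
set I1 : set R := `]- 2^-1, 0]%classic; set I2 : set R := `]0, 2^-1]%classic.
have m1 : measurable I1 by exact: measurable_itv.
have m2 : measurable I2 by exact: measurable_itv.
have split B : measurable B ->
    mu B = (mu ((B `\` I1) `\` I2) + mu ((B `\` I1) `&` I2) + mu (B `&` I1))%E.
  move=> mB; apply: etrans (measureDI mu mB m1) _; congr (_ + _)%E.
  by apply: measureDI => //; exact: measurableD.
have mA' : measurable (swap_halves @^-1` A).
  by rewrite -[X in measurable X]setTI; exact: ms.
have shift u := (@scaling_addR R u).2.
have E1 x : I1 x -> swap_halves x = x + 2^-1.
  by rewrite /swap_halves /I1 /= in_itv/= => ->.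
have E2 x : I2 x -> swap_halves x = x - 2^-1.
  rewrite /swap_halves /I2 /= in_itv/= => /[dup] /andP[x0 _] ->.
  by rewrite [x <= 0]leNgt x0 andbF.
have E3 x : ~ I1 x -> ~ I2 x -> swap_halves x = x.
  by rewrite /swap_halves /I1 /I2 /= !in_itv/= => /negP/negbTE-> /negP/negbTE->.
have I12 x : I1 x <-> I2 (x + 2^-1).
  by rewrite /I1 /I2 /= !in_itv/=; split=> /andP[? ?]; apply/andP; split; lra.
have I21 x : I2 x <-> I1 (x - 2^-1).
  by rewrite /I1 /I2 /= !in_itv/=; split=> /andP[? ?]; apply/andP; split; lra.
have disj x : I1 x -> ~ I2 x.
  by rewrite /I1 /I2 /= !in_itv/= => /andP[? ?] /andP[? ?]; lra.
have e1 : (swap_halves @^-1` A `\` I1) `\` I2 = (A `\` I1) `\` I2.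
  by apply/seteqP; split=> x [[/= Ax n1] n2]; split=> //; split=> //; move: Ax; rewrite /= E3.
have e2 : mu ((swap_halves @^-1` A `\` I1) `&` I2) = mu (A `&` I1).
  rewrite -[RHS]mul1e -(shift (- 2^-1)); last exact: measurableI.
  congr (mu _); apply/seteqP; split=> x.
    by move=> [[/= Ax _] x2]; rewrite /= addrC; split; [rewrite -E2|exact/I21].
  rewrite /= addrC => -[Ax /I21 x2]; split=> //; split=> //=; first by rewrite E2.
  by move=> /disj.
have e3 : mu (swap_halves @^-1` A `&` I1) = mu ((A `\` I1) `&` I2).
  rewrite -[RHS]mul1e -(shift 2^-1); last first.
    by apply: measurableI => //; exact: measurableD.
  congr (mu _); apply/seteqP; split=> x.
    move=> [/= Ax x1]; rewrite addrC; split; last exact/I12.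
    by split; [rewrite -E1|move=> /disj; apply; exact/I12].
  by rewrite /= addrC => -[[Ax _] /I12 x1]; split=> //=; rewrite E1.
apply: etrans (split _ mA') _; rewrite e1 e2 e3 -addeA [X in (_ + X)%E]addeC addeA.
exact: esym (split A mA).
Qed.

Lemma voronoi_volume : lam V = (2^-1)%:E.
Proof.
(* Half-open, so that [swap_halves] maps it to itself and the cube has volume exactly 1. *)
pose I : set R := `]- 2^-1, 2^-1]%classic.
pose Q : set (quat R) := I `*` I `*` I `*` I.
pose sum (X : quat R) := `|X.1.1.1| + `|X.1.1.2| + `|X.1.2| + `|X.2|.
have mI : measurable I by exact: measurable_itv.
have mQ : measurable Q by do 3!(apply: measurableX => //).
have Q1 : lam Q = 1%E.
  have I1 : (mu : {sigma_finite_measure set _ -> \bar R}) I = 1%E.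
    rewrite /I [LHS]lebesgue_measure_itv/= lte_fin ifT; last by lra.
    by rewrite -EFinD; congr EFin; lra.
  rewrite /quat_lebesgue /Q !sprodE//; do ?exact: measurableX.
    by rewrite I1 !mule1.
  by do 2!(apply: measurableX => //).
have [_ _ _ _ ms] := measurable_voronoi_norms.
have mlt : measurable [set X | sum X < 1].
  rewrite (_ : [set _ | _] = sum @^-1` `]-oo, 1[%classic).
    by rewrite -[X in measurable X]setTI; exact: ms.
  by apply/seteqP; split=> X; rewrite /= in_itv.
have meq : measurable [set X | sum X = 1].
  rewrite (_ : [set _ | _] = sum @^-1` [set 1])//.
  by rewrite -[X in measurable X]setTI; exact: ms.
pose t (q : quat R) : quat R := (swap_halves q.1.1.1, swap_halves q.1.1.2,
  swap_halves q.1.2, swap_halves q.2).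
have st : scaling 1 lam lam t.
  have := scaling_quat ler01 scaling_swap_halves scaling_swap_halves
    scaling_swap_halves scaling_swap_halves.
  by rewrite expr1n.
have tI x : I (swap_halves x) <-> I x.
  rewrite /I /= !in_itv/= /swap_halves.
  have [/andP[? ?]|_] := boolP ((- 2^-1 < x) && (x <= 0)).
    by split=> /andP[? ?]; apply/andP; split; lra.
  have [/andP[? ?]|//] := boolP ((0 < x) && (x <= 2^-1)).
  by split=> /andP[? ?]; apply/andP; split; lra.
have tN x : I x -> `|swap_halves x| = 2^-1 - `|x|.
  rewrite /I /= in_itv/= /swap_halves => /andP[x1 x2]; have [x0|x0] := leP x 0.
    by rewrite x1 /= (ler0_norm x0) ger0_norm; lra.
  by rewrite andbF x2 /= (gtr0_norm x0) ler0_norm; lra.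
pose L := [set X | sum X < 1]; pose E := [set X | sum X = 1].
have mQL : measurable (Q `&` L) by exact: measurableI.
have tQ X : Q (t X) <-> Q X.
  by case: X => [[[x0 x1] x2] x3]; rewrite /Q /t /= !tI.
have tsum X : Q X -> sum (t X) = 2 - sum X.
  case: X => [[[x0 x1] x2] x3] [[[/= I0 I1] I2] I3].
  by rewrite /sum /t /= !tN//; lra.
have gtE : lam (Q `&` [set X | 1 < sum X]) = lam (Q `&` L).
  rewrite -[RHS]mul1e -(st.2 _ mQL); congr (lam _).
  by apply/seteqP; split=> X [/= QX]; [move=> h; split; [exact/tQ|rewrite /L /= tsum//; lra]
    |move=> h; have QX' := (tQ X).1 QX; split=> //; move: h; rewrite /L /= tsum//; lra].
have QV X : Q X -> sum X <= 1 -> V X.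
  case: X => [[[x0 x1] x2] x3] [[[/= I0 I1] I2] I3]; rewrite /sum /= => s1.
  have n x : I x -> `|x| <= 2^-1 by rewrite /I /= in_itv/= ler_norml => /andP[/ltW-> ->].
  by split; rewrite //= !n.
have VQ X : voronoi_interior X -> (Q `&` L) X.
  case: X => [[[x0 x1] x2] x3] [/= /and5P[h0 h1 h2 h3 _] h4].
  have n x : `|x| < 2^-1 -> I x by rewrite /I /= in_itv/= ltr_norml => /andP[-> /ltW ->].
  by split => //; split; [split; [split|]|]; exact: n.
(* Points of the cube with coordinate sum exactly 1 lie in the cell but not in its interior. *)
have nE : lam (Q `&` E) = 0%E.
  apply/eqP; rewrite eq_le measure_ge0 andbT -voronoi_boundary_null.
  apply: le_measure; rewrite ?inE.
  - exact: measurableI.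
  - by apply: measurableD; [exact: measurable_voronoi|exact: measurable_voronoi_interior].
  move=> X [QX]; rewrite /E /= => s1; split; first by apply: QV => //; rewrite s1.
  by move=> /VQ[_]; rewrite /L /= s1 ltxx.
have VE : lam V = lam (Q `&` L).
  apply/eqP; rewrite eq_le; apply/andP; split; last first.
    apply: le_measure; rewrite ?inE//; first exact: measurable_voronoi.
    by move=> X [QX /ltW]; exact: QV.
  have mV := measurable_voronoi; have mVi := measurable_voronoi_interior.
  have -> : lam V = lam (@voronoi_interior R).
    apply: etrans (measureDI lam mV mVi) _; apply: etrans (add0e _); congr (_ + lam _)%E.
      exact: voronoi_boundary_null.
    by apply: setIidr; exact: voronoi_interior_sub.
  by apply: le_measure; rewrite ?inE.
(* The cube splits into sum less than 1, sum greater than 1, of equal volume by [gtE], and the null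
   set where the sum is 1. *)
have e1 : (1 = lam (Q `&` L) + lam (Q `&` L))%E.
  rewrite -{1}Q1; apply: etrans (measureDI lam mQ mlt) _; congr (_ + _)%E.
  rewrite -gtE -[RHS]adde0 -nE.
  apply: etrans (measureDI lam (measurableD mQ mlt) meq) _; congr (lam _ + lam _)%E.
    apply/seteqP; split=> X /=.
      by move=> [[QX /negP]]; rewrite -leNgt le_eqVlt => /orP[/eqP/esym|].
    move=> [QX h]; split=> [|h']; last by move: h; rewrite h' ltxx.
    by split=> //; apply/negP; rewrite -leNgt ltW.
  apply/seteqP; split=> X /=; first by move=> [[QX _] s1].
  by move=> [QX s1]; split=> //; split=> //; rewrite s1 ltxx.
rewrite VE; move: (lam _) e1 => [x| |]//=; rewrite -EFinD => -[e1].
by congr EFin; lra.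
Qed.

End VoronoiVolume.

(** * Reduced bases *)

Arguments mat_vec : simpl never.
Arguments quat_sqnorm : simpl never.
Arguments quat_conj : simpl never.
Arguments quat_re : simpl never.

Section ReducedBases.
Context {R : realType}.
Local Notation sqn := (@quat_sqnorm R).
Local Notation hw := (@hurwitz R).
Local Notation V := (@voronoi_cell R).
Local Notation vec := (quat R * quat R)%type.
Local Notation mat := (vec * vec)%type.
Implicit Types (g h x y : mat) (v w : vec) (m n X : quat R).

Definition vec_sqn v : R := sqn v.1 + sqn v.2.

(** The [X] for which [x.2 - x.1 X] is orthogonal to [x.1] in the Hermitian product
    [sum_i quat_conj p_i * q_i]. *)
Definition gram_coef x : quat R :=
  quat_real (vec_sqn x.1)^-1 *
  (quat_conj x.1.1 * x.2.1 + quat_conj x.1.2 * x.2.2).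

Lemma vec_sqn_ge0 v : 0 <= vec_sqn v.
Proof. by rewrite addr_ge0 ?sqn_ge0. Qed.

Lemma vec_sqn_eq0 v : (vec_sqn v == 0) = (v == 0).
Proof. by case: v => p q; rewrite paddr_eq0 ?sqn_ge0// !sqn_eq0. Qed.

Lemma vec_sqn_gt0 v : (0 < vec_sqn v) = (v != 0).
Proof. by rewrite lt_def vec_sqn_ge0 andbT vec_sqn_eq0. Qed.

Lemma vec_sqn_scale v m : vec_sqn (vec_scale v m) = vec_sqn v * sqn m.
Proof. by rewrite /vec_sqn /= !sqnM mulrDl. Qed.

Lemma sqnD (p q : quat R) : sqn (p + q) = sqn p + sqn q + 2 * quat_re (quat_conj p * q).
Proof.
have := sqnB_real p q (- 1); rewrite (_ : quat_real (-1) * q = - q) ?opprK; last first.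
  by case: q => [[[? ?] ?] ?]; rewrite quat_mulE quat_oppE; apply: quat_eq; ring.
by move=> ->; ring.
Qed.

Lemma quat_reD (p q : quat R) : quat_re (p + q) = quat_re p + quat_re q.
Proof. by []. Qed.

Lemma quat_re_real k (q : quat R) : quat_re (quat_real k * q) = k * quat_re q.
Proof. by case: q => [[[? ?] ?] ?]; rewrite quat_mulE /quat_re /=; ring. Qed.

(* Cauchy-Binet *)
Lemma mat_norm_gram x : mat_norm x =
  vec_sqn x.1 * vec_sqn x.2 -
  sqn (quat_conj x.1.1 * x.2.1 + quat_conj x.1.2 * x.2.2).
Proof.
rewrite /mat_norm /vec_sqn sqnD !sqnM !sqn_conj quat_conjM quat_conjK.
have -> : quat_re (quat_conj x.2.1 * x.1.1 * (quat_conj x.1.2 * x.2.2)) =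
    quat_re (x.1.1 * quat_conj x.1.2 * x.2.2 * quat_conj x.2.1).
  by rewrite -!mulrA quat_reC -!mulrA.
by ring.
Qed.

(** Pythagoras: the component along [x.1] is [x.1 (m + X n)], and the part of [x.2] orthogonal to
    [x.1] has squared length [mat_norm x / |x.1|^2]. *)
Lemma vec_sqn_comb x m n : x.1 != 0 ->
  vec_sqn (mat_vec x (m, n)) =
  vec_sqn x.1 * sqn (m + gram_coef x * n) + mat_norm x / vec_sqn x.1 * sqn n.
Proof.
move=> x0; have s0 : vec_sqn x.1 != 0 by rewrite vec_sqn_eq0.
rewrite mat_norm_gram; set s := vec_sqn x.1 in s0 *.
set G := quat_conj x.1.1 * x.2.1 + quat_conj x.1.2 * x.2.2.
have -> : gram_coef x = quat_real s^-1 * G by [].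
have rE : quat_re (quat_conj m * (quat_real s^-1 * G * n)) =
    s^-1 * quat_re (quat_conj m * (G * n)).
  by rewrite -[_ * G * n]mulrA mulrA -quat_realC -mulrA quat_re_real.
rewrite sqnD !sqnM sqn_real rE.
rewrite [in LHS]/vec_sqn !sqnD !sqnM !quat_conjM.
have -> : quat_re (quat_conj m * (G * n)) =
   quat_re (quat_conj m * quat_conj x.1.1 * (x.2.1 * n)) +
   quat_re (quat_conj m * quat_conj x.1.2 * (x.2.2 * n)).
  by rewrite -quat_reD -!mulrA -mulrDr mulrDl !mulrA.
rewrite [X in X = _](_ : _ = s * sqn m + vec_sqn x.2 * sqn n +
   2 * (quat_re (quat_conj m * quat_conj x.1.1 * (x.2.1 * n)) +
   quat_re (quat_conj m * quat_conj x.1.2 * (x.2.2 * n)))); last first.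
  by rewrite /s /vec_sqn; ring.
by field.
Qed.

Lemma vec_sqn_col2 x : x.1 != 0 ->
  vec_sqn x.2 = vec_sqn x.1 * sqn (gram_coef x) + mat_norm x / vec_sqn x.1.
Proof.
move=> x0; have := vec_sqn_comb 0 1 x0.
by rewrite mat_vecE vec_scale0 vec_scale1 !add0r mulr1 [sqn 1]sqn1 mulr1.
Qed.

Lemma mat_norm_col1 x : mat_norm x != 0 -> x.1 != 0.
Proof.
apply: contra => /eqP x0.
have x1 : x.1.1 = 0 by rewrite x0.
have x2 : x.1.2 = 0 by rewrite x0.
by rewrite mat_norm_antipivot// x2 [sqn 0]sqn0 mulr0.
Qed.

Definition hurwitz_gamma : set mat :=
  [set u | mat_norm u = 1 /\ [/\ hw u.1.1, hw u.1.2, hw u.2.1 & hw u.2.2]].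

Lemma hurwitz_gamma1 : hurwitz_gamma mat_one.
Proof.
split; first exact: mat_norm1.
by split; [exact: hurwitz1|exact: hurwitz0|exact: hurwitz0|exact: hurwitz1].
Qed.

Lemma hurwitz_gammaM g h : hurwitz_gamma g -> hurwitz_gamma h ->
  hurwitz_gamma (mat_mul g h).
Proof.
move=> [Ng [g1 g2 g3 g4]] [Nh [h1 h2 h3 h4]].
split; first by rewrite mat_normM Ng Nh mulr1.
by split; apply: hurwitzD; exact: hurwitzM.
Qed.

Lemma hurwitz_gammaV g : hurwitz_gamma g -> hurwitz_gamma (mat_adj g).
Proof.
move=> [Ng [g1 g2 g3 g4]]; split; first exact: mat_norm_adj.
case: g Ng g1 g2 g3 g4 => -[a c] [b d] /= _ ha hc hb hd.
by split; apply: hurwitzB; repeat (apply: hurwitzM || apply: hurwitz_conj).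
Qed.

Definition swap_mat : mat := ((0, 1), (-1, 0)).

Lemma hurwitz_gamma_swap : hurwitz_gamma swap_mat.
Proof.
split; last first.
  by split; [exact: hurwitz0|exact: hurwitz1|exact/hurwitzN/hurwitz1|exact: hurwitz0].
by rewrite mat_norm_antipivot//= sqnN !sqn1 mulr1.
Qed.

Definition shear_mat m : mat := ((1, 0), (m, 1)).

Lemma quat_one_neq0 : (1 : quat R) != 0.
Proof. exact: oner_neq0. Qed.

Lemma hurwitz_gamma_shear m : hw m -> hurwitz_gamma (shear_mat m).
Proof.
move=> hm; split.
  rewrite mat_norm_pivot /=; last exact: quat_one_neq0.
  by rewrite !mul0r subr0 !sqn1 mulr1.
by split=> //; [exact: hurwitz1|exact: hurwitz0|exact: hurwitz1].
Qed.

Definition diag_mat m n : mat := ((m, 0), (0, n)).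

Lemma mat_norm_diag m n : mat_norm (diag_mat m n) = sqn m * sqn n.
Proof.
have [->|m0] := eqVneq m 0; first by rewrite mat_norm_antipivot//= !sqn0 !mul0r.
by rewrite mat_norm_pivot//= mulr0 subr0.
Qed.

Lemma hurwitz_gamma_diag m n : hw m -> hw n -> sqn m = 1 -> sqn n = 1 ->
  hurwitz_gamma (diag_mat m n).
Proof.
move=> hm hn m1 n1; split; first by rewrite mat_norm_diag m1 n1 mulr1.
by split=> //; exact: hurwitz0.
Qed.

(** The new columns are [x.1 m] and [x.1 p + x.2 n]. The case [m = n = 1] translates the
    coefficient, as reduction needs; unit diagonal matrices rotate it. *)
Lemma gram_coef_tri x m n p : x.1 != 0 -> m != 0 ->
  gram_coef (mat_mul x ((m, 0), (p, n))) =
  quat_inv m * (gram_coef x * n + p).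
Proof.
move=> x0 m0; have s0 : vec_sqn x.1 != 0 by rewrite vec_sqn_eq0.
set y := mat_mul x _; set s := vec_sqn x.1 in s0 *.
have e1 : y.1 = vec_scale x.1 m by rewrite /y [LHS]mat_vecE vec_scale0 addr0.
have e2 : y.2 = vec_scale x.1 p + vec_scale x.2 n by [].
rewrite /gram_coef e1 e2 vec_sqn_scale -/s /= !quat_conjM.
have -> : quat_conj m * quat_conj x.1.1 * (x.1.1 * p + x.2.1 * n) +
  quat_conj m * quat_conj x.1.2 * (x.1.2 * p + x.2.2 * n) =
  quat_conj m * ((quat_conj x.1.1 * x.2.1 + quat_conj x.1.2 * x.2.2) * n +
     quat_real s * p).
  rewrite -!mulrA -mulrDr; congr (_ * _).
  rewrite !mulrDr !mulrA !mul_conj_quat addrACA -mulrDl -quat_realD -/(vec_sqn _) -/s.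
  by rewrite addrC mulrDl.
set G := _ + _; rewrite /quat_inv.
have -> : quat_real (s * sqn m)^-1 = quat_real (sqn m)^-1 * quat_real s^-1.
  by rewrite -quat_realM invfM mulrC.
rewrite -!mulrA; congr (_ * _); rewrite mulrA quat_realC -mulrA; congr (_ * _).
by rewrite mulrDr !mulrA -quat_realM mulVf// mul1r.
Qed.

End ReducedBases.

Section Reduction.
Context {R : realType}.
Local Notation sqn := (@quat_sqnorm R).
Local Notation hw := (@hurwitz R).
Local Notation V := (@voronoi_cell R).
Local Notation vec := (quat R * quat R)%type.
Local Notation mat := (vec * vec)%type.
Local Notation Gamma := (@hurwitz_gamma R).
Implicit Types (g h x y : mat) (v w : vec) (m n X : quat R) (Y : set (R * quat R)).

Definition col_length x : R := Num.sqrt (vec_sqn x.1).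

Definition with_shape Y : set mat :=
  [set x | mat_norm x = 1 /\ Y (col_length x, gram_coef x)].

(** The last condition says that the first column is at most as long as the second:
    [t^2 <= t^2 |X|^2 + 1/t^2]. *)
Definition reduced_shape : set (R * quat R) :=
  [set p | [/\ 0 < p.1, V p.2 & 1 - 1 / p.1 ^+ 4 <= sqn p.2]].

Definition strictly_reduced_shape : set (R * quat R) :=
  [set p | [/\ 0 < p.1, voronoi_interior p.2 & 1 - 1 / p.1 ^+ 4 < sqn p.2]].

Lemma strictly_reduced_sub : strictly_reduced_shape `<=` reduced_shape.
Proof.
by move=> p [? /voronoi_interior_sub ? ?]; split=> //; exact: ltW.
Qed.

Lemma col_length_sqr x : col_length x ^+ 2 = vec_sqn x.1.
Proof. by rewrite sqr_sqrtr// vec_sqn_ge0. Qed.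

Lemma col_length4 x : col_length x ^+ 4 = vec_sqn x.1 ^+ 2.
Proof. by rewrite -col_length_sqr -exprM. Qed.

Lemma mat_norm1_col1 x : mat_norm x = 1 -> x.1 != 0.
Proof. by move=> x1; apply: mat_norm_col1; rewrite x1 oner_neq0. Qed.

Lemma col_length_gt0 x : mat_norm x = 1 -> 0 < col_length x.
Proof. by move=> /mat_norm1_col1; rewrite sqrtr_gt0 vec_sqn_gt0. Qed.

(** To be read with [T = t^2], the squared length of the first column. *)
Lemma reduced_condition (S T : R) : 0 < T ->
  (1 - 1 / T ^+ 2 <= S) = (T ^+ 2 - 1 <= T ^+ 2 * S).
Proof.
move=> T0; have T2 : 0 < T ^+ 2 by rewrite exprn_gt0.
by rewrite -(ler_pM2l T2) mulrBr mulr1 mulrCA divff ?gt_eqF// mulr1.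
Qed.

Lemma strictly_reduced_condition (S T : R) : 0 < T ->
  (1 - 1 / T ^+ 2 < S) = (T ^+ 2 - 1 < T ^+ 2 * S).
Proof.
move=> T0; have T2 : 0 < T ^+ 2 by rewrite exprn_gt0.
by rewrite -(ltr_pM2l T2) mulrBr mulr1 mulrCA divff ?gt_eqF// mulr1.
Qed.

Lemma with_reduced_shapeE x : with_shape reduced_shape x <->
  [/\ mat_norm x = 1, V (gram_coef x) &
      vec_sqn x.1 ^+ 2 - 1 <= vec_sqn x.1 ^+ 2 * sqn (gram_coef x)].
Proof.
split=> [[x1 [_ VX cond]]|[x1 VX cond]].
  split=> //; move: cond; rewrite [(_, _).1]/(col_length x) col_length4.
  by rewrite reduced_condition// vec_sqn_gt0 mat_norm1_col1.
split=> //; split=> //; first exact: col_length_gt0.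
rewrite [(_, _).1]/(col_length x) col_length4.
by rewrite reduced_condition// vec_sqn_gt0 mat_norm1_col1.
Qed.

Lemma with_strictly_reduced_shapeE x : with_shape strictly_reduced_shape x <->
  [/\ mat_norm x = 1, voronoi_interior (gram_coef x) &
      vec_sqn x.1 ^+ 2 - 1 < vec_sqn x.1 ^+ 2 * sqn (gram_coef x)].
Proof.
split=> [[x1 [_ VX cond]]|[x1 VX cond]].
  split=> //; move: cond; rewrite [(_, _).1]/(col_length x) col_length4.
  by rewrite strictly_reduced_condition// vec_sqn_gt0 mat_norm1_col1.
split=> //; split=> //; first exact: col_length_gt0.
rewrite [(_, _).1]/(col_length x) col_length4.
by rewrite strictly_reduced_condition// vec_sqn_gt0 mat_norm1_col1.
Qed.

Lemma ler_mul_self (T P Q : R) : 0 < T ->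
  (T <= T * P + 1 / T * Q) = (T ^+ 2 <= T ^+ 2 * P + Q).
Proof.
move=> T0; rewrite -(ler_pM2l T0) -expr2 mulrDr mulrA -expr2.
by rewrite mulrA mulrCA divff ?gt_eqF// mulr1 mul1r.
Qed.

Lemma ltr_mul_self (T P Q : R) : 0 < T ->
  (T < T * P + 1 / T * Q) = (T ^+ 2 < T ^+ 2 * P + Q).
Proof.
move=> T0; rewrite -(ltr_pM2l T0) -expr2 mulrDr mulrA -expr2.
by rewrite mulrA mulrCA divff ?gt_eqF// mulr1 mul1r.
Qed.

Lemma sqn_comb_unit X m n : sqn n = 1 ->
  sqn (m + X * n) = sqn (X - - (m * quat_conj n)).
Proof.
move=> n1; rewrite opprK -[RHS]mulr1 -{1}n1 -sqnM mulrDl -mulrA mul_conj_quat.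
by rewrite n1 quat_real1 mulr1 addrC.
Qed.

(** Three cases. If [n = 0], then [|m| >= 1]. If [|n| = 1], the Voronoi inequality gives
    [|m + X n| >= |X|], and the reduction condition concludes. Otherwise [|n|^2 >= 2], while that
    condition and [|X|^2 <= 1/2] force [t^4 <= 2], so the orthogonal part alone is long enough. *)
Lemma reduced_shortest x m n : with_shape reduced_shape x -> hw m -> hw n ->
  (m, n) != 0 -> vec_sqn x.1 <= vec_sqn (mat_vec x (m, n)).
Proof.
move=> /with_reduced_shapeE[x1 VX cond] hm hn mn0.
have x0 := mat_norm1_col1 x1; have T0 : 0 < vec_sqn x.1 by rewrite vec_sqn_gt0.
rewrite vec_sqn_comb// x1 ler_mul_self//; move: cond.
set X := gram_coef x in VX *; set K := _ ^+ 2; have K0 : 0 < K by rewrite exprn_gt0.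
move=> cond; have S2 := voronoi_sqn VX.
have [n0|n0] := eqVneq n 0.
  have m0 : m != 0 by apply: contra mn0 => /eqP->; rewrite n0.
  have := hurwitz_sqn_ge1 hm m0; rewrite n0 mulr0 addr0 sqn0; nra.
have [n1|n1] := eqVneq (sqn n) 1.
  have := voronoi_le VX (hurwitzN (hurwitzM hm (hurwitz_conj hn))).
  by rewrite -sqn_comb_unit// n1; nra.
have := hurwitz_sqn_ge2 hn n0 n1; have := sqn_ge0 (m + X * n); nra.
Qed.

(** In the cases of [reduced_shortest] with [n != 0] the inequality is now strict, so only [n = 0]
    with a unit [m] can reach the length of [x.1]. *)
Lemma strictly_reduced_shortest x m n :
  with_shape strictly_reduced_shape x -> hw m -> hw n ->
  (m, n) != 0 -> vec_sqn (mat_vec x (m, n)) <= vec_sqn x.1 -> n = 0 /\ sqn m = 1.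
Proof.
move=> /with_strictly_reduced_shapeE[x1 VX cond] hm hn mn0.
have x0 := mat_norm1_col1 x1; have T0 : 0 < vec_sqn x.1 by rewrite vec_sqn_gt0.
rewrite vec_sqn_comb// x1 leNgt ltr_mul_self//; move: cond.
set X := gram_coef x in VX *; set K := _ ^+ 2; have K0 : 0 < K by rewrite exprn_gt0.
move=> cond; have S2 := voronoi_sqn (voronoi_interior_sub VX).
have [n0|n0] := eqVneq n 0.
  have m0 : m != 0 by apply: contra mn0 => /eqP->; rewrite n0.
  move=> le; split=> //; move: le; rewrite n0 mulr0 addr0 sqn0 addr0 -leNgt.
  by rewrite -{2}[K]mulr1 ler_pM2l// => ?; apply/eqP; rewrite eq_le hurwitz_sqn_ge1// andbT.
have [n1|n1] := eqVneq (sqn n) 1.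
  have := voronoi_le (voronoi_interior_sub VX) (hurwitzN (hurwitzM hm (hurwitz_conj hn))).
  rewrite -sqn_comb_unit// n1 -leNgt => ? ?; exfalso; nra.
have := hurwitz_sqn_ge2 hn n0 n1; have := sqn_ge0 (m + X * n).
by rewrite -leNgt => ? ? ?; exfalso; nra.
Qed.

Lemma finite_min (T : choiceType) (A : set T) (f : T -> R) : finite_set A -> A !=set0 ->
  exists2 a, A a & forall b, A b -> f a <= f b.
Proof.
move=> /finite_seqP[s ->].
elim: s => [[x]|a s IH _] //.
have [->|s0] := eqVneq s [::].
  by exists a; [rewrite /= inE|move=> b /=; rewrite inE => /eqP->].
have [|b bs bmin] := IH; first by case: s s0 {IH} => // c s _; exists c; rewrite /= inE eqxx.
have [ab|ba] := leP (f a) (f b).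
  exists a; first by rewrite /= inE eqxx.
  by move=> c /=; rewrite inE => /orP[/eqP->//|cs]; exact: le_trans ab (bmin _ cs).
exists b; first by rewrite /= inE; apply/orP; right.
by move=> c /=; rewrite inE => /orP[/eqP->|/bmin//]; exact: ltW.
Qed.

Lemma sqnD_le (p q : quat R) : sqn (p + q) <= 2 * (sqn p + sqn q).
Proof.
case: p q => [[[a0 a1] a2] a3] [[[b0 b1] b2] b3]; rewrite quat_addE /quat_sqnorm.
have H (a b : R) : (a + b) ^+ 2 <= 2 * (a ^+ 2 + b ^+ 2).
  by have := sqr_ge0 (a - b); nra.
by have := H a0 b0; have := H a1 b1; have := H a2 b2; have := H a3 b3; lra.
Qed.

Definition mat_sqn x : R := vec_sqn x.1 + vec_sqn x.2.

Lemma vec_sqn_mat_vec x v : vec_sqn (mat_vec x v) <= 2 * mat_sqn x * vec_sqn v.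
Proof.
rewrite {1}/vec_sqn; apply: (le_trans (lerD (sqnD_le _ _) (sqnD_le _ _))).
rewrite !sqnM /mat_sqn /vec_sqn.
have := sqn_ge0 x.1.1; have := sqn_ge0 x.1.2; have := sqn_ge0 x.2.1.
have := sqn_ge0 x.2.2; have := sqn_ge0 v.1; have := sqn_ge0 v.2.
nra.
Qed.

Lemma mat_sqn_mul x y : mat_sqn (mat_mul x y) <= 2 * mat_sqn x * mat_sqn y.
Proof.
rewrite {1}/mat_sqn mulrDr; apply: lerD; exact: vec_sqn_mat_vec.
Qed.

Lemma mat_vec_adjK x v : mat_norm x = 1 -> mat_vec (mat_adj x) (mat_vec x v) = v.
Proof. by move=> x1; rewrite -mat_vec_mul mat_adj_mul// mat_vec1. Qed.

Lemma finite_hurwitz_vec (C : R) :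
  finite_set [set v : vec | [/\ hw v.1, hw v.2 & vec_sqn v <= C]].
Proof.
pose B := [set q : quat R | hw q /\ sqn q <= C].
apply: (sub_finite_set (B := B `*` B)); last first.
  by apply: finite_setX; exact: finite_hurwitz_ball.
move=> v [h1 h2 vC]; split; split=> //; apply: le_trans vC; rewrite /vec_sqn.
  by rewrite lerDl sqn_ge0.
by rewrite lerDr sqn_ge0.
Qed.

(** The minimum is taken over first columns of elements of [Gamma], so that the minimiser extends to
    a basis by construction. A shear then moves the Gram-Schmidt coefficient into the cell without
    changing the first column. *)
Lemma reduction x : mat_norm x = 1 ->
  exists2 u, Gamma u & with_shape reduced_shape (mat_mul x u).
Proof.
move=> x1.
(* Applying the inverse of [x] shows that [|x v| <= |x.1|] implies [|v|^2 <= C], so only finitely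
   many candidates compete. *)
pose C := 2 * mat_sqn (mat_adj x) * vec_sqn x.1.
pose A := [set v : vec | [/\ hw v.1, hw v.2 & vec_sqn v <= C]] `&`
  [set v | exists2 u, Gamma u & u.1 = v].
have finA : finite_set A.
  by apply: sub_finite_set (finite_hurwitz_vec C); apply: subIsetl.
have inA u : Gamma u -> vec_sqn (mat_vec x u.1) <= vec_sqn x.1 -> A u.1.
  move=> Gu le; split; last by exists u.
  have [_ [h1 h2 _ _]] := Gu; split=> //.
  rewrite -[u.1](mat_vec_adjK _ x1); apply: (le_trans (vec_sqn_mat_vec _ _)).
  apply: ler_wpM2l => //; rewrite mulr_ge0// /mat_sqn addr_ge0// vec_sqn_ge0//.
have xe : mat_vec x mat_one.1 = x.1.
  by rewrite mat_vecE /= vec_scale1 vec_scale0 addr0.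
have A0 : A !=set0.
  by exists mat_one.1; apply: inA; [exact: hurwitz_gamma1|rewrite xe].
have [v [vC [u Gu uv]] vmin] := finite_min (fun v => vec_sqn (mat_vec x v)) finA A0.
have umin g : Gamma g -> vec_sqn (mat_vec x u.1) <= vec_sqn (mat_vec x g.1).
  move=> Gg; rewrite uv.
  have vx : vec_sqn (mat_vec x v) <= vec_sqn x.1.
    rewrite -[in leRHS]xe; apply/vmin/inA; first exact: hurwitz_gamma1.
    by rewrite xe.
  have [le|/ltW lt] := leP (vec_sqn (mat_vec x g.1)) (vec_sqn x.1).
    exact: vmin (inA _ Gg le).
  exact: le_trans vx lt.
pose y := mat_mul x u.
have y1 : mat_norm y = 1 by rewrite mat_normM x1 Gu.1 mulr1.
have [h hh Vh] := voronoi_cover (gram_coef y).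
have hNh : hw (- h) by exact: hurwitzN.
pose z := mat_mul y (shear_mat (- h)).
have z1 : mat_norm z = 1 by rewrite mat_normM y1 (hurwitz_gamma_shear hNh).1 mulr1.
have zy : z.1 = y.1.
  by rewrite /z /= [LHS]mat_vecE /= vec_scale1 vec_scale0 addr0.
have y0 := mat_norm1_col1 y1.
have Xz : gram_coef z = gram_coef y - h.
  rewrite /z /shear_mat gram_coef_tri//; last exact: oner_neq0.
  by rewrite mulr1 /quat_inv sqn1 invr1 quat_real1 mul1r (_ : quat_conj 1 = 1) ?mul1r//;
    apply: quat_eq; rewrite ?oppr0.
exists (mat_mul u (shear_mat (- h))).
  by apply: hurwitz_gammaM => //; exact: hurwitz_gamma_shear.
rewrite mat_mulA -/y -/z; apply/with_reduced_shapeE; split; rewrite ?Xz//.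
have T0 : 0 < vec_sqn z.1 by rewrite vec_sqn_gt0 mat_norm1_col1.
(* Exchanging the columns makes [z.2] a first column too; minimality then gives [|z.1| <= |z.2|],
   which is the reduction condition. *)
have Gw : Gamma (mat_mul (mat_mul u (shear_mat (- h))) swap_mat).
  apply: hurwitz_gammaM; last exact: hurwitz_gamma_swap.
  by apply: hurwitz_gammaM => //; exact: hurwitz_gamma_shear.
have := umin _ Gw.
have -> : mat_vec x u.1 = z.1 by rewrite zy.
have -> : mat_vec x (mat_mul (mat_mul u (shear_mat (- h))) swap_mat).1 = z.2.
  rewrite /mat_mul [(_, _).1]/(mat_vec _ _) -mat_vec_mul mat_mulA -/y -/z.
  by rewrite mat_vecE [(0, 1).1]/= [(0, 1).2]/= vec_scale0 vec_scale1 add0r.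
rewrite vec_sqn_col2 ?mat_norm1_col1// z1 -Xz.
rewrite -(ler_pM2l T0) -expr2 mulrDr mulrA -expr2 mulrCA divff ?gt_eqF// mulr1.
by rewrite lerBlDr.
Qed.

End Reduction.

(** * The volume of Gamma in the coordinates (t, X) *)

Section ProductAssociativity.
Context {R : realType} d1 d2 d3 (T1 : measurableType d1) (T2 : measurableType d2)
  (T3 : measurableType d3).
Variables (m1 : {sigma_finite_measure set T1 -> \bar R})
  (m2 : {sigma_finite_measure set T2 -> \bar R})
  (m3 : {sigma_finite_measure set T3 -> \bar R}).

Lemma scaling_assoc : scaling 1 (sprod (sprod m1 m2) m3) (sprod m1 (sprod m2 m3))
  (fun p => (p.1.1, (p.1.2, p.2))).
Proof.
have ma : measurable_fun setT (fun p : T1 * T2 * T3 => (p.1.1, (p.1.2, p.2))).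
  apply: measurable_fun_pair.
    exact: measurableT_comp (@measurable_fst _ _ _ _) (@measurable_fst _ _ _ _).
  apply: measurable_fun_pair; last exact: measurable_snd.
  exact: measurableT_comp (@measurable_snd _ _ _ _) (@measurable_fst _ _ _ _).
split=> // A mA; rewrite mul1e.
pose F (p : T1 * T2) : \bar R := m3 [set z | A (p.1, (p.2, z))].
have mF : measurable_fun setT F.
  have mA' : measurable ((fun p : T1 * T2 * T3 => (p.1.1, (p.1.2, p.2))) @^-1` A).
    by rewrite -[X in measurable X]setTI; exact: ma.
  by have := measurable_measure_slice1 m3 mA'; congr measurable_fun; apply/funext => -[].
apply: etrans; first exact: measure_fubini1.
transitivity (\int[m1]_x \int[m2]_y F (x, y))%E.
  exact: (@fubini_tonelli1 _ _ _ _ _ m1 m2 F mF (fun p => measure_ge0 _ _)).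
apply: etrans; last by apply/esym; exact: measure_fubini1.
by apply: eq_integral => x _; apply/esym; exact: measure_fubini1.
Qed.

Lemma scaling_fst d (T : measurableType d) (m : {sigma_finite_measure set T -> \bar R})
  (f : T1 -> T) : scaling 1 m1 m f ->
  scaling 1 (sprod m1 m2) (sprod m m2) (fun p => (f p.1, p.2)).
Proof.
by move=> sf; have := scaling_prod ler01 ler01 sf (scaling_id m2); rewrite mulr1.
Qed.

End ProductAssociativity.

Section VolumeOfGamma.
Context {R : realType}.
Local Notation sqn := (@quat_sqnorm R).
Local Notation lam := (@quat_lebesgue R).
Local Notation mu := (@lebesgue_measure R).
Local Notation V := (@voronoi_cell R).

(** Matches the left-nested fivefold product in [vol_Gamma] with the product of R and the
    quaternions. *)
Lemma scaling_coords : scaling 1 (sprod (sprod (sprod (sprod mu mu) mu) mu) mu)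
  (sprod mu lam) (fun p : R * R * R * R * R =>
    (p.1.1.1.1, (p.1.1.1.2, p.1.1.2, p.1.2, p.2) : quat R)).
Proof.
have s1 := scaling_fst mu (scaling_fst mu (scaling_assoc mu mu mu)).
have s2 := scaling_fst mu (scaling_assoc mu (sprod mu mu) mu).
have s3 := scaling_assoc mu (sprod (sprod mu mu) mu) mu.
by have := scaling_comp (scaling_comp s1 s2) s3; rewrite !mul1r.
Qed.

Let measurable_condition : let c (p : measurableTypeR R * quat R) := 1 - 1 / p.1 ^+ 4 in
  let n (p : measurableTypeR R * quat R) := sqn p.2 in
  measurable_fun setT c /\ measurable_fun setT n.
Proof.
have mt := @measurable_fst _ _ (measurableTypeR R) (quat R).
split; last exact: measurable_sqn (@measurable_snd _ _ (measurableTypeR R) (quat R)).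
apply: measurable_funB => //; apply: measurable_funM => //.
by apply: measurableT_comp (@measurable_invr R) _; exact: measurable_funX.
Qed.

Lemma measurable_reduced_shape : measurable (@reduced_shape R).
Proof.
have [mc mn] := measurable_condition.
have mb : measurable_fun setT (fun p : measurableTypeR R * quat R =>
    (0 < p.1) && (1 - 1 / p.1 ^+ 4 <= sqn p.2)).
  by apply: measurable_and; [exact: measurable_fun_ltr|exact: measurable_fun_ler].
rewrite (_ : @reduced_shape R = (fun p : measurableTypeR R * quat R =>
    (0 < p.1) && (1 - 1 / p.1 ^+ 4 <= sqn p.2)) @^-1` [set true] `&` snd @^-1` V).
  apply: measurableI; first by rewrite -[X in measurable X]setTI; exact: mb.
  rewrite -[X in measurable X]setTI; apply: (@measurable_snd _ _ (measurableTypeR R)) => //.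
  exact: measurable_voronoi.
by apply/seteqP; split=> p /=; [case=> -> VX ->|case=> /andP[]].
Qed.

Lemma measurable_strictly_reduced_shape : measurable (@strictly_reduced_shape R).
Proof.
have [mc mn] := measurable_condition.
have mb : measurable_fun setT (fun p : measurableTypeR R * quat R =>
    (0 < p.1) && (1 - 1 / p.1 ^+ 4 < sqn p.2)).
  by apply: measurable_and; exact: measurable_fun_ltr.
rewrite (_ : @strictly_reduced_shape R = (fun p : measurableTypeR R * quat R =>
    (0 < p.1) && (1 - 1 / p.1 ^+ 4 < sqn p.2)) @^-1` [set true] `&`
    snd @^-1` (@voronoi_interior R)).
  apply: measurableI; first by rewrite -[X in measurable X]setTI; exact: mb.
  rewrite -[X in measurable X]setTI; apply: (@measurable_snd _ _ (measurableTypeR R)) => //.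
  exact: measurable_voronoi_interior.
by apply/seteqP; split=> p /=; [case=> -> VX ->|case=> /andP[]].
Qed.

Definition power_density (t : R) : R := if 0 < t then t ^+ 7 else 0.

Lemma measurable_power_density : measurable_fun setT (fun t => (power_density t)%:E).
Proof.
apply/measurable_EFinP; apply: measurable_fun_ifT; last exact: measurable_cst.
  by apply: measurable_fun_ltr.
exact: measurable_funX.
Qed.

Lemma power_density_ge0 t : 0 <= power_density t.
Proof. by rewrite /power_density; case: ifPn => // t0; rewrite exprn_ge0// ltW. Qed.

Lemma vol_GammaE : vol_Gamma R = fine (\int[mu]_t
  ((power_density t)%:E * lam [set X | reduced_shape (t, X)]))%E.
Proof.
pose G (p : measurableTypeR R * quat R) : \bar R :=
  ((power_density p.1)%:E * (\1_(@reduced_shape R) p)%:E)%E.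
have G0 p : (0 <= G p)%E by rewrite mule_ge0// lee_fin power_density_ge0.
have mG : measurable_fun setT G.
  apply: emeasurable_funM.
    exact: measurableT_comp measurable_power_density (@measurable_fst _ _ _ _).
  by apply/measurable_EFinP; apply: measurable_indic; exact: measurable_reduced_shape.
have := integral_scaling ler01 scaling_coords mG G0; rewrite mul1e => e.
rewrite /vol_Gamma /Rintegral; congr fine.
transitivity (\int[sprod mu lam]_p G p)%E.
  apply: etrans e; rewrite integral_mkcond; apply: eq_integral => p _.
  case: p => [[[[t x0] x1] x2] x3]; rewrite /patch /G /= indicE.
  have -> : ((t, (x0, x1, x2, x3)) \in @reduced_shape R) =
      ((t, x0, x1, x2, x3) \in @Gamma_region R) by apply/idP/idP; rewrite !inE.
  case: ifPn => [|_]; last by rewrite mule0.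
  by rewrite inE => -[t0 _ _]; rewrite mule1 /power_density t0.
apply: etrans; first exact: fubini_tonelli1.
apply: eq_integral => t _.
have mt : measurable_fun setT (fun X => (\1_(@reduced_shape R) (t, X))%:E : \bar R).
  apply/measurable_EFinP; apply: measurableT_comp; last exact: measurable_pair1.
  by apply: measurable_indic; exact: measurable_reduced_shape.
transitivity ((power_density t)%:E * \int[lam]_X (\1_(@reduced_shape R) (t, X))%:E)%E.
  by rewrite -ge0_integralZl// lee_fin power_density_ge0.
congr (_ * _)%E; apply: etrans (integral_indic lam measurableT
  (measurable_slice1 t measurable_reduced_shape)) _.
by rewrite setIT.
Qed.
End VolumeOfGamma.

(** * The strictly reduced bases of one lattice *)

Section StrictlyReducedOrbit.
Context {R : realType}.
Local Notation sqn := (@quat_sqnorm R).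
Local Notation hw := (@hurwitz R).
Local Notation vec := (quat R * quat R)%type.
Local Notation mat := (vec * vec)%type.
Local Notation Gamma := (@hurwitz_gamma R).
Implicit Types (x u : mat) (m n h X : quat R).

Definition hurwitz_units : set (quat R) := [set q | hw q /\ sqn q = 1].

Lemma finite_hurwitz_units : finite_set hurwitz_units.
Proof.
by apply: sub_finite_set (finite_hurwitz_ball 1) => q [hq q1]; split; rewrite ?q1.
Qed.

Lemma with_shapeS (Y Z : set (R * quat R)) : Y `<=` Z ->
  with_shape Y `<=` with_shape Z.
Proof. by move=> YZ x [x1 Yx]; split=> //; exact: YZ. Qed.

Lemma quat_inv_unit m : sqn m = 1 -> quat_inv m = quat_conj m.
Proof. by move=> m1; rewrite /quat_inv m1 invr1 quat_real1 mul1r. Qed.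

Lemma unit_neq0 m : sqn m = 1 -> m != 0.
Proof. by move=> m1; rewrite -sqn_eq0 m1 oner_neq0. Qed.

(** If [h] were nonzero, the strict Voronoi inequality at [X] and at [X + h] would make each of them
    shorter than the other. *)
Lemma voronoi_interior_inj X h : hw h -> voronoi_interior X ->
  voronoi_interior (X + h) -> h = 0.
Proof.
move=> hh VX VXh; apply/eqP; apply: contraT => h0.
have := voronoi_lt VX (hurwitzN hh); rewrite oppr_eq0 opprK => /(_ h0) l1.
by have := voronoi_lt VXh hh h0; rewrite addrK ltNge (ltW l1).
Qed.

(** Both first columns are shortest, so the first column of [u] is [(m, 0)] with a unit [m], and
    norm 1 makes the other diagonal entry a unit. The two Gram-Schmidt coefficients then agree up to
    units and a Hurwitz translation, which must vanish because both lie inside the cell. *)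
Lemma strictly_reduced_orbit x u :
  with_shape (@strictly_reduced_shape R) x -> Gamma u ->
  with_shape (@strictly_reduced_shape R) (mat_mul x u) ->
  exists m n, [/\ hurwitz_units m, hurwitz_units n & u = diag_mat m n].
Proof.
move=> sx Gu sy.
have Gv := hurwitz_gammaV Gu.
have [x1 Vx _] := (with_strictly_reduced_shapeE x).1 sx.
have [y1 Vy _] := (with_strictly_reduced_shapeE _).1 sy.
have x0 := mat_norm1_col1 x1.
(* The column [x.1] is the first column of [(x u) (mat_adj u)], hence a nonzero lattice vector
   written in the reduced basis [x u]. *)
have le : vec_sqn (mat_mul x u).1 <= vec_sqn x.1.
  have [_ [v1 v2 _ _]] := Gv.
  have v0 : (mat_adj u).1 != 0 by apply: mat_norm1_col1; exact: Gv.1.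
  have := reduced_shortest (with_shapeS (@strictly_reduced_sub R) sy) v1 v2.
  rewrite -surjective_pairing => /(_ v0).
  by rewrite -[X in _ <= vec_sqn X -> _]/((mat_mul (mat_mul x u) (mat_adj u)).1)
    -mat_mulA mat_mul_adjr ?mat_mulr1//; exact: Gu.1.
have u0 : u.1 != 0 by apply: mat_norm1_col1; exact: Gu.1.
case: u Gu sy Gv y1 Vy le u0 => -[m n] [p r] Gu sy Gv y1 Vy le u0.
have [N1 [/= hm hn hp hr]] := Gu.
have [n0 m1] := strictly_reduced_shortest sx hm hn u0 le.
have m0 := unit_neq0 m1.
have r1 : sqn r = 1.
  by move: N1; rewrite mat_norm_pivot//= n0 m1 mul1r !mul0r subr0.
move: Vy; rewrite n0 gram_coef_tri// quat_inv_unit// mulrDr mulrA => Vy.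
have hmp : hw (quat_conj m * p) by apply: hurwitzM => //; exact: hurwitz_conj.
have Vz : voronoi_interior (quat_conj m * gram_coef x * r).
  by apply: voronoi_interior_unit; rewrite ?sqn_conj//; exact: hurwitz_conj.
have mp0 := voronoi_interior_inj hmp Vz Vy.
have p0 : p = 0.
  by apply/eqP; rewrite -sqn_eq0 -[sqn p]mul1r -m1 -sqn_conj -sqnM mp0 sqn0.
by exists m, r; rewrite p0.
Qed.

Lemma mat_mul_diag_col1 x m n : (mat_mul x (diag_mat m n)).1 = vec_scale x.1 m.
Proof. by rewrite [LHS]mat_vecE vec_scale0 addr0. Qed.

Lemma col_length_diag x m n : sqn m = 1 ->
  col_length (mat_mul x (diag_mat m n)) = col_length x.
Proof. by move=> m1; rewrite /col_length mat_mul_diag_col1 vec_sqn_scale m1 mulr1. Qed.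

Lemma strictly_reduced_diag x m n :
  with_shape (@strictly_reduced_shape R) x -> hurwitz_units m -> hurwitz_units n ->
  with_shape (@strictly_reduced_shape R) (mat_mul x (diag_mat m n)).
Proof.
move=> /with_strictly_reduced_shapeE[x1 Vx cond] [hm m1] [hn n1].
have m0 := unit_neq0 m1.
apply/with_strictly_reduced_shapeE; split.
- by rewrite mat_normM x1 mat_norm_diag m1 n1 !mulr1.
- rewrite gram_coef_tri ?mat_norm1_col1// addr0 mulrA quat_inv_unit//.
  by apply: voronoi_interior_unit; rewrite ?sqn_conj//; exact: hurwitz_conj.
- rewrite mat_mul_diag_col1 vec_sqn_scale m1 mulr1.
  rewrite gram_coef_tri ?mat_norm1_col1// addr0 quat_inv_unit// 2!sqnM sqn_conj.
  by rewrite m1 n1 mulr1 mul1r.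
Qed.

End StrictlyReducedOrbit.

(** * Bases of a coset *)

Section CosetBases.
Context {R : realType}.
Local Notation sqn := (@quat_sqnorm R).
Local Notation hw := (@hurwitz R).
Local Notation vec := (quat R * quat R)%type.
Local Notation mat := (vec * vec)%type.
Local Notation Gamma := (@hurwitz_gamma R).
Implicit Types (x y u : mat) (g h : SL2H R) (q : coset_space R).

Definition sl_coords g : mat := mx_mat (SL2H_mx g).

Definition bases q : set mat :=
  [set x | exists2 g, mkcoset g = q & sl_coords g = x].

Lemma sl_coords_norm g : mat_norm (sl_coords g) = 1.
Proof.
have := set_mem (valP g); rewrite /SL2H_set /= det_complex_rep.
by move=> /(congr1 (@complex.Re _)).
Qed.

Lemma sl_coords_surj x : mat_norm x = 1 -> exists g, sl_coords g = x.
Proof.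
move=> x1.
have H : mat_mx x \in SL2H_set R.
  by apply/mem_set; rewrite /SL2H_set /= det_complex_rep mat_mxK x1.
by exists (exist _ (mat_mx x) H : SL2H R); rewrite /sl_coords /SL2H_mx /= mat_mxK.
Qed.

Lemma sl_coords_inj : injective sl_coords.
Proof.
by move=> g h /(congr1 (@mat_mx R)); rewrite !mx_matK => /val_inj.
Qed.

Lemma sl_coordsM g h : sl_coords (SL2H_mul g h) = mat_mul (sl_coords g) (sl_coords h).
Proof. by rewrite /sl_coords -mx_matM. Qed.

Lemma SL2HurwitzP g : SL2Hurwitz g <-> Gamma (sl_coords g).
Proof.
split=> [gH|[_ [h1 h2 h3 h4]] i j].
  by split; [exact: sl_coords_norm|split; exact: gH].
by case: i j => -[|[|//]] i [[|[|//]] j];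
  [move: h1|move: h3|move: h2|move: h4]; rewrite /sl_coords /mx_mat /=;
  congr (hw (_ _ _)); exact: val_inj.
Qed.

Lemma mkcosetP g h : mkcoset g = mkcoset h <->
  exists2 u, Gamma u & sl_coords h = mat_mul (sl_coords g) u.
Proof.
have eqP : mkcoset g = mkcoset h <-> lcoset_Hurwitz g = lcoset_Hurwitz h.
  split=> [/eqmodP/asboolP//|e]; by apply/eqmodP/asboolP.
apply: (iff_trans eqP); split=> [e|[u Gu hgu]].
  have : lcoset_Hurwitz h h.
    have [w w1] := sl_coords_surj (@mat_norm1 R).
    exists w; first by apply/SL2HurwitzP; rewrite w1; exact: hurwitz_gamma1.
    by apply: sl_coords_inj; rewrite sl_coordsM w1 mat_mulr1.
  rewrite -e => -[u Hu <-]; exists (sl_coords u); first exact/SL2HurwitzP.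
  by rewrite sl_coordsM.
have [w wu] := sl_coords_surj Gu.1; have [w' wu'] := sl_coords_surj (mat_norm_adj Gu.1).
apply/seteqP; split=> _ [k /SL2HurwitzP Hk <-].
  exists (SL2H_mul w' k).
    apply/SL2HurwitzP; rewrite sl_coordsM wu'; apply: hurwitz_gammaM => //.
    exact: hurwitz_gammaV.
  apply: sl_coords_inj; rewrite !sl_coordsM wu' hgu !mat_mulA.
  by rewrite -(mat_mulA _ u) mat_mul_adjr ?mat_mulr1//; exact: Gu.1.
exists (SL2H_mul w k).
  by apply/SL2HurwitzP; rewrite sl_coordsM wu; exact: hurwitz_gammaM.
by apply: sl_coords_inj; rewrite !sl_coordsM wu hgu !mat_mulA.
Qed.

Lemma mkcosetK q : mkcoset (coset_repr q) = q.
Proof. exact: reprK. Qed.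

Lemma bases_norm q x : bases q x -> mat_norm x = 1.
Proof. by move=> [g _ <-]; exact: sl_coords_norm. Qed.

Lemma bases_repr q : bases q (sl_coords (coset_repr q)).
Proof. by exists (coset_repr q) => //; exact: mkcosetK. Qed.

Lemma bases_mkcoset g : bases (mkcoset g) (sl_coords g).
Proof. by exists g. Qed.

Lemma basesP q x y : bases q x ->
  bases q y <-> exists2 u, Gamma u & y = mat_mul x u.
Proof.
move=> [g gq <-]; split=> [[h hq <-]|[u Gu ->]].
  by apply/mkcosetP; rewrite gq hq.
have [w wu] := sl_coords_surj Gu.1.
exists (SL2H_mul g w); last by rewrite sl_coordsM wu.
by rewrite -gq; apply/esym/mkcosetP; exists u; rewrite ?sl_coordsM ?wu.
Qed.

Lemma bases_translate g q :
  bases (coset_translate g q) = mat_mul (sl_coords g) @` bases q.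
Proof.
have b1 : bases (coset_translate g q) (mat_mul (sl_coords g) (sl_coords (coset_repr q))).
  rewrite -sl_coordsM; exact: bases_mkcoset.
apply/seteqP; split=> [y /(basesP _ b1)[u Gu ->]|_ [y yq <-]].
  exists (mat_mul (sl_coords (coset_repr q)) u); last by rewrite mat_mulA.
  by apply/(basesP _ (bases_repr q)); exists u.
have /(basesP _ (bases_repr q))[u Gu ->] := yq.
by apply/(basesP _ b1); exists u; rewrite ?mat_mulA.
Qed.

Lemma lattice_coordsP q (v : 'cV[quat R]_2) : coset_lattice q v <->
  exists m : vec, [/\ hw m.1, hw m.2 &
    (v 0 0, v 1 0) = mat_vec (sl_coords (coset_repr q)) m].
Proof.
have entry (A : 'M[quat R]_2) (m0 m1 : quat R) i :
    (col 0 A *m m0%:M + col 1 A *m m1%:M) i 0 = A i 0 * m0 + A i 1 * m1.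
  by rewrite !mxE !big_ord1 !mxE /= !mulr1n.
split=> [[m0 [m1 [h0 h1 ->]]]|[[m0 m1] /= [h0 h1 [e0 e1]]]].
  by exists (m0, m1); split; rewrite // !entry.
exists m0, m1; split=> //; apply/matrixP => i j; rewrite (ord1 j) entry.
case: i => -[|[|//]] i.
  rewrite (_ : Ordinal i = 0); [exact: e0|exact: val_inj].
rewrite (_ : Ordinal i = 1); [exact: e1|exact: val_inj].
Qed.

(** Frees [coset_lattice] from the chosen representative, so that a reduced basis can be used in its
    place. *)
Lemma lattice_basisP q x (v : 'cV[quat R]_2) : bases q x ->
  coset_lattice q v <->
  exists m : vec, [/\ hw m.1, hw m.2 & (v 0 0, v 1 0) = mat_vec x m].
Proof.
have hmv (u : mat) (m : vec) : Gamma u -> hw m.1 -> hw m.2 ->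
    hw (mat_vec u m).1 /\ hw (mat_vec u m).2.
  by move=> [_ [? ? ? ?]] ? ?; split; apply: hurwitzD; exact: hurwitzM.
move=> /(basesP _ (bases_repr q))[u Gu xu].
apply: (iff_trans (lattice_coordsP q v)); split=> [[m [h1 h2 ->]]|[m [h1 h2 ->]]].
  exists (mat_vec (mat_adj u) m).
  have [? ?] := hmv _ _ (hurwitz_gammaV Gu) h1 h2; split=> //.
  by rewrite xu -mat_vec_mul -mat_mulA mat_mul_adjr ?mat_mulr1//; exact: Gu.1.
exists (mat_vec u m); have [? ?] := hmv _ _ Gu h1 h2; split=> //.
by rewrite xu mat_vec_mul.
Qed.

Lemma quat_lengthE (v : 'cV[quat R]_2) :
  quat_length v = Num.sqrt (vec_sqn (v 0 0, v 1 0)).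
Proof. by []. Qed.

(** The first column is a shortest vector and all shortest vectors have its length, so [xget] has
    exactly one value to choose and never falls back on 0. *)
Lemma shortest_length_reduced q x : bases q x -> with_shape (@reduced_shape R) x ->
  shortest_length (coset_lattice q) = col_length x.
Proof.
move=> bx sx.
have x0 := mat_norm1_col1 (bases_norm bx).
have lower (w : 'cV[quat R]_2) : coset_lattice q w -> w != 0 ->
    col_length x <= quat_length w.
  move=> /(lattice_basisP _ bx)[[m0 m1] [h0 h1 e]] w0.
  rewrite quat_lengthE e ler_wsqrtr//; apply: reduced_shortest => //.
  apply: contra w0 => /eqP m00; move: e.
  rewrite m00 mat_vecE !vec_scale0 addr0 => -[e0 e1].
  apply/eqP/matrixP => i j; rewrite (ord1 j) mxE.
  case: i => -[|[|//]] i.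
    rewrite (_ : Ordinal i = 0); [exact: e0|exact: val_inj].
  rewrite (_ : Ordinal i = 1); [exact: e1|exact: val_inj].
pose v : 'cV[quat R]_2 := \col_i (if i == 0 then x.1.1 else x.1.2).
have v12 : (v 0 0, v 1 0) = x.1 by rewrite !mxE /= -surjective_pairing.
have vlen : quat_length v = col_length x by rewrite quat_lengthE v12.
have vL : coset_lattice q v.
  apply/(lattice_basisP _ bx); exists (1, 0).
  rewrite v12 mat_vecE vec_scale0 addr0 vec_scale1; split=> //.
    exact: hurwitz1.
  exact: hurwitz0.
have v0 : v != 0.
  by apply: contra x0 => /eqP v0; rewrite -v12 v0 !mxE.
have vs : shortest_vectors (coset_lattice q) v.
  by split=> // w wL w0; rewrite vlen; exact: lower.
apply: xget_unique; first by exists v.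
move=> _ [w [wL w0 wmin] <-]; apply/eqP; rewrite eq_le lower// andbT.
by rewrite -vlen; exact: wmin.
Qed.

Lemma exists_reduced_basis q : exists2 x, bases q x & with_shape (@reduced_shape R) x.
Proof.
have b := bases_repr q.
have [u Gu rx] := reduction (bases_norm b).
by eexists; [apply/(basesP _ b); exists u|exact: rx].
Qed.

End CosetBases.

(** * Topology of the coset space *)

Section ContinuityOfQuaternionOperations.
Context {R : realType} (T : topologicalType).
Implicit Types (f g : T -> quat R) (k : T -> R).

Lemma continuous_pair (U W : topologicalType) (f : T -> U) (g : T -> W) :
  continuous f -> continuous g -> continuous (fun x => (f x, g x)).
Proof. by move=> cf cg x; apply: cvg_pair; [exact: cf|exact: cg]. Qed.

Lemma continuous_fst_comp (U W : topologicalType) (f : T -> U * W) :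
  continuous f -> continuous (fun x => (f x).1).
Proof. by move=> cf x; apply: (@continuous_comp _ _ _ f fst x (cf x)); exact: cvg_fst. Qed.

Lemma continuous_snd_comp (U W : topologicalType) (f : T -> U * W) :
  continuous f -> continuous (fun x => (f x).2).
Proof. by move=> cf x; apply: (@continuous_comp _ _ _ f snd x (cf x)); exact: cvg_snd. Qed.

Lemma continuous_quat_tuple (k0 k1 k2 k3 : T -> R) :
  continuous k0 -> continuous k1 -> continuous k2 -> continuous k3 ->
  continuous (fun x => (k0 x, k1 x, k2 x, k3 x) : quat R).
Proof. by move=> c0 c1 c2 c3; do 3!(apply: continuous_pair => //). Qed.

Lemma continuous_quat_coords f : continuous f ->
  [/\ continuous (fun x => (f x).1.1.1 : R), continuous (fun x => (f x).1.1.2 : R),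
      continuous (fun x => (f x).1.2 : R) & continuous (fun x => (f x).2 : R)].
Proof.
move=> cf.
have c1 : continuous (fun x => (f x).1 : R * R * R) := continuous_fst_comp cf.
have c2 : continuous (fun x => (f x).1.1 : R * R) := continuous_fst_comp c1.
split; [exact: continuous_fst_comp c2|exact: continuous_snd_comp c2|
  exact: continuous_snd_comp c1|exact: continuous_snd_comp cf].
Qed.

Lemma continuous_quat_add f g : continuous f -> continuous g ->
  continuous (fun x => f x + g x).
Proof.
move=> /continuous_quat_coords[f0 f1 f2 f3] /continuous_quat_coords[g0 g1 g2 g3].
rewrite (_ : (fun x => _) = fun x =>
  ((f x).1.1.1 + (g x).1.1.1, (f x).1.1.2 + (g x).1.1.2,
   (f x).1.2 + (g x).1.2, (f x).2 + (g x).2)); last first.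
  by apply/funext => x; case: (f x) (g x) => [[[? ?] ?] ?] [[[? ?] ?] ?].
by apply: continuous_quat_tuple => x; apply: cvgD;
  [exact: f0|exact: g0|exact: f1|exact: g1|exact: f2|exact: g2|exact: f3|exact: g3].
Qed.

Lemma continuous_quat_mul f g : continuous f -> continuous g ->
  continuous (fun x => f x * g x).
Proof.
move=> /continuous_quat_coords[f0 f1 f2 f3] /continuous_quat_coords[g0 g1 g2 g3].
rewrite (_ : (fun x => _) = fun x =>
  ((f x).1.1.1 * (g x).1.1.1 - (f x).1.1.2 * (g x).1.1.2
     - (f x).1.2 * (g x).1.2 - (f x).2 * (g x).2,
   (f x).1.1.1 * (g x).1.1.2 + (f x).1.1.2 * (g x).1.1.1
     + (f x).1.2 * (g x).2 - (f x).2 * (g x).1.2,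
   (f x).1.1.1 * (g x).1.2 - (f x).1.1.2 * (g x).2
     + (f x).1.2 * (g x).1.1.1 + (f x).2 * (g x).1.1.2,
   (f x).1.1.1 * (g x).2 + (f x).1.1.2 * (g x).1.2
     - (f x).1.2 * (g x).1.1.2 + (f x).2 * (g x).1.1.1)); last first.
  by apply/funext => x; case: (f x) (g x) => [[[? ?] ?] ?] [[[? ?] ?] ?].
have M (a b : T -> R) : continuous a -> continuous b -> continuous (fun x => a x * b x).
  by move=> ca cb x; apply: cvgM; [exact: ca|exact: cb].
have A (a b : T -> R) : continuous a -> continuous b -> continuous (fun x => a x + b x).
  by move=> ca cb x; apply: cvgD; [exact: ca|exact: cb].
have S (a b : T -> R) : continuous a -> continuous b -> continuous (fun x => a x - b x).
  by move=> ca cb x; apply: cvgB; [exact: ca|exact: cb].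
have t0 := S _ _ (S _ _ (S _ _ (M _ _ f0 g0) (M _ _ f1 g1)) (M _ _ f2 g2)) (M _ _ f3 g3).
have t1 := S _ _ (A _ _ (A _ _ (M _ _ f0 g1) (M _ _ f1 g0)) (M _ _ f2 g3)) (M _ _ f3 g2).
have t2 := A _ _ (A _ _ (S _ _ (M _ _ f0 g2) (M _ _ f1 g3)) (M _ _ f2 g0)) (M _ _ f3 g1).
have t3 := A _ _ (S _ _ (A _ _ (M _ _ f0 g3) (M _ _ f1 g2)) (M _ _ f2 g1)) (M _ _ f3 g0).
exact: continuous_quat_tuple t0 t1 t2 t3.
Qed.

End ContinuityOfQuaternionOperations.

Section CosetTopology.
Context {R : realType}.
Local Notation vec := (quat R * quat R)%type.
Local Notation mat := (vec * vec)%type.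
Local Notation Gamma := (@hurwitz_gamma R).
Implicit Types (x y u : mat) (g h : SL2H R) (q : coset_space R) (O : set mat).

Lemma continuous_mat_entries : [/\ continuous (fun x : mat => x.1.1),
  continuous (fun x : mat => x.1.2), continuous (fun x : mat => x.2.1) &
  continuous (fun x : mat => x.2.2)].
Proof.
have c1 : continuous (fun x : mat => x.1).
  by apply: continuous_fst_comp => x; exact: cvg_id.
have c2 : continuous (fun x : mat => x.2).
  by apply: continuous_snd_comp => x; exact: cvg_id.
split; [exact: continuous_fst_comp c1|exact: continuous_snd_comp c1|
  exact: continuous_fst_comp c2|exact: continuous_snd_comp c2].
Qed.

Lemma continuous_mat_mul (f g : mat -> mat) : continuous f -> continuous g ->
  continuous (fun x => mat_mul (f x) (g x)).
Proof.
move=> cf cg.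
have f1 := continuous_fst_comp cf; have f2 := continuous_snd_comp cf.
have g1 := continuous_fst_comp cg; have g2 := continuous_snd_comp cg.
have f11 := continuous_fst_comp f1; have f12 := continuous_snd_comp f1.
have f21 := continuous_fst_comp f2; have f22 := continuous_snd_comp f2.
have g11 := continuous_fst_comp g1; have g12 := continuous_snd_comp g1.
have g21 := continuous_fst_comp g2; have g22 := continuous_snd_comp g2.
by apply: continuous_pair; apply: continuous_pair; apply: continuous_quat_add;
  exact: continuous_quat_mul.
Qed.

Lemma continuous_mat_mull g : continuous (mat_mul (sl_coords g)).
Proof.
by apply: continuous_mat_mul => x; [exact: cvg_cst|exact: cvg_id].
Qed.

Lemma continuous_mat_mulr u : continuous (fun x => mat_mul x u).
Proof.
by apply: continuous_mat_mul => x; [exact: cvg_id|exact: cvg_cst].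
Qed.

Lemma continuous_mat_mx : continuous (@mat_mx R).
Proof.
have [c11 c12 c21 c22] := continuous_mat_entries.
move=> x A [P nP PA]; rewrite nbhs_simpl/=.
have : nbhs x (fun y => forall i j, P i j (mat_mx y i j)).
  apply: (@filter_forall _ _ (fun i y => forall j, P i j (mat_mx y i j)) _ (nbhs_filter x)) => i.
  apply: (@filter_forall _ _ (fun j y => P i j (mat_mx y i j)) _ (nbhs_filter x)) => j.
  have cij : continuous (fun y : mat => mat_mx y i j).
    rewrite (_ : (fun y => _) = fun y : mat =>
      if j == 0 then (if i == 0 then y.1.1 else y.1.2)
      else (if i == 0 then y.2.1 else y.2.2)); last by apply/funext => y; rewrite mxE.
    by case: (j == 0); case: (i == 0).
  exact: (cij x _ (nP i j)).
by apply: filterS => y Py; exact: PA.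
Qed.

Lemma open_SL2HP (U : set (SL2H R)) : open U ->
  exists2 O, open O & U = sl_coords @^-1` O.
Proof.
move=> [W oW <-]; exists (@mat_mx R @^-1` W).
  by move/continuousP: continuous_mat_mx; apply.
by apply/seteqP; split=> g /=; rewrite /sl_coords mx_matK.
Qed.

Lemma continuous_mx_mat : continuous (@mx_mat R).
Proof.
have c i j : continuous (fun A : 'M[quat R]_2 => A i j).
  move=> A B nB; rewrite nbhs_simpl/=.
  exists (fun i' j' => if (i' == i) && (j' == j) then B else setT).
    by move=> i' j'; case: ifP => [/andP[/eqP-> /eqP->]//|_]; exact: filterT.
  by move=> C /(_ i j); rewrite !eqxx.
by apply: continuous_pair; apply: continuous_pair; exact: c.
Qed.

Lemma open_sl_coords O : open O -> open (sl_coords @^-1` O : set (SL2H R)).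
Proof.
move=> oO; exists (@mx_mat R @^-1` O) => //.
by move/continuousP: continuous_mx_mat; apply.
Qed.

(** The preimage in the group is a union over [u] in [Gamma] of the open sets where [g u] lies in
    [O]. All Borel measurability on the quotient, except that of translations, is derived from
    this. *)
Lemma open_bases_meet O : open O -> open [set q | bases q `&` O !=set0].
Proof.
move=> oO; rewrite /open /= /quotient_open.
rewrite (_ : _ @^-1` _ =
    \bigcup_(u in Gamma) (sl_coords @^-1` ((fun x => mat_mul x u) @^-1` O))).
  apply: bigcup_open => u _; apply: open_sl_coords.
  by have /continuousP := @continuous_mat_mulr u; apply.
apply/seteqP; split=> g /=.
  by move=> [x [/(basesP _ (bases_mkcoset g))[u Gu ->] Ox]]; exists u.
move=> [u Gu Ox]; exists (mat_mul (sl_coords g) u); split=> //.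
by apply/(basesP _ (bases_mkcoset g)); exists u.
Qed.

Lemma open_measurable_coset (U : set (coset_space R)) : open U ->
  measurable (U : set (coset_borel R)).
Proof. by move=> oU; exact: sub_sigma_algebra. Qed.

Lemma measurable_coset_translate g :
  measurable_fun setT (coset_translate g : coset_borel R -> coset_borel R).
Proof.
apply: (@measurability _ _ (coset_borel R) (coset_borel R) setT _
  (@open (coset_space R)) erefl) => _ [U oU <-].
rewrite setTI; apply: open_measurable_coset.
have [B oB UB] := open_SL2HP oU.
rewrite /open /= /quotient_open -comp_preimage.
rewrite (_ : _ @^-1` U = sl_coords @^-1` (mat_mul (sl_coords g) @^-1` B)).
  apply: open_sl_coords.
  by have /continuousP := @continuous_mat_mull g; apply.
have memB h : U (mkcoset h) <-> B (sl_coords h).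
  by rewrite -[X in _ <-> X]/((sl_coords @^-1` B) h) -UB.
apply/seteqP; split=> h /=.
  rewrite (_ : coset_translate g _ = mkcoset (SL2H_mul g h)).
    by move=> /memB; rewrite sl_coordsM.
  exact: coset_translateE.
rewrite -sl_coordsM => /memB.
by rewrite (_ : coset_translate g _ = mkcoset (SL2H_mul g h))//; exact: coset_translateE.
Qed.

End CosetTopology.

(** * Counting the bases of a coset that lie in a set *)

Section CountingFacts.
Context {R : realType} (T : choiceType).
Implicit Types A : set T.
Local Notation counting := (@counting T R).

Lemma counting_finite A : finite_set A -> counting A = (#|` fset_set A|)%:R%:E.
Proof. by move=> fA; rewrite /counting asboolT. Qed.

Lemma counting_infinite A : infinite_set A -> counting A = +oo%E.
Proof. by move=> iA; rewrite /counting asboolF. Qed.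

(** Finite duplicate-free lists as witnesses turn a lower bound on a count into finitely many
    membership conditions. *)
Lemma counting_gtP A (r : R) : (r%:E < counting A)%E <->
  exists s : seq T, [/\ uniq s, (forall x, x \in s -> A x) & r < (size s)%:R].
Proof.
split=> [|[s [us sA rs]]].
  have [fA|iA] := pselect (finite_set A).
    rewrite counting_finite// lte_fin => rA.
    exists (fset_set A); split=> // x; rewrite in_fset_set//.
    by move=> /set_mem.
  move=> _; have [B BA Bn] := infinite_set_fset (Num.trunc r).+1 iA.
  exists B; split=> //.
  by apply: lt_le_trans (truncnS_gt r) _; rewrite ler_nat.
have [fA|iA] := pselect (finite_set A); last first.
  by rewrite /counting asboolF// ltry.
rewrite counting_finite// lte_fin (lt_le_trans rs)// ler_nat.
by apply: uniq_leq_size => // x xs; rewrite in_fset_set//; exact/mem_set/sA.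
Qed.

Lemma counting_le A n :
  (forall s : seq T, uniq s -> (forall x, x \in s -> A x) -> (size s <= n)%N) ->
  (counting A <= n%:R%:E)%E.
Proof.
move=> H; rewrite leNgt; apply/negP => /counting_gtP[s [us sA]].
by rewrite ltr_nat ltnNge H.
Qed.

Lemma counting_gt0 A : A !=set0 -> (1 <= counting A)%E.
Proof.
move=> [x Ax]; have [fA|iA] := pselect (finite_set A); last first.
  by rewrite /counting asboolF// leey.
rewrite counting_finite// lee_fin ler1n cardfs_gt0; apply/fset0Pn; exists x.
by rewrite in_fset_set//; exact/mem_set.
Qed.

End CountingFacts.

Section BaseMeasure.
Context {R : realType}.
Local Notation vec := (quat R * quat R)%type.
Local Notation mat := (vec * vec)%type.
Local Notation Gamma := (@hurwitz_gamma R).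
Local Notation counting := (@counting mat R).
Implicit Types (x y u : mat) (q : coset_space R) (E O : set mat).

Lemma counting_mat_image (f : mat -> mat) E : injective f ->
  counting (f @` E) = counting E.
Proof.
move=> fi.
have le A (g : mat -> mat) B : injective g -> g @` A `<=` B ->
    (counting A <= counting B)%E.
  move=> gi gAB; have [fB|iB] := pselect (finite_set B); last first.
    by rewrite (counting_infinite iB) leey.
  rewrite (counting_finite fB); apply: counting_le => s us sA.
  rewrite -(size_map g) uniq_leq_size ?map_inj_uniq// => _ /mapP[x xs ->].
  by rewrite in_fset_set//; apply/mem_set/gAB; exists x => //; exact: sA.
apply/eqP; rewrite eq_le (le E f)// andbT.
(* A left inverse of the injective [f], obtained by choice. *)
have [g gK] : exists g : mat -> mat, forall x, f (g (f x)) = f x.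
  exists (fun y => xget point [set x | f x = y]) => x.
  by apply: (@xgetPex _ point [set x' | f x' = f x]); exists x.
have [fE|iE] := pselect (finite_set E); last first.
  by rewrite (counting_infinite iE) leey.
rewrite (counting_finite fE); apply: counting_le => s us sA.
rewrite -(size_map g) uniq_leq_size//.
  rewrite map_inj_in_uniq// => _ _ /sA[a Ea <-] /sA[b Eb <-] /(congr1 f).
  by rewrite !gK.
move=> _ /mapP[_ /sA[a Ea <-] ->].
have /fi -> : f (g (f a)) = f a by rewrite gK.
by rewrite in_fset_set//; exact/mem_set.
Qed.

Definition coset_count q E : \bar R := counting (E `&` bases q).

Lemma mat_mul_injl x : mat_norm x = 1 -> injective (mat_mul x).
Proof.
move=> x1 y z /(congr1 (mat_mul (mat_adj x))).
by rewrite !mat_mulA mat_adj_mul// !mat_mul1.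
Qed.

Lemma bases_seqP q x (s : seq mat) : bases q x ->
  (forall y, y \in s -> bases q y) ->
  exists us : seq mat, [/\ s = map (mat_mul x) us & forall u, u \in us -> Gamma u].
Proof.
move=> bx sb; exists (map (mat_mul (mat_adj x)) s).
have x1 := bases_norm bx.
have K y : mat_mul x (mat_mul (mat_adj x) y) = y.
  by rewrite mat_mulA mat_mul_adjr// mat_mul1.
split; first by rewrite -map_comp map_id_in// => y _; exact: K.
move=> _ /mapP[y /sb /(basesP _ bx)[u Gu ->] ->].
by rewrite mat_mulA mat_adj_mul// mat_mul1.
Qed.

(** Lower semicontinuity of the count: the witnesses are [x u] for a list of distinct [u] in [Gamma]
    and a single basis [x], and for each list the condition on [x] is a finite intersection of open
    ones. *)
Lemma open_coset_count_gt O (r : R) : open O ->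
  open [set q | (r%:E < coset_count q O)%E].
Proof.
move=> oO.
pose S := [set us : seq mat | [/\ uniq us, forall u, u \in us -> Gamma u &
  r < (size us)%:R]].
rewrite (_ : [set q | _] = \bigcup_(us in S)
   [set q | bases q `&` [set x | forall u, u \in us -> O (mat_mul x u)] !=set0]).
  apply: bigcup_open => us _; apply: open_bases_meet.
  elim: us => [|u us IH].
    by rewrite (_ : [set _ | _] = setT); [exact: openT|apply/seteqP; split].
  rewrite (_ : [set _ | _] = (fun x => mat_mul x u) @^-1` O `&`
      [set x | forall v, v \in us -> O (mat_mul x v)]).
    apply: openI => //; have /continuousP := @continuous_mat_mulr _ u; exact.
  apply/seteqP; split=> x /=.
    move=> H; split; first by apply: H; rewrite inE eqxx.
    by move=> v vus; apply: H; rewrite inE vus orbT.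
  by move=> [Hu Hus] v; rewrite inE => /orP[/eqP->//|]; exact: Hus.
apply/seteqP; split=> q /=.
  move=> /counting_gtP[s [us sO rs]].
  have br := bases_repr q; set x := sl_coords _ in br.
  have [|vs [sE vsG]] := bases_seqP br (s := s); first by move=> y /sO[].
  exists vs; last first.
    exists x; split=> // v vvs.
    by have [] := sO (mat_mul x v); rewrite // sE map_f.
  split=> //; last by rewrite -(size_map (mat_mul x)) -sE.
  by move: us; rewrite sE map_inj_uniq//; apply: mat_mul_injl; exact: bases_norm br.
move=> [vs [uvs vsG rvs] [x [bx Hx]]].
apply/counting_gtP; exists (map (mat_mul x) vs); split; last by rewrite size_map.
  by rewrite map_inj_uniq//; apply: mat_mul_injl; exact: bases_norm bx.
move=> _ /mapP[v vvs ->]; split; first exact: Hx.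
by apply/(basesP _ bx); exists v => //; exact: vsG.
Qed.

Lemma measurable_coset_count_open O : open O ->
  measurable_fun setT (fun q : coset_borel R => coset_count q O).
Proof.
move=> oO; apply: (measurability _ (ErealGenOInfty.measurableE R)) => _ [_ [r ->] <-].
rewrite setTI; apply: open_measurable_coset.
rewrite (_ : _ @^-1` _ = [set q | (r%:E < coset_count q O)%E]).
  exact: open_coset_count_gt.
by apply/seteqP; split=> q /=; rewrite in_itv/= andbT.
Qed.

Lemma mat_sqn_ge0 x : 0 <= mat_sqn x.
Proof. by rewrite addr_ge0// vec_sqn_ge0. Qed.

Lemma finite_gamma (C : R) : finite_set [set u | Gamma u /\ mat_sqn u <= C].
Proof.
pose B := [set v : vec | [/\ hurwitz v.1, hurwitz v.2 & vec_sqn v <= C]].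
apply: (sub_finite_set (B := B `*` B)); last first.
  by apply: finite_setX; exact: finite_hurwitz_vec.
move=> u [[_ [h1 h2 h3 h4]] uC]; split; split=> //; apply: le_trans uC.
  by rewrite lerDl vec_sqn_ge0.
by rewrite lerDr vec_sqn_ge0.
Qed.

Definition mat_ball (C : R) : set mat := [set x | mat_sqn x < C].

(** The adjugate has eight cubic monomials, each of squared norm at most [C^3]; pairing them in
    differences costs a factor 2. *)
Lemma mat_sqn_adj x (C : R) : mat_sqn x <= C -> mat_sqn (mat_adj x) <= 16 * C ^+ 3.
Proof.
case: x => -[a c] [b d]; rewrite /mat_sqn /vec_sqn /= => le.
have H (p q : quat R) : quat_sqnorm (p - q) <= 2 * (quat_sqnorm p + quat_sqnorm q).
  by have := sqnD_le p (- q); rewrite sqnN.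
apply: le_trans (lerD (lerD (H _ _) (H _ _)) (lerD (H _ _) (H _ _))) _.
rewrite !sqnM !sqn_conj.
have a0 := sqn_ge0 a; have b0 := sqn_ge0 b; have c0 := sqn_ge0 c; have d0 := sqn_ge0 d.
set A := quat_sqnorm a in a0 le *; set B := quat_sqnorm b in b0 le *.
set C' := quat_sqnorm c in c0 le *; set D := quat_sqnorm d in d0 le *.
have M (p q r : R) : 0 <= p <= C -> 0 <= q <= C -> 0 <= r <= C -> p * (q * r) <= C ^+ 3.
  move=> /andP[p0 pC] /andP[q0 qC] /andP[r0 rC].
  rewrite exprS expr2; apply: ler_pM => //; first exact: mulr_ge0.
  exact: ler_pM.
have aC : 0 <= A <= C by rewrite a0/=; lra.
have bC : 0 <= B <= C by rewrite b0/=; lra.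
have cC : 0 <= C' <= C by rewrite c0/=; lra.
have dC : 0 <= D <= C by rewrite d0/=; lra.
have := M _ _ _ aC dC dC; have := M _ _ _ cC dC bC; have := M _ _ _ bC cC cC.
have := M _ _ _ dC cC aC; have := M _ _ _ cC bC bC; have := M _ _ _ aC bC dC.
have := M _ _ _ dC aC aC; have := M _ _ _ bC aC cC.
rewrite -!mulrA; lra.
Qed.

(** Two bases [x] and [y] of one coset in the ball satisfy [y = x u] with [u = mat_adj x * y]
    bounded in terms of [C] alone. The bound is uniform in the coset, which makes the averaged count
    of a ball finite. *)
Lemma coset_count_ball (C : R) : exists n : nat, forall q,
  (coset_count q (mat_ball C) <= n%:R%:E)%E.
Proof.
pose F := [set u | Gamma u /\ mat_sqn u <= 2 * (16 * C ^+ 3) * C].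
have finF : finite_set F by exact: finite_gamma.
exists #|` fset_set F| => q; apply: counting_le => s us sB.
case: s us sB => [|x s] us sB //.
have [xC bx] : mat_ball C x /\ bases q x by apply: sB; rewrite inE eqxx.
have x1 := bases_norm bx.
have a1 := mat_norm_adj x1.
rewrite -(size_map (mat_mul (mat_adj x))) uniq_leq_size//.
  by rewrite map_inj_uniq//; exact: mat_mul_injl.
move=> _ /mapP[y /sB[yC by_] ->]; rewrite in_fset_set//; apply/mem_set.
have /(basesP _ bx)[u Gu yu] := by_.
have -> : mat_mul (mat_adj x) y = u by rewrite yu mat_mulA mat_adj_mul// mat_mul1.
split=> //.
have -> : u = mat_mul (mat_adj x) y by rewrite yu mat_mulA mat_adj_mul// mat_mul1.
have C0 : 0 <= C by apply: le_trans (ltW xC); exact: mat_sqn_ge0.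
apply: le_trans (mat_sqn_mul _ _) _; apply: ler_pM.
- by rewrite mulr_ge0// mat_sqn_ge0.
- exact: mat_sqn_ge0.
- by rewrite ler_pM2l//; apply: mat_sqn_adj; exact: ltW.
- exact: ltW.
Qed.

End BaseMeasure.

Section BorelMatrices.
Context {R : realType}.
Local Notation vec := (quat R * quat R)%type.
Local Notation mat := (vec * vec)%type.
Local Notation borel_mat := (g_sigma_algebraType (@open mat)).

Lemma continuous_measurable_borel (f : mat -> R) : continuous f ->
  measurable_fun setT (f : borel_mat -> R).
Proof.
move=> /continuousP cf; apply: (measurability _ (RGenOpens.measurableE R)) => _ [_ [a [b ->]] <-].
by rewrite setTI; apply: sub_sigma_algebra; apply/cf/interval_open.
Qed.

(** Measurable sets of matrices come from the product sigma-algebra, whereas the measurability of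
    counts starts from open sets; this is the bridge. *)
Lemma measurable_mat_borel (E : set mat) : measurable E -> <<s (@open mat) >> E.
Proof.
move=> mE.
have mq (f : mat -> quat R) : continuous f -> measurable_fun setT (f : borel_mat -> quat R).
  move=> /continuous_quat_coords[c0 c1 c2 c3].
  have := measurable_quat_tuple (continuous_measurable_borel c0)
    (continuous_measurable_borel c1) (continuous_measurable_borel c2)
    (continuous_measurable_borel c3).
  by congr measurable_fun; apply/funext => x; case: (f x) => [[[? ?] ?] ?].
have [c11 c12 c21 c22] := @continuous_mat_entries R.
have := measurable_fun_pair (measurable_fun_pair (mq _ c11) (mq _ c12))
  (measurable_fun_pair (mq _ c21) (mq _ c22)).
move=> /(_ measurableT E mE); rewrite setTI.
by congr (<<s _ >> _); apply/seteqP; split=> -[[? ?] [? ?]].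
Qed.

Lemma continuous_sqn (f : mat -> quat R) : continuous f ->
  continuous (fun x => quat_sqnorm (f x)).
Proof.
move=> /continuous_quat_coords[c0 c1 c2 c3].
have A (a b : mat -> R) : continuous a -> continuous b -> continuous (fun x => a x + b x).
  by move=> ca cb x; apply: cvgD; [exact: ca|exact: cb].
have X2 (a : mat -> R) : continuous a -> continuous (fun x => a x ^+ 2).
  by move=> ca x; apply: cvgM; exact: ca.
rewrite (_ : (fun x => _) = fun x => (f x).1.1.1 ^+ 2 + (f x).1.1.2 ^+ 2 +
    (f x).1.2 ^+ 2 + (f x).2 ^+ 2).
  exact: A _ _ (A _ _ (A _ _ (X2 _ c0) (X2 _ c1)) (X2 _ c2)) (X2 _ c3).
by apply/funext => x; case: (f x) => [[[? ?] ?] ?].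
Qed.

Lemma continuous_mat_sqn : continuous (@mat_sqn R).
Proof.
have [c11 c12 c21 c22] := @continuous_mat_entries R.
have A (a b : mat -> R) : continuous a -> continuous b -> continuous (fun x => a x + b x).
  by move=> ca cb x; apply: cvgD; [exact: ca|exact: cb].
exact: A _ _ (A _ _ (continuous_sqn c11) (continuous_sqn c12))
  (A _ _ (continuous_sqn c21) (continuous_sqn c22)).
Qed.

Lemma open_mat_ball (C : R) : open (mat_ball C).
Proof.
rewrite (_ : mat_ball C = @mat_sqn R @^-1` `]-oo, C[%classic).
  by move/continuousP: continuous_mat_sqn; apply; exact: interval_open.
by apply/seteqP; split=> x; rewrite /mat_ball /= in_itv.
Qed.

End BorelMatrices.

Section CosetCountMeasurable.
Context {R : realType}.
Local Notation vec := (quat R * quat R)%type.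
Local Notation mat := (vec * vec)%type.
Local Notation discrete_mat := (g_sigma_algebraType [set: set mat]).
Implicit Types (q : coset_space R) (E F : set mat).

(** For counting measure every set is measurable, so no condition falls on the set of bases of a
    coset. *)
Lemma measurable_discrete (E : set discrete_mat) : measurable E.
Proof. exact: sub_sigma_algebra. Qed.

(** A Dynkin class argument starting from open sets. Cutting by a ball keeps the counts finite, as
    the step for differences requires. *)
Lemma measurable_coset_count_ball (C : R) E : <<s (@open mat) >> E ->
  measurable_fun setT (fun q : coset_borel R => coset_count q (E `&` mat_ball C)).
Proof.
pose cm : {measure set discrete_mat -> \bar R} := @counting discrete_mat R.
have cmE q F : coset_count q F = cm (F `&` bases q) by [].
pose H := [set F : set mat |
  measurable_fun setT (fun q : coset_borel R => coset_count q (F `&` mat_ball C))].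
move: E; change (<<s (@open mat) >> `<=` H).
have oI : setI_closed (@open mat) by move=> A B; exact: openI.
apply: (@lambda_system_subset _ _ oI setT) => //; last first.
  by move=> O oO; apply: measurable_coset_count_open; apply: openI => //; exact: open_mat_ball.
split=> //.
- by apply: measurable_coset_count_open; rewrite setTI; exact: open_mat_ball.
- move=> A B BA mA mB; rewrite /H /=.
  rewrite (_ : (fun q => _) = (fun q : coset_borel R =>
      coset_count q (A `&` mat_ball C) - coset_count q (B `&` mat_ball C))%E).
    exact: emeasurable_funB.
  apply/funext => q; rewrite !cmE.
  have -> : (A `\` B) `&` mat_ball C `&` bases q =
      (A `&` mat_ball C `&` bases q) `\` (B `&` mat_ball C `&` bases q).
    apply/seteqP; split=> x /=.
      by move=> [[[Ax Bx] Cx] qx]; split=> // -[[]].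
    by move=> [[[Ax Cx] qx] nB]; split=> //; split=> //; split=> // Bx; apply: nB.
  rewrite measureD; [|exact: measurable_discrete|exact: measurable_discrete|].
    congr (_ - cm _)%E; apply/setIidPr => x [[Bx Cx] qx]; split=> //; split=> //.
    exact: BA.
  have [n /(_ q)] := @coset_count_ball R C; rewrite cmE => nq.
  apply: (@le_lt_trans _ _ n%:R%:E); last exact: ltry.
  apply: le_trans nq; apply: le_measure; rewrite ?inE; [exact: measurable_discrete..|].
  by move=> x [[Ax Cx] qx].
- move=> F ndF mF; rewrite /H /=.
  apply: (emeasurable_fun_cvg (fun n (q : coset_borel R) => coset_count q (F n `&` mat_ball C))) => //.
  move=> q _; rewrite cmE !setI_bigcupl.
  have := @nondecreasing_cvg_mu _ _ _ cm (fun n => F n `&` mat_ball C `&` bases q).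
  apply => [n||m n mn]; [exact: measurable_discrete|exact: measurable_discrete|].
  by apply/subsetPset; do 2!apply: setSI; exact/subsetPset/ndF.
Qed.

Lemma measurable_coset_count E : measurable E ->
  measurable_fun setT (fun q : coset_borel R => coset_count q E).
Proof.
move=> /measurable_mat_borel bE.
pose cm : {measure set discrete_mat -> \bar R} := @counting discrete_mat R.
apply: (emeasurable_fun_cvg
    (fun n (q : coset_borel R) => coset_count q (E `&` mat_ball n%:R))) => [n|q _].
  exact: measurable_coset_count_ball.
have EU : E `&` bases q = \bigcup_n (E `&` mat_ball n%:R `&` bases q).
  apply/seteqP; split=> [x [Ex qx]|x [n _ [[Ex _] qx]]//].
  exists (Num.trunc (mat_sqn x)).+1 => //; split=> //; split=> //.
  exact: truncnS_gt.
rewrite [X in _ --> X](_ : _ = cm (\bigcup_n (E `&` mat_ball n%:R `&` bases q))).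
  have := @nondecreasing_cvg_mu _ _ _ cm (fun n => E `&` mat_ball n%:R `&` bases q).
  apply => [n||m n mn]; [exact: measurable_discrete|exact: measurable_discrete|].
  apply/subsetPset; apply: setSI; apply: setIS => x; rewrite /mat_ball /= => /lt_le_trans; apply.
  by rewrite ler_nat.
by rewrite -EU.
Qed.

Variable P : {measure set (coset_borel R) -> \bar R}.

Definition base_measure E : \bar R := (\int[P]_q coset_count q E)%E.

Local Lemma base_measure0 : base_measure set0 = 0%E.
Proof.
rewrite /base_measure integral0_eq// => q _.
by rewrite /coset_count set0I measure0.
Qed.

Lemma coset_count_ge0 q E : (0 <= coset_count q E)%E.
Proof. exact: measure_ge0. Qed.

Local Lemma base_measure_ge0 E : (0 <= base_measure E)%E.
Proof. by apply: integral_ge0 => q _; exact: coset_count_ge0. Qed.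

Local Lemma base_measure_sigma_additive : semi_sigma_additive base_measure.
Proof.
pose cm : {measure set discrete_mat -> \bar R} := @counting discrete_mat R.
move=> F mF tF mUF.
rewrite [X in _ --> X](_ : _ = \sum_(n <oo) base_measure (F n))%E.
  apply/cvg_closeP; split; last by rewrite closeE.
  by apply: is_cvg_nneseries => n _ _; exact: base_measure_ge0.
rewrite /base_measure -integral_nneseries//; last first.
  by move=> n; exact: measurable_coset_count.
apply: eq_integral => q _; apply/esym/cvg_lim => //.
rewrite /coset_count setI_bigcupl.
apply: (@measure_semi_sigma_additive _ _ _ cm (fun n => F n `&` bases q)).
- by move=> n; exact: measurable_discrete.
- by apply/trivIsetP => i j _ _ ij; rewrite setIACA (trivIsetP.1 tF)// set0I.
- exact: measurable_discrete.
Qed.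

HB.instance Definition _ := isMeasure.Build _ _ _ base_measure
  base_measure0 base_measure_ge0 base_measure_sigma_additive.

End CosetCountMeasurable.

(** * Uniqueness of the invariant measure *)

Lemma mat_lebesgue_slice (R : realType) (A : set ((quat R * quat R) * (quat R * quat R))) :
  mat_lebesgue A = (\int[@vec_lebesgue R]_a vec_lebesgue [set b | A (a, b)])%E.
Proof. exact: measure_fubini1. Qed.

Opaque mat_lebesgue sprod.

Section NormalizedMatrices.
Context {R : realType}.
Local Notation sqn := (@quat_sqnorm R).
Local Notation vec := (quat R * quat R)%type.
Local Notation mat := (vec * vec)%type.

Section Measurability.
Context d (T : measurableType d).
Implicit Types f g : T -> mat.

Lemma measurable_mat_entries f : measurable_fun setT f ->
  [/\ measurable_fun setT (fun x => (f x).1.1), measurable_fun setT (fun x => (f x).1.2),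
      measurable_fun setT (fun x => (f x).2.1) & measurable_fun setT (fun x => (f x).2.2)].
Proof.
move=> mf.
have m1 := measurableT_comp (@measurable_fst _ _ _ _) mf.
have m2 := measurableT_comp (@measurable_snd _ _ _ _) mf.
split; [exact: measurableT_comp (@measurable_fst _ _ _ _) m1|
  exact: measurableT_comp (@measurable_snd _ _ _ _) m1|
  exact: measurableT_comp (@measurable_fst _ _ _ _) m2|
  exact: measurableT_comp (@measurable_snd _ _ _ _) m2].
Qed.

Lemma measurable_mat_tuple (a c b e : T -> quat R) :
  measurable_fun setT a -> measurable_fun setT c -> measurable_fun setT b ->
  measurable_fun setT e ->
  measurable_fun setT (fun x => ((a x, c x), (b x, e x))).
Proof.
move=> ma mc mb me.
exact: measurable_fun_pair (measurable_fun_pair ma mc) (measurable_fun_pair mb me).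
Qed.

Lemma measurable_mat_mul f g : measurable_fun setT f -> measurable_fun setT g ->
  measurable_fun setT (fun x => mat_mul (f x) (g x)).
Proof.
move=> /measurable_mat_entries[f1 f2 f3 f4] /measurable_mat_entries[g1 g2 g3 g4].
by apply: measurable_mat_tuple; apply: measurable_quat_add; exact: measurable_quat_mul.
Qed.

Lemma measurable_mat_norm f : measurable_fun setT f ->
  measurable_fun setT (fun x => mat_norm (f x)).
Proof.
move=> /measurable_mat_entries[f1 f2 f3 f4]; rewrite /mat_norm.
apply: measurable_funB.
  by apply: measurable_funD; apply: measurable_funM; exact: measurable_sqn.
apply: measurable_funM => //; apply: measurable_quat_re.
apply: measurable_quat_mul; last exact: measurable_quat_conj.
apply: measurable_quat_mul => //; apply: measurable_quat_mul => //.
exact: measurable_quat_conj.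
Qed.

Lemma measurable_vec_sqn (f : T -> vec) : measurable_fun setT f ->
  measurable_fun setT (fun x => vec_sqn (f x)).
Proof.
move=> mf.
have m1 := measurableT_comp (@measurable_fst _ _ _ _) mf.
have m2 := measurableT_comp (@measurable_snd _ _ _ _) mf.
exact: measurable_funD (measurable_sqn m1) (measurable_sqn m2).
Qed.

Lemma measurable_mat_sqn f : measurable_fun setT f ->
  measurable_fun setT (fun x => mat_sqn (f x)).
Proof.
move=> mf.
have m1 := measurableT_comp (@measurable_fst _ _ _ _) mf.
have m2 := measurableT_comp (@measurable_snd _ _ _ _) mf.
exact: measurable_funD (measurable_vec_sqn m1) (measurable_vec_sqn m2).
Qed.

Lemma measurable_mat_adj f : measurable_fun setT f ->
  measurable_fun setT (fun x => mat_adj (f x)).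
Proof.
move=> /measurable_mat_entries[f1 f2 f3 f4].
have C h : measurable_fun setT h -> measurable_fun setT (fun x : T => quat_conj (h x)).
  exact: measurable_quat_conj.
have entry (p q r s : T -> quat R) : measurable_fun setT p -> measurable_fun setT q ->
    measurable_fun setT r -> measurable_fun setT s ->
    measurable_fun setT (fun x => quat_conj (p x) * (q x * quat_conj (q x)) -
      quat_conj (r x) * q x * quat_conj (s x)).
  move=> mp mq mr ms; apply: measurable_quat_add; last apply: measurable_quat_opp.
    apply: measurable_quat_mul; first exact: C.
    by apply: measurable_quat_mul => //; exact: C.
  apply: measurable_quat_mul; last exact: C.
  by apply: measurable_quat_mul => //; exact: C.
have := measurable_mat_tuple (entry _ _ _ _ f1 f4 f2 f3) (entry _ _ _ _ f3 f2 f4 f1)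
  (entry _ _ _ _ f2 f3 f1 f4) (entry _ _ _ _ f4 f1 f3 f2).
by congr measurable_fun; apply/funext => x; case: (f x) => [[? ?] [? ?]].
Qed.

End Measurability.

Implicit Types (x y : mat).

Definition mat_scale (k : R) x : mat :=
  ((quat_real k * x.1.1, quat_real k * x.1.2),
   (quat_real k * x.2.1, quat_real k * x.2.2)).

(** A fourth root because [mat_norm] has degree 4 under real dilations. *)
Definition normalizer x : R := (Num.sqrt (Num.sqrt (mat_norm x)))^-1.

Definition normalize x : mat := mat_scale (normalizer x) x.

Lemma measurable_normalize : measurable_fun setT normalize.
Proof.
have [f1 f2 f3 f4] := measurable_mat_entries (@measurable_id _ mat setT).
have mk : measurable_fun setT (fun x : mat => quat_real (normalizer x)).
  apply: measurable_quat_real; apply: measurableT_comp (@measurable_invr R) _.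
  apply: measurableT_comp (@measurable_sqrt R) _.
  by apply: measurableT_comp (@measurable_sqrt R) _; apply: measurable_mat_norm.
by apply: measurable_mat_tuple; exact: measurable_quat_mul.
Qed.

Lemma mat_scale_mull k x y : mat_scale k (mat_mul x y) = mat_mul (mat_scale k x) y.
Proof.
by rewrite /mat_scale /mat_mul /mat_vec /= !mulrDr !mulrA.
Qed.

Lemma mat_scale_mulr k x y : mat_scale k (mat_mul x y) = mat_mul x (mat_scale k y).
Proof.
rewrite /mat_scale /mat_mul /mat_vec /= !mulrDr.
have C (p q : quat R) : quat_real k * (p * q) = p * (quat_real k * q).
  by rewrite mulrA quat_realC mulrA.
by rewrite !C.
Qed.

Lemma mat_norm_scale k x : mat_norm (mat_scale k x) = k ^+ 4 * mat_norm x.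
Proof.
rewrite -[x in LHS]mat_mulr1 mat_scale_mulr mat_normM mulrC; congr (_ * _).
have -> : mat_scale k mat_one = diag_mat (quat_real k) (quat_real k).
  by rewrite /mat_scale /diag_mat /= !mulr1 !mulr0.
by rewrite mat_norm_diag !sqn_real -exprD.
Qed.

Lemma normalize_norm x : 0 < mat_norm x -> mat_norm (normalize x) = 1.
Proof.
move=> N0; rewrite mat_norm_scale /normalizer exprVn.
rewrite (exprM _ 2 2) sqr_sqrtr ?sqrtr_ge0// sqr_sqrtr ?ltW//.
by rewrite mulVf// gt_eqF.
Qed.

Lemma normalize_mull x y : mat_norm y = 1 -> normalize (mat_mul x y) = mat_mul (normalize x) y.
Proof. by move=> y1; rewrite /normalize /normalizer mat_normM y1 mulr1 mat_scale_mull. Qed.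

Lemma normalize_mulr x y : mat_norm x = 1 -> normalize (mat_mul x y) = mat_mul x (normalize y).
Proof. by move=> x1; rewrite /normalize /normalizer mat_normM x1 mul1r mat_scale_mulr. Qed.

Lemma mat_adjM x y : mat_norm x = 1 -> mat_norm y = 1 ->
  mat_adj (mat_mul x y) = mat_mul (mat_adj y) (mat_adj x).
Proof.
move=> x1 y1.
have xy1 : mat_norm (mat_mul x y) = 1 by rewrite mat_normM x1 y1 mulr1.
apply: (@mat_mul_injl _ (mat_mul x y)) => //.
rewrite mat_mul_adjr// -mat_mulA [mat_mul y _]mat_mulA mat_mul_adjr// mat_mul1.
by rewrite mat_mul_adjr.
Qed.

End NormalizedMatrices.

Section Uniqueness.
Context {R : realType}.
Local Notation vec := (quat R * quat R)%type.
Local Notation mat := (vec * vec)%type.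
Local Notation mlam := (@mat_lebesgue R).
Implicit Types (x y : mat) (E S : set mat).

Definition SL_mat : set mat := [set x | mat_norm x = 1].

Definition unit_cone : set mat := [set x | 0 < mat_norm x <= 1].

(* [E] is a subset of the hypersurface [mat_norm x = 1]; its thickening is the
   cone it spans, cut off at norm 1. *)
Definition thicken E : set mat := unit_cone `&` @normalize R @^-1` E.

(** On matrices of norm 1 [mat_adj] is inversion, so this is the cone over the inverses of the
    elements of [E]. *)
Definition thicken_inv E : set mat :=
  unit_cone `&` (fun x => mat_adj (normalize x)) @^-1` E.

Lemma measurable_SL_mat : measurable SL_mat.
Proof.
rewrite (_ : SL_mat = @mat_norm R @^-1` [set 1])// -[X in measurable X]setTI.
by apply: measurable_mat_norm => //; exact: measurable_id.
Qed.

Lemma measurable_unit_cone : measurable unit_cone.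
Proof.
rewrite (_ : unit_cone = @mat_norm R @^-1` `]0, 1]%classic); last first.
  by apply/seteqP; split=> x; rewrite /unit_cone /= in_itv.
rewrite -[X in measurable X]setTI.
by apply: measurable_mat_norm => //; exact: measurable_id.
Qed.

Lemma measurable_thicken E : measurable E -> measurable (thicken E).
Proof.
move=> mE; apply: measurableI; first exact: measurable_unit_cone.
by rewrite -[X in measurable X]setTI; exact: measurable_normalize.
Qed.

Definition swap_set1 S E : set (mat * mat) :=
  (fun p => p.1) @^-1` (S `&` SL_mat) `&`
  ((fun p => p.2) @^-1` unit_cone `&` (fun p => mat_mul (normalize p.2) p.1) @^-1` E).

(** The image of [swap_set1 S E] under [(b, h) |-> (normalize h * b, h)]. *)
Definition swap_set2 S E : set (mat * mat) :=
  (fun p => p.1) @^-1` (E `&` SL_mat) `&`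
  ((fun p => p.2) @^-1` unit_cone `&`
   (fun p => mat_mul (mat_adj (normalize p.2)) p.1) @^-1` S).

Lemma swap_set1_slice S E b : S b -> mat_norm b = 1 ->
  [set h | swap_set1 S E (b, h)] = (fun h => mat_mul h b) @^-1` thicken E.
Proof.
move=> Sb b1.
apply/seteqP; split=> h; rewrite /swap_set1 /thicken /unit_cone /= mat_normM b1 mulr1
  normalize_mull//.
by move=> [_ []].
Qed.

(** Substituting [b h] for [h] cancels [b] against the inverse of the normalised matrix, so the
    volume of the slice does not depend on [b]. *)
Lemma swap_set2_slice S E b : E b -> mat_norm b = 1 ->
  mat_mul b @^-1` [set h | swap_set2 S E (b, h)] = thicken_inv S.
Proof.
move=> Eb b1.
have key h : 0 < mat_norm h ->
    mat_mul (mat_adj (normalize (mat_mul b h))) b = mat_adj (normalize h).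
  move=> h0; rewrite normalize_mulr// mat_adjM ?normalize_norm//.
  by rewrite -mat_mulA mat_adj_mul// mat_mulr1.
apply/seteqP; split=> h; rewrite /swap_set2 /thicken_inv /unit_cone /= mat_normM b1 mul1r.
  by move=> [_ [/andP[h0 h1]]]; rewrite key// h0 h1.
by move=> [/andP[h0 h1]]; rewrite key// h0 h1.
Qed.

Lemma swap_set1_out S E b : ~ (S `&` SL_mat) b -> [set h | swap_set1 S E (b, h)] = set0.
Proof. by move=> nSb; apply/seteqP; split=> // h []. Qed.

Lemma swap_set2_out S E b : ~ (E `&` SL_mat) b -> [set h | swap_set2 S E (b, h)] = set0.
Proof. by move=> nSb; apply/seteqP; split=> // h []. Qed.

Lemma swap_set1_cone S E h : ~ unit_cone h -> [set b | swap_set1 S E (b, h)] = set0.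
Proof. by move=> nh; apply/seteqP; split=> // b [_ []]. Qed.

Lemma swap_set2_cone S E h : ~ unit_cone h -> [set b | swap_set2 S E (b, h)] = set0.
Proof. by move=> nh; apply/seteqP; split=> // b [_ []]. Qed.

Lemma swap_set_slice S E h : unit_cone h -> [set b | swap_set1 S E (b, h)] =
  mat_mul (normalize h) @^-1` [set b | swap_set2 S E (b, h)].
Proof.
move=> /[dup] ch /andP[h0 h1]; have n1 := normalize_norm h0.
have key b : mat_mul (mat_adj (normalize h)) (mat_mul (normalize h) b) = b.
  by rewrite mat_mulA mat_adj_mul// mat_mul1.
apply/seteqP; split=> b; rewrite /swap_set1 /swap_set2 /SL_mat /= mat_normM n1 mul1r key.
  by move=> [[? ?] [? ?]].
by move=> [[? ?] [? ?]].
Qed.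

Lemma measurable_swap_sets S E : measurable S -> measurable E ->
  measurable (swap_set1 S E) /\ measurable (swap_set2 S E).
Proof.
move=> mS mE.
have m1 : measurable_fun setT (fun p : mat * mat => p.1) by exact: measurable_fst.
have m2 : measurable_fun setT (fun p : mat * mat => p.2) by exact: measurable_snd.
have mn : measurable_fun setT (fun p : mat * mat => normalize p.2).
  exact: measurableT_comp (@measurable_normalize R) m2.
have pre d (T : measurableType d) (f : mat * mat -> T) (A : set T) :
    measurable_fun setT f -> measurable A -> measurable (f @^-1` A).
  by move=> mf mA; rewrite -[X in measurable X]setTI; exact: mf.
have mC := measurable_unit_cone; have mSL := measurable_SL_mat.
split; apply: measurableI; [|apply: measurableI| |apply: measurableI]; apply: pre => //.
- exact: measurableI.
- exact: measurable_mat_mul.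
- exact: measurableI.
- by apply: measurable_mat_mul => //; exact: measurable_mat_adj.
Qed.

Variable nu : {sigma_finite_measure set mat -> \bar R}.
Hypothesis nu_SL : forall E, measurable E -> nu E = nu (E `&` SL_mat).
Hypothesis nu_inv : forall x, mat_norm x = 1 -> scaling 1 nu nu (mat_mul x).

Let const_slice (Z : set (mat * mat)) A (c : \bar R) : (0 <= c)%E -> measurable A ->
  (forall b, (A `&` SL_mat) b -> mlam [set h | Z (b, h)] = c) ->
  (forall b, ~ (A `&` SL_mat) b -> mlam [set h | Z (b, h)] = 0%E) ->
  sprod nu mlam Z = (nu A * c)%E.
Proof.
move=> c0 mA H1 H0; rewrite [LHS]measure_fubini1.
have mASL : measurable (A `&` SL_mat) := measurableI _ _ mA measurable_SL_mat.
transitivity (\int[nu]_b ((\1_(A `&` SL_mat) b)%:E * c))%E.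
  apply: eq_integral => b _; rewrite indicE; case: (boolP (b \in _)) => bA.
    by rewrite mul1e; apply: H1; exact: set_mem bA.
  by rewrite mul0e; apply: H0 => /mem_set; exact/negP.
rewrite ge0_integralZr//; last exact/measurable_EFinP/measurable_indic.
by rewrite integral_indic// setIT [in RHS](nu_SL mA).
Qed.

(* Both sides are the measure of the set of pairs [(b, h)] with [b \in S] and
   [normalize h * b \in E]: integrate first over [h], or first over [b]. *)
Lemma invariant_measure_swap S E : measurable S -> measurable E ->
  (nu S * mlam (thicken E) = nu E * mlam (thicken_inv S))%E.
Proof.
move=> mS mE; have [mZ1 mZ2] := measurable_swap_sets mS mE.
transitivity (sprod nu mlam (swap_set1 S E)).
  apply/esym; apply: const_slice (measure_ge0 _ _) mS _ _ => b; last first.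
    by move=> nSb; rewrite (swap_set1_out E nSb) measure0.
  move=> [Sb b1]; rewrite (swap_set1_slice E Sb b1).
  by rewrite ((scaling_mat_mulr b1).2 _ (measurable_thicken mE)) mul1e.
transitivity (sprod nu mlam (swap_set2 S E)); last first.
  apply: const_slice (measure_ge0 _ _) mE _ _ => b; last first.
    by move=> nSb; rewrite (swap_set2_out S nSb) measure0.
  move=> [Eb b1]; have := (scaling_mat_mull b1).2 _ (measurable_slice1 b mZ2).
  by rewrite (swap_set2_slice S Eb b1) mul1e => e; exact: (esym e).
rewrite [LHS](measure_fubini nu mlam mZ1) [RHS](measure_fubini nu mlam mZ2).
apply: eq_integral => h _.
have [ch|nch] := pselect (unit_cone h); last first.
  by rewrite (swap_set1_cone S E nch) (swap_set2_cone S E nch).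
have n1 : mat_norm (normalize h) = 1 by apply: normalize_norm; case/andP: ch.
(* For fixed [h] the slices differ by left multiplication by [normalize h]; this is where the
   invariance of [nu] enters. *)
rewrite (swap_set_slice S E ch).
by rewrite ((nu_inv n1).2 _ (measurable_slice2 h mZ2)) mul1e.
Qed.

End Uniqueness.

(** Used with [a = m S], [b = m D], [l] the volume of the cone over [D] and [i] that of the inverse
    cone over [S]. Finiteness on the left side forces [b] and [i] to be finite and [i] positive,
    which licenses the division. *)
Lemma proportional_ereal (R : realType) (a b l i : \bar R) :
  (0 < a)%E -> (a < +oo)%E -> (0 < b)%E -> (0 < l)%E -> (l < +oo)%E ->
  (a * l = b * i)%E ->
  exists2 k : R, 0 < k & forall x y : \bar R, (a * x = y * i)%E -> (y = k%:E * x)%E.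
Proof.
move=> a0 ay b0 l0 ly.
case: a a0 ay => [a| |]// ; rewrite lte_fin => a0 _.
case: l l0 ly => [l| |]//; rewrite lte_fin => l0 _.
have al0 : 0 < a * l by exact: mulr_gt0.
case: i => [i| |]; rewrite -EFinM; last 2 first.
- by rewrite gt0_muley.
- by rewrite gt0_muleNy.
case: b b0 => [b| |]// b0; last first.
  case: (ltgtP i 0) => i0.
  - by rewrite lt0_mulye.
  - by rewrite gt0_mulye.
  - by rewrite i0 mule0 => -[/eqP]; rewrite gt_eqF.
rewrite lte_fin in b0; rewrite -EFinM => -[e].
have i0 : 0 < i by rewrite -(pmulr_rgt0 _ b0) -e.
exists (a / i); first exact: divr_gt0.
move=> x y xy; rewrite EFinM -muleA [(i^-1%:E * _)%E]muleC muleA xy -muleA -EFinM.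
by rewrite divff ?gt_eqF// mule1.
Qed.

(** * The measure on bases induced by the invariant probability *)

Section InvariantProbability.
Context {R : realType}.
Local Notation vec := (quat R * quat R)%type.
Local Notation mat := (vec * vec)%type.
Local Notation mlam := (@mat_lebesgue R).
Local Notation SL_mat := (@SL_mat R).
Implicit Types (q : coset_space R) (E : set mat).
Variable P : probability (coset_borel R) R.
Hypothesis P_invariant : left_invariant P.
Local Notation m := (base_measure P).

Lemma base_measure_SL E : measurable E -> m E = m (E `&` SL_mat).
Proof.
move=> mE; apply: eq_integral => q _; rewrite /coset_count; congr (counting _).
apply/seteqP; split=> x [Ex qx]; split=> //; last by case: Ex.
by split=> //; exact: bases_norm qx.
Qed.

Lemma measurable_mat_ball (C : R) : measurable (@mat_ball R C).
Proof.
rewrite (_ : mat_ball C = @mat_sqn R @^-1` `]-oo, C[%classic); last first.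
  by apply/seteqP; split=> x; rewrite /mat_ball /= in_itv.
rewrite -[X in measurable X]setTI.
by apply: measurable_mat_sqn => //; exact: measurable_id.
Qed.

Lemma base_measure_ball (C : R) : (m (mat_ball C) < +oo)%E.
Proof.
have [n nC] := @coset_count_ball R C.
have mc := measurable_coset_count (measurable_mat_ball C).
apply: (@le_lt_trans _ _ (\int[P]_q (cst n%:R%:E q))%E).
  by apply: ge0_le_integral => // q _.
rewrite integral_cst//. by rewrite [X in (_ * X)%E](@probability_setT _ _ _ P) mule1 ltry.
Qed.

Lemma mat_ball_cover : \bigcup_n (@mat_ball R n%:R) = setT.
Proof.
apply/seteqP; split=> // x _; exists (Num.trunc (mat_sqn x)).+1 => //.
exact: truncnS_gt.
Qed.

Lemma base_measure_sigma_finite : sigma_finite setT m.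
Proof.
exists (fun n => mat_ball n%:R); first by rewrite mat_ball_cover.
by move=> n; split; [exact: measurable_mat_ball|exact: base_measure_ball].
Qed.

Definition base_sigma : {sigma_finite_measure set mat -> \bar R} :=
  pack_sigma_finite base_measure_sigma_finite.

Lemma coset_count_translate (g : SL2H R) q E :
  coset_count (coset_translate g q) E = coset_count q (mat_mul (sl_coords g) @^-1` E).
Proof.
rewrite /coset_count bases_translate.
rewrite -[RHS](counting_mat_image _ (mat_mul_injl (sl_coords_norm g))).
congr (counting _); apply/seteqP; split=> x.
  by move=> [Ex [y qy yx]]; exists y => //; split=> //; rewrite /= yx.
by move=> [y [Ey qy] <-]; split=> //; exists y.
Qed.

Lemma base_measure_mull x : mat_norm x = 1 ->
  scaling 1 base_sigma base_sigma (mat_mul x).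
Proof.
move=> x1; have mx : measurable_fun setT (mat_mul x).
  by apply: measurable_mat_mul; [exact: measurable_cst|exact: measurable_id].
split=> // E mE; rewrite mul1e.
have [g gx] := sl_coords_surj x1.
have sP : scaling 1 P P (coset_translate g : coset_borel R -> coset_borel R).
  split=> [|A mA]; first exact: measurable_coset_translate.
  by rewrite mul1e; exact: P_invariant.
have := integral_scaling ler01 sP (measurable_coset_count mE) (fun q => coset_count_ge0 q E).
rewrite mul1e => e; apply: etrans e; apply: eq_integral => q _.
by rewrite coset_count_translate gx.
Qed.

Lemma base_measure_setT : (1 <= m setT)%E.
Proof.
have <- : (\int[P]_q (cst 1 q) = 1 :> \bar R)%E.
  by rewrite integral_cst// [X in (_ * X)%E](@probability_setT _ _ _ P) mul1e.
apply: ge0_le_integral => //.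
  exact: measurable_coset_count.
move=> q _; apply: counting_gt0; exists (sl_coords (coset_repr q)).
by split=> //; exact: bases_repr.
Qed.

Lemma base_measure_ball_gt0 : exists n : nat, (0 < m (mat_ball n%:R))%E.
Proof.
apply: contrapT => H.
have m0 n : m (mat_ball n%:R) = 0%E.
  apply/eqP; rewrite eq_le measure_ge0 andbT leNgt; apply/negP => H'.
  by apply: H; exists n.
have := le_trans base_measure_setT (@measure_sigma_subadditive _ _ _ m setT
  (fun n => mat_ball n%:R) (fun n => measurable_mat_ball _) measurableT _).
rewrite mat_ball_cover => /(_ (fun _ => id)).
by rewrite eseries0 ?lee_fin ?ler10// => n _ _; exact: m0.
Qed.

(* The reference set [D] keeps the constant finite and nonzero. *)
Lemma base_measure_thicken D : measurable D -> (0 < m D)%E ->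
  (0 < mlam (thicken D))%E -> (mlam (thicken D) < +oo)%E ->
  exists2 k : R, 0 < k & forall E, measurable E -> m E = (k%:E * mlam (thicken E))%E.
Proof.
move=> mD D0 L0 Ly; have [n n0] := base_measure_ball_gt0.
set S := mat_ball n%:R in n0; have mS : measurable S by exact: measurable_mat_ball.
have Sy : (m S < +oo)%E by exact: base_measure_ball.
have swap E : measurable E ->
    (m S * mlam (thicken E) = m E * mlam (thicken_inv S))%E.
  move=> mE; exact: (@invariant_measure_swap _ base_sigma base_measure_SL base_measure_mull).
have [k k0 K] := proportional_ereal n0 Sy D0 L0 Ly (swap _ mD).
exists k; first exact: k0.
move=> E mE; exact: K _ _ (swap E mE).
Qed.

(** Reduced bases attain the shortest length and no basis has a shorter first column, so sublevel
    sets of the length are open by [open_bases_meet]. *)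
Lemma coset_length_lt q (r : R) : (shortest_length (coset_lattice q) < r) <->
  bases q `&` [set x | col_length x < r] !=set0.
Proof.
have [y yq ry] := exists_reduced_basis q.
rewrite (shortest_length_reduced yq ry); split=> [lr|[x [xq xr]]].
  by exists y.
apply: le_lt_trans xr; rewrite ler_wsqrtr//.
have /(basesP _ yq)[u Gu ->] := xq.
have [_ [h1 h2 _ _]] := Gu.
have u0 : u.1 != 0 by apply: mat_norm1_col1; exact: Gu.1.
have := reduced_shortest ry h1 h2; rewrite -surjective_pairing; exact.
Qed.

Lemma open_col_length (r : R) : open [set x : mat | col_length x < r].
Proof.
have c : continuous (@col_length R).
  move=> x; apply: (@continuous_comp _ _ _ (fun x : mat => vec_sqn x.1) Num.sqrt).
    have [c11 c12 c21 c22] := @continuous_mat_entries R.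
    have S (f : mat -> quat R) : continuous f -> continuous (fun x => quat_sqnorm (f x)).
      exact: continuous_sqn.
    by apply: cvgD; [exact: (S _ c11)|exact: (S _ c12)].
  exact: sqrt_continuous.
rewrite (_ : [set x | _] = @col_length R @^-1` `]-oo, r[%classic).
  by move/continuousP: c; apply; exact: interval_open.
by apply/seteqP; split=> x; rewrite /= in_itv.
Qed.

Lemma measurable_coset_length :
  measurable_fun setT (fun q : coset_borel R => shortest_length (coset_lattice q)).
Proof.
apply: (measurability _ (RGenInftyO.measurableE R)) => _ [_ [r ->] <-].
rewrite setTI; apply: open_measurable_coset.
rewrite (_ : _ @^-1` _ = [set q | bases q `&` [set x | col_length x < r] !=set0]).
  by apply: open_bases_meet; exact: open_col_length.
by apply/seteqP; split=> q /=; rewrite in_itv/= => /coset_length_lt.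
Qed.

End InvariantProbability.

(** * Polar coordinates *)

Section ConeVolume.
Context {R : realType}.
Local Notation sqn := (@quat_sqnorm R).
Local Notation lam := (@quat_lebesgue R).
Local Notation vec := (quat R * quat R)%type.
Local Notation mat := (vec * vec)%type.
Implicit Types (a b : vec) (x g : mat) (Y : set (R * quat R)).

Lemma quat_conj_real (k : R) : quat_conj (quat_real k) = quat_real k.
Proof. by rewrite /quat_conj /quat_real !oppr0. Qed.

Lemma quat_conj0 : quat_conj 0 = 0 :> quat R.
Proof. exact: quat_conj_real 0. Qed.

Lemma quat_realN (k : R) : - quat_real k = quat_real (- k).
Proof. by rewrite quat_oppE !oppr0. Qed.

Lemma mat_scale_gram k x : k != 0 -> gram_coef (mat_scale k x) = gram_coef x.
Proof.
move=> k0; rewrite /gram_coef /mat_scale /= /vec_sqn !sqnM -mulrDr sqn_real.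
have C (p q : quat R) : quat_conj (quat_real k * p) * (quat_real k * q) =
    quat_real (k ^+ 2) * (quat_conj p * q).
  rewrite quat_conjM quat_conj_real -mulrA [quat_real k * (_ * _)]mulrA.
  by rewrite -quat_realM mulrA -quat_realC -mulrA -expr2.
rewrite !C -mulrDr mulrA -quat_realM invfM mulrAC mulVf ?mul1r//.
by rewrite expf_eq0 negb_and k0 orbT.
Qed.

Lemma col_length_scale k x : 0 <= k -> col_length (mat_scale k x) = k * col_length x.
Proof.
move=> k0; rewrite /col_length /vec_sqn /= !sqnM -mulrDr sqn_real sqrtrM ?sqr_ge0//.
by rewrite sqrtr_sqr ger0_norm.
Qed.

(* For fixed [a], an explicit linear change of variables of norm 1 turns [b]
   into a square root of [mat_norm (a, b)] and the Gram-Schmidt coefficient. *)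
Lemma gram_pivot a : a != 0 -> exists2 g, mat_norm g = 1 & forall b,
  mat_norm (a, b) = sqn (mat_vec g b).1 /\ gram_coef (a, b) = (mat_vec g b).2.
Proof.
case: a => a c a0; have [az|a1] := eqVneq a 0.
  have c1 : c != 0 by apply: contra_neq a0 => ->; rewrite az.
  have c2 : sqn c != 0 by rewrite sqn_eq0.
  (* When the upper entry of the first column vanishes, the norm is [|c|^2 |b|^2] and the
     coefficient is the inverse of [c] times [e]. *)
  exists ((quat_real (Num.sqrt (sqn c)), 0), (0, quat_inv c)).
    rewrite /mat_norm /= quat_conj0 !mulr0 sqn0 mulr0 addr0 sqn_real sqnV//.
    by rewrite sqr_sqrtr ?sqn_ge0// divff// subr0.
  move=> [b e]; rewrite /mat_vec /= !mul0r addr0 add0r az; split.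
    by rewrite mat_norm_antipivot//= sqnM sqn_real sqr_sqrtr ?sqn_ge0// mulrC.
  rewrite /gram_coef /vec_sqn /= sqn0 add0r quat_conj0 mul0r add0r.
  by rewrite /quat_inv mulrA.
have s1 : sqn a != 0 by rewrite sqn_eq0.
set r := Num.sqrt (sqn a); have rr : r ^+ 2 = sqn a by rewrite sqr_sqrtr ?sqn_ge0.
set S := sqn a + sqn c; have S0 : S != 0.
  by have := a0; rewrite -vec_sqn_eq0.
(* The first row is [|a|] times the Schur complement as a linear form in the second column, and the
   second row is the formula of [gram_coef]. *)
exists ((- (quat_real r * (c * quat_inv a)), quat_real S^-1 * quat_conj a),
        (quat_real r, quat_real S^-1 * quat_conj c)).
  rewrite /mat_norm /= sqnN !sqnM !sqn_conj !sqn_real rr.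
  set w := (X in quat_re X).
  have -> : w = quat_real (- (S ^- 2 * (sqn a * sqn c))).
    rewrite /w quat_conjM quat_conjK !quat_conj_real !mulNr -!mulrA.
    have L k (p q : quat R) : p * (quat_real k * q) = quat_real k * (p * q).
      by rewrite mulrA -quat_realC mulrA.
    rewrite [quat_conj a * (a * _)]mulrA mul_conj_quat.
    rewrite -[quat_conj c * _]quat_realC !(L _ c) mul_quat_conj -!quat_realM -quat_realN.
    congr (- quat_real _).
    by rewrite -rr; field; rewrite S0 sqrtr_eq0 -ltNge sqn_gt0.
  by move: S0; rewrite /quat_re /quat_real/= /S => S0; field; rewrite S0 s1.
move=> [b e]; rewrite /mat_vec /=; split.
  rewrite mat_norm_pivot//= -rr -sqn_real -sqnM; congr sqn.
  by rewrite mulrBr addrC mulNr !mulrA.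
by rewrite /gram_coef /vec_sqn /= mulrDr !mulrA.
Qed.
Definition radius a : R := Num.sqrt (vec_sqn a).

Lemma measurable_radius : measurable_fun setT radius.
Proof.
apply: measurableT_comp (@measurable_sqrt R) _.
by apply: measurable_vec_sqn; exact: measurable_id.
Qed.

Definition quartic_root_inv (s : R) : R := (Num.sqrt (Num.sqrt s))^-1.

Lemma quartic_root_inv_gt0 s : 0 < s -> 0 < quartic_root_inv s.
Proof. by move=> s0; rewrite invr_gt0 !sqrtr_gt0. Qed.

Lemma measurable_quartic_root_inv : measurable_fun setT quartic_root_inv.
Proof.
apply: measurableT_comp (@measurable_invr R) _.
exact: measurableT_comp (@measurable_sqrt R) (@measurable_sqrt R).
Qed.

Lemma measurable_gram_coef : measurable_fun setT (@gram_coef R).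
Proof.
have [f1 f2 f3 f4] := measurable_mat_entries (@measurable_id _ mat setT).
apply: measurable_quat_mul.
  apply: measurable_quat_real; apply: measurableT_comp (@measurable_invr R) _.
  by apply: measurable_vec_sqn; exact: measurable_fst.
by apply: measurable_quat_add; apply: measurable_quat_mul => //; exact: measurable_quat_conj.
Qed.

Lemma measurable_with_shape Y : measurable Y -> measurable (@with_shape R Y).
Proof.
move=> mY; apply: measurableI; first exact: measurable_SL_mat.
have ms : measurable_fun setT (fun x : mat => (col_length x, gram_coef x)).
  apply: measurable_fun_pair; last exact: measurable_gram_coef.
  exact: measurableT_comp measurable_radius (@measurable_fst _ _ _ _).
by rewrite -[X in measurable X]setTI; exact: ms.
Qed.

Lemma thicken_shapeE Y x : thicken (with_shape Y) x <->
  0 < mat_norm x <= 1 /\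
  Y (quartic_root_inv (mat_norm x) * radius x.1, gram_coef x).
Proof.
split=> [[/[dup] N01 /andP[N0 _]] [_ Yx]|[/[dup] N01 /andP[N0 _] Yx]]; split=> //.
  rewrite -(@mat_scale_gram (quartic_root_inv (mat_norm x))); last first.
    by rewrite gt_eqF// quartic_root_inv_gt0.
  have := col_length_scale x (ltW (quartic_root_inv_gt0 N0)).
  by rewrite -[_ * radius _]/(_ * col_length x) => <-.
split; first exact: normalize_norm.
have := col_length_scale x (ltW (quartic_root_inv_gt0 N0)).
rewrite /normalize -/(quartic_root_inv (mat_norm x)) => ->.
by rewrite mat_scale_gram// gt_eqF// quartic_root_inv_gt0.
Qed.

Definition shape_slice (Y : set (R * quat R)) (t : R) : \bar R :=
  lam [set X | Y (t, X)].

Lemma measurable_shape_slice Y : measurable Y -> measurable_fun setT (shape_slice Y).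
Proof. exact: measurable_measure_slice1. Qed.

(** The factor [sqn z ^+ 2] is [n ^- 8] for [n = quartic_root_inv (sqn z)], the factor that the
    dilation by [n] contributes on R^8. *)
Definition cone_weight (z : quat R) : \bar R :=
  if 0 < sqn z <= 1 then (sqn z ^+ 2)%:E else 0%E.

Lemma thicken_shape_slice Y a : measurable Y -> a != 0 ->
  vec_lebesgue [set b | thicken (with_shape Y) (a, b)] =
  (\int[lam]_z (if (0 < sqn z <= 1)%R
     then shape_slice Y (quartic_root_inv (sqn z) * radius a)%R else 0))%E.
Proof.
move=> mY a0; have [g g1 gb] := gram_pivot a0.
have [mg sg] := mat_norm_scaling (g := g) (etrans (congr1 (fun r => r != 0) g1) (oner_neq0 _)).
pose B := [set p : quat R * quat R |
  0 < sqn p.1 <= 1 /\ Y (quartic_root_inv (sqn p.1) * radius a, p.2)].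
have mB : measurable B.
  have ms : measurable_fun setT (fun p : quat R * quat R =>
      (quartic_root_inv (sqn p.1) * radius a, p.2)).
    apply: measurable_fun_pair; last exact: measurable_snd.
    apply: measurable_funM; last exact: measurable_cst.
    apply: measurableT_comp measurable_quartic_root_inv _.
    by apply: measurable_sqn; exact: measurable_fst.
  have mn := measurable_sqn (@measurable_fst _ _ (quat R) (quat R)).
  rewrite (_ : B = (fun p => sqn p.1) @^-1` `]0, 1]%classic `&`
      (fun p => (quartic_root_inv (sqn p.1) * radius a, p.2)) @^-1` Y).
    by apply: measurableI; rewrite -[X in measurable X]setTI; [exact: mn|exact: ms].
  by apply/seteqP; split=> p; rewrite /B /= in_itv.
transitivity (vec_lebesgue (mat_vec g @^-1` B)).
  congr (vec_lebesgue _); apply/seteqP; split=> b; rewrite /= thicken_shapeE /B/=;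
    by have [-> ->] := gb b.
rewrite sg// g1 expr1n invr1 mul1e; apply: etrans; first exact: measure_fubini1.
apply: eq_integral => z _; rewrite /B /=; case: ifPn => z1.
  congr (lam _); apply/seteqP; split=> X /=; [by case|by split].
by rewrite (_ : [set _ | _] = set0) ?measure0//; apply/seteqP; split=> X //= -[].
Qed.

Lemma thicken_shape_slice0 Y : (forall p, Y p -> 0 < p.1) ->
  [set b | thicken (with_shape Y) ((0 : vec), b)] = set0.
Proof.
move=> Y0; apply/seteqP; split=> b //=; rewrite thicken_shapeE => -[_ /Y0 /=].
by rewrite /radius (_ : vec_sqn (0 : vec) = 0) ?sqrtr0 ?mulr0 ?ltxx//; apply/eqP; rewrite vec_sqn_eq0.
Qed.

Lemma shape_slice0 Y : (forall p, Y p -> 0 < p.1) -> forall t, t <= 0 ->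
  shape_slice Y t = 0%E.
Proof.
move=> Y0 t t0; rewrite /shape_slice (_ : [set _ | _] = set0) ?measure0//.
by apply/seteqP; split=> X //= /Y0 /=; rewrite ltNge t0.
Qed.

Lemma shape_slice_ge0 Y t : (0 <= shape_slice Y t)%E.
Proof. exact: measure_ge0. Qed.

Lemma integral_shape_slice_scale Y n : measurable Y -> 0 < n ->
  (\int[@vec_lebesgue R]_a shape_slice Y (n * radius a)%R =
   (n ^- 8)%:E * \int[@vec_lebesgue R]_a shape_slice Y (radius a))%E.
Proof.
move=> mY n0; have n1 : quat_real n != 0 by rewrite -sqn_gt0 sqn_real exprn_gt0.
have mf : measurable_fun setT (fun a => shape_slice Y (radius a)).
  exact: measurableT_comp (measurable_shape_slice mY) measurable_radius.
have := integral_scaling (invr_exp_ge0 4 (sqn_ge0 _)) (scaling_vec_scale n1) mf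
  (fun a => shape_slice_ge0 Y (radius a)).
rewrite sqn_real -exprM => <-; apply: eq_integral => a _; congr (shape_slice Y _).
by rewrite /radius vec_sqn_scale sqn_real sqrtrM ?vec_sqn_ge0// sqrtr_sqr gtr0_norm// mulrC.
Qed.

Lemma measurable_cone_weight : measurable_fun setT cone_weight.
Proof.
rewrite /cone_weight; have ms := measurable_sqn (@measurable_id _ (quat R) setT).
apply: measurable_fun_ifT; last exact: measurable_cst.
  apply: measurable_and; first by apply: measurable_fun_ltr.
  exact: measurable_fun_ler.
by apply/measurable_EFinP; exact: measurable_funX.
Qed.

(** After the substitution in the second column, [z] occurs only in the dilation of the first;
    exchanging the integrals and undoing the dilation separates the two. *)
Lemma mat_lebesgue_thicken Y : measurable Y -> (forall p, Y p -> 0 < p.1) ->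
  mat_lebesgue (thicken (with_shape Y)) =
  (\int[lam]_z cone_weight z * \int[@vec_lebesgue R]_a shape_slice Y (radius a))%E.
Proof.
move=> mY Y0; apply: etrans; first exact: mat_lebesgue_slice.
pose F (p : vec * quat R) : \bar R := if 0 < sqn p.2 <= 1
  then shape_slice Y (quartic_root_inv (sqn p.2) * radius p.1) else 0%E.
have F0 p : (0 <= F p)%E by rewrite /F; case: ifP => // _; exact: shape_slice_ge0.
have mF : measurable_fun setT F.
  have ms := measurable_sqn (@measurable_snd _ _ vec (quat R)).
  apply: measurable_fun_ifT; last exact: measurable_cst.
    apply: measurable_and; first by apply: measurable_fun_ltr.
    exact: measurable_fun_ler.
  apply: measurableT_comp (measurable_shape_slice mY) _.
  apply: measurable_funM; first exact: measurableT_comp measurable_quartic_root_inv ms.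
  exact: measurableT_comp measurable_radius (@measurable_fst _ _ _ _).
transitivity (\int[@vec_lebesgue R]_a \int[lam]_z F (a, z))%E.
  apply: eq_integral => a _; have [->|a0] := eqVneq a 0; last first.
    exact: thicken_shape_slice.
  rewrite thicken_shape_slice0// measure0 integral0_eq// => z _; rewrite /F/=.
  case: ifP => // _; apply: shape_slice0 => //.
  by rewrite /radius (_ : vec_sqn (0 : vec) = 0) ?sqrtr0 ?mulr0//; apply/eqP; rewrite vec_sqn_eq0.
apply: etrans; first exact: fubini_tonelli.
rewrite -ge0_integralZr//; last 3 first.
- exact: measurable_cone_weight.
- by move=> z _; rewrite /cone_weight; case: ifP => // _; rewrite lee_fin sqr_ge0.
- by apply: integral_ge0 => a _; exact: shape_slice_ge0.
apply: eq_integral => z _; rewrite /F/= /cone_weight; case: ifPn => z1; last first.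
  by rewrite mul0e integral0_eq.
have /andP[z0 _] := z1.
rewrite integral_shape_slice_scale ?quartic_root_inv_gt0//; congr (_%:E * _)%E.
rewrite /quartic_root_inv exprVn invrK (exprM _ 2 4) sqr_sqrtr ?sqrtr_ge0//.
by rewrite (exprM _ 2 2) sqr_sqrtr ?ltW.
Qed.

End ConeVolume.

(** * The radial part of Lebesgue measure on R^8 *)

Section RadialMeasure.
Context {R : realType}.
Local Notation sqn := (@quat_sqnorm R).
Local Notation lam := (@quat_lebesgue R).
Local Notation vlam := (@vec_lebesgue R).
Local Notation mu := (@lebesgue_measure R).
Local Notation vec := (quat R * quat R)%type.
Implicit Types (a b : vec) (Y : set (R * quat R)).

Lemma quat_ball_dilation : lam (quat_ball (4^-1)) = (16^-1%:E * lam (quat_ball 1))%E.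
Proof.
have [_ s2] := @scaling_quat_real R 2 (ltr0n _ _).
have := s2 _ (measurable_quat_ball 1).
rewrite (_ : _ @^-1` _ = quat_ball 4^-1) => [->|].
  by congr (_%:E * _)%E; rewrite -natrX.
by apply/seteqP; split=> x; rewrite /quat_ball /= sqnM sqn_real; lra.
Qed.

Lemma cone_weight_integral :
  (0 < \int[lam]_z cone_weight z)%E /\ (\int[lam]_z cone_weight z < +oo)%E.
Proof.
have cw0 z : (0 <= @cone_weight R z)%E.
  by rewrite /cone_weight; case: ifP => // _; rewrite lee_fin sqr_ge0.
have mcw := @measurable_cone_weight R.
have mb (r : R) := measurable_quat_ball r.
split; last first.
  apply: le_lt_trans (@quat_ball_lty R).
  have <- : (\int[lam]_z (\1_(quat_ball 1) z)%:E = lam (quat_ball 1))%E.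
    by rewrite integral_indic ?setIT.
  apply: ge0_le_integral => //.
    by apply/measurable_EFinP; exact: measurable_indic.
  move=> z _; rewrite /cone_weight; case: ifPn => [/andP[z0 z1]|_]; last by rewrite lee_fin.
  by rewrite indicE mem_set// lee_fin exprn_ile1// ltW.
(* On this shell, where [|z|^2] lies between 1/4 and 1, the weight is at least 1/16. *)
pose S := @quat_ball R 1 `\` quat_ball 4^-1.
have mS : measurable S by exact: measurableD.
have b1 : (lam (quat_ball 1) < +oo)%E by exact: quat_ball_lty.
have S0 : (0 < lam S)%E.
  have -> : lam S = (lam (quat_ball 1) - lam (quat_ball 4^-1))%E.
    apply: etrans; first exact: measureD.
    rewrite [X in (_ - lam X)%E](_ : _ = quat_ball 4^-1)//; apply: setIidr.
    by move=> x; rewrite /quat_ball /=; lra.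
  rewrite quat_ball_dilation.
  have := @quat_ball_gt0 R; have : lam (quat_ball 1) \is a fin_num by rewrite ge0_fin_numE// measure_ge0.
  move=> /fineK <-; rewrite lte_fin -EFinM -EFinB lte_fin; lra.
apply: (@lt_le_trans _ _ (\int[lam]_z (16^-1 * \1_S z)%:E)%E).
  under eq_integral do rewrite EFinM.
  rewrite ge0_integralZl//; last first.
    by apply/measurable_EFinP; exact: measurable_indic.
  by rewrite integral_indic// setIT mule_gt0.
apply: ge0_le_integral => //.
  by apply/measurable_EFinP; apply: measurable_funM => //; exact: measurable_indic.
move=> z _; rewrite indicE; have [|] := boolP (z \in S); last by rewrite mulr0.
rewrite inE mulr1 => -[z1 z2]; rewrite /cone_weight ifT; last first.
  by apply/andP; split; move: z1 z2; rewrite /quat_ball /=; lra.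
move: z1 z2; rewrite /quat_ball /= lee_fin => z1 z2.
have : 4^-1 <= sqn z by lra.
by move=> h; nra.
Qed.

Definition open_ball (r : R) : set vec := [set a | radius a < r].

Lemma measurable_open_ball r : measurable (open_ball r).
Proof.
rewrite (_ : open_ball r = @radius R @^-1` `]-oo, r[%classic).
  by rewrite -[X in measurable X]setTI; exact: measurable_radius.
by apply/seteqP; split=> x; rewrite /open_ball /= in_itv.
Qed.

Lemma open_ball1 : (0 < vlam (open_ball 1))%E /\ (vlam (open_ball 1) < +oo)%E.
Proof.
have mb (r : R) := measurable_quat_ball r.
have vE (r : R) : vlam (quat_ball r `*` quat_ball r) = (lam (quat_ball r) * lam (quat_ball r))%E.
  exact: sprodE.
have fin : lam (quat_ball 1) \is a fin_num by rewrite ge0_fin_numE ?measure_ge0 ?quat_ball_lty.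
have pos := @quat_ball_gt0 R.
have E a : open_ball 1 a <-> vec_sqn a < 1.
  by rewrite /open_ball /= /radius -{1}sqrtr1 ltr_sqrt.
split.
  apply: (@lt_le_trans _ _ (vlam (quat_ball (4^-1) `*` quat_ball (4^-1)))).
    by rewrite vE quat_ball_dilation !mule_gt0.
  apply: le_measure; rewrite ?inE; [exact: measurableX|exact: measurable_open_ball|].
  by move=> a; rewrite /quat_ball /= E /vec_sqn; lra.
apply: (@le_lt_trans _ _ (vlam (quat_ball 1 `*` quat_ball 1))).
  apply: le_measure; rewrite ?inE; [exact: measurable_open_ball|exact: measurableX|].
  move=> a /E; rewrite /quat_ball /= /vec_sqn.
  by have := sqn_ge0 a.1; have := sqn_ge0 a.2; lra.
by rewrite vE -(fineK fin) -EFinM ltry.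
Qed.

(** The volume of the unit ball of R^8; its value cancels in the law of the length. *)
Definition kappa : R := fine (vlam (open_ball 1)).

Lemma kappa_gt0 : 0 < kappa.
Proof.
have [h1 h2] := open_ball1.
by rewrite -lte_fin fineK// ge0_fin_numE// measure_ge0.
Qed.

Lemma vlam_open_ball r : vlam (open_ball r) = (kappa * (Num.max 0 r) ^+ 8)%:E.
Proof.
have [r0|r0] := leP r 0.
  rewrite expr0n mulr0 (_ : open_ball r = set0) ?measure0//.
  apply/seteqP; split=> a //=; rewrite /open_ball /= => h.
  by have := le_lt_trans (sqrtr_ge0 _) (lt_le_trans h r0); rewrite ltxx.
have q0 : quat_real r^-1 != 0 by rewrite -sqn_gt0 sqn_real exprn_gt0// invr_gt0.
have [_ s] := scaling_vec_scale q0.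
have := s _ (measurable_open_ball 1); rewrite sqn_real.
rewrite (_ : _ @^-1` _ = open_ball r) => [->|].
  rewrite /kappa mulrC EFinM fineK; last first.
    by have [h1 h2] := open_ball1; rewrite ge0_fin_numE// measure_ge0.
  by congr (_%:E * _)%E; rewrite -exprM exprVn invrK.
apply/seteqP; split=> a; rewrite /open_ball /= /radius vec_sqn_scale sqn_real;
  rewrite sqrtrM ?vec_sqn_ge0// sqrtr_sqr gtr0_norm ?invr_gt0// -[_ < 1](@ltr_pM2r _ r)//;
  by rewrite mul1r -mulrA mulVf ?mulr1// gt_eqF.
Qed.

End RadialMeasure.

Section RadialDensity.
Context {R : realType}.
Local Notation lam := (@quat_lebesgue R).
Local Notation vlam := (@vec_lebesgue R).
Local Notation mu := (@lebesgue_measure R).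
Local Notation vec := (quat R * quat R)%type.
Implicit Types (a b : vec) (Y : set (R * quat R)).

(** The derivative of [kappa * t ^+ 8], the volume of the ball of radius [t]. *)
Definition radial_density (t : R) : R := if 0 < t then 8 * kappa * t ^+ 7 else 0.

Lemma radial_density_ge0 t : 0 <= radial_density t.
Proof.
rewrite /radial_density; case: ifPn => // t0.
by rewrite !mulr_ge0 ?exprn_ge0// ltW// kappa_gt0.
Qed.

Lemma measurable_radial_density : measurable_fun setT radial_density.
Proof.
apply: measurable_fun_ifT; last exact: measurable_cst.
  by apply: measurable_fun_ltr.
by apply: measurable_funM => //; exact: measurable_funX.
Qed.

Lemma measurable_radial_densityE : measurable_fun setT (fun t => (radial_density t)%:E).
Proof. by apply/measurable_EFinP; exact: measurable_radial_density. Qed.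

Definition radial_measure (A : set (measurableTypeR R)) : \bar R :=
  (\int[mu]_(t in A) (radial_density t)%:E)%E.

Local Lemma radial_measure0 : radial_measure set0 = 0%E.
Proof. by rewrite /radial_measure integral_set0. Qed.

Local Lemma radial_measure_ge0 A : (0 <= radial_measure A)%E.
Proof. by apply: integral_ge0 => t _; rewrite lee_fin radial_density_ge0. Qed.

Local Lemma radial_measure_sigma_additive : semi_sigma_additive radial_measure.
Proof.
move=> F mF tF mUF; rewrite /radial_measure ge0_integral_bigcup//; last 2 first.
- exact: measurable_funTS measurable_radial_densityE.
- by move=> t _; rewrite lee_fin radial_density_ge0.
apply: is_cvg_nneseries => n _ _; exact: radial_measure_ge0.
Qed.

HB.instance Definition _ := isMeasure.Build _ _ _ radial_measure
  radial_measure0 radial_measure_ge0 radial_measure_sigma_additive.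

Lemma radial_measure_ray r : radial_measure `]-oo, r[%classic = (kappa * (Num.max 0 r) ^+ 8)%:E.
Proof.
rewrite /radial_measure; have [r0|r0] := leP r 0.
  rewrite expr0n mulr0 integral0_eq// => t; rewrite /= in_itv/= => tr.
  by rewrite /radial_density ltNge (ltW (lt_le_trans tr r0)).
pose f (t : R) := 8 * kappa * t ^+ 7.
pose F (t : R) := kappa * t ^+ 8.
have cX n (k : R) : continuous (fun t : R => k * t ^+ n).
  move=> t; apply: cvgM; first exact: cvg_cst.
  exact: exprn_continuous.
have mf : measurable_fun setT (fun t => (f t)%:E).
  by apply/measurable_EFinP; apply: measurable_funM => //; exact: measurable_funX.
transitivity (\int[mu]_(t in `]0%R, r[) (f t)%:E)%E.
  rewrite integral_mkcond [RHS]integral_mkcond; apply: eq_integral => t _.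
  rewrite /patch !mem_setE !in_itv/= /radial_density.
  by case: (ltP 0 t) => t0; case: (ltP t r).
rewrite -(integral_itv_bndoo true false); last exact: measurable_funTS.
have := @continuous_FTC2 R f F 0 r r0.
rewrite /F expr0n mulr0 sube0; apply.
- by apply: continuous_subspaceT; exact: cX.
- split=> [t _||].
  + by apply: derivableM; [exact: derivable_cst|exact: exprn_derivable].
  + by apply: cvg_at_right_filter; exact: cX.
  + by apply: cvg_at_left_filter; exact: cX.
- move=> t _; rewrite derive1Ml; last exact: exprn_derivable.
  by rewrite exp_derive1 /f mulrCA mulrA.
Qed.

(** Both measures agree on the rays, which are stable under intersection and generate the Borel
    sets. *)
Lemma radial_pushforward A : measurable A ->
  vlam (@radius R @^-1` A) = radial_measure A.
Proof.
pose nu := @image_measure R _ _ vec (measurableTypeR R) vlam (@radius R) (@measurable_radius R).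
have nuE r : nu `]-oo, r[%classic = (kappa * (Num.max 0 r) ^+ 8)%:E.
  rewrite -vlam_open_ball (_ : open_ball r = @radius R @^-1` `]-oo, r[%classic); first exact: erefl.
  by apply/seteqP; split=> a; rewrite /= in_itv.
move=> mA; apply: (@measure_unique _ R (measurableTypeR R) (@RGenInftyO.G R)
  (fun n => `]-oo, n%:R[%classic) _ _ _ _ nu radial_measure).
- exact: RGenInftyO.measurableE.
- move=> _ _ [x ->] [y ->]; exists (Num.min x y); apply/seteqP; split=> z; rewrite /= !in_itv/= lt_min.
    by move=> [-> ->].
  by move=> /andP.
- by move=> n; exists n%:R.
- apply/seteqP; split=> // x _; exists (Num.trunc x).+1 => //=.
  by rewrite in_itv/=; exact: truncnS_gt.
- by move=> _ [x ->]; exact: etrans (nuE x) (esym (radial_measure_ray x)).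
- by move=> n; apply: (le_lt_trans _ (ltry _)); rewrite le_eqVlt; apply/orP; left; apply/eqP; exact: nuE.
- exact: mA.
Qed.

End RadialDensity.

Section PolarCoordinates.
Context {R : realType}.
Local Notation lam := (@quat_lebesgue R).
Local Notation vlam := (@vec_lebesgue R).
Local Notation mu := (@lebesgue_measure R).
Local Notation vec := (quat R * quat R)%type.
Implicit Types (a b : vec) (Y : set (R * quat R)).

Definition shape_volume Y : \bar R :=
  (\int[mu]_t ((radial_density t)%:E * shape_slice Y t))%E.

(** Both sides measure a set of pairs. With the integral over [X] outermost, the inner sets are
    preimages under [radius], to which [radial_pushforward] applies directly. *)
Lemma integral_radius Y : measurable Y ->
  (\int[vlam]_a shape_slice Y (radius a) = shape_volume Y)%E.
Proof.
move=> mY; pose B : set (vec * quat R) := [set p | Y (radius p.1, p.2)].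
have mB : measurable B.
  have mr : measurable_fun setT (fun p : vec * quat R => (radius p.1, p.2)).
    apply: measurable_fun_pair; last exact: measurable_snd.
    exact: measurableT_comp (@measurable_radius R) (@measurable_fst _ _ _ _).
  by rewrite -[X in measurable X]setTI; exact: mr.
transitivity (sprod vlam lam B); first exact: esym (measure_fubini1 _ _ _).
apply: etrans; first exact: measure_fubini.
pose F (p : measurableTypeR R * quat R) : \bar R :=
  ((radial_density p.1)%:E * (\1_Y p)%:E)%E.
have F0 p : (0 <= F p)%E by rewrite mule_ge0// lee_fin radial_density_ge0.
have mF : measurable_fun setT F.
  apply: emeasurable_funM.
    exact: measurableT_comp (@measurable_radial_densityE R) (@measurable_fst _ _ _ _).
  by apply/measurable_EFinP; exact: measurable_indic.
transitivity (\int[lam]_X \int[mu]_t F (t, X))%E.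
  apply: eq_integral => X _; apply: etrans; first exact: (radial_pushforward (measurable_slice2 X mY)).
  rewrite /radial_measure integral_mkcond; apply: eq_integral => t _.
  by rewrite epatch_indic /F /=; congr (_ * _%:E)%E.
apply: etrans; first by apply/esym; exact: fubini_tonelli.
apply: eq_integral => t _; have mt : measurable_fun setT (fun X => (\1_Y (t, X))%:E : \bar R).
  by apply/measurable_EFinP; apply: measurableT_comp; [exact: measurable_indic|exact: measurable_pair1].
transitivity ((radial_density t)%:E * \int[lam]_X (\1_Y (t, X))%:E)%E.
  by rewrite -ge0_integralZl// lee_fin radial_density_ge0.
congr (_ * _)%E.
apply: etrans (integral_indic lam measurableT (measurable_slice1 t mY)) _.
by rewrite setIT.
Qed.
End PolarCoordinates.

(** * Law of the shortest length *)

Section ReducedVolume.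
Context {R : realType}.
Local Notation sqn := (@quat_sqnorm R).
Local Notation lam := (@quat_lebesgue R).
Local Notation mu := (@lebesgue_measure R).
Implicit Types (Y : set (R * quat R)) (A : set R) (t : R).

Definition restrict_shape Y A : set (R * quat R) := Y `&` (fun p => p.1) @^-1` A.

Lemma measurable_restrict_shape Y A : measurable Y -> measurable A ->
  measurable (restrict_shape Y A).
Proof.
move=> mY mA; apply: measurableI => //; rewrite -[X in measurable X]setTI.
exact: (@measurable_fst _ _ R (quat R)).
Qed.

Lemma shape_slice_restrict Y A t :
  shape_slice (restrict_shape Y A) t = ((\1_A t)%:E * shape_slice Y t)%E.
Proof.
rewrite indicE /shape_slice; have [|nA] := boolP (t \in A).
  rewrite inE => tA; rewrite mul1e; congr (lam _).
  by apply/seteqP; split=> X; [case|].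
rewrite mul0e (_ : [set _ | _] = set0) ?measure0//; apply/seteqP; split=> X //= -[_ tA].
by move/negP: nA; apply; rewrite inE.
Qed.

(** Failing strictness puts [X] either on the boundary of the cell or on the sphere
    [|X|^2 = 1 - 1/t^4]; both are null. *)
Lemma shape_slice_boundary t :
  shape_slice (@reduced_shape R `\` @strictly_reduced_shape R) t = 0%E.
Proof.
have mr := measurable_slice1 t (@measurable_reduced_shape R).
have ms := measurable_slice1 t (@measurable_strictly_reduced_shape R).
have mV := @measurable_voronoi R; have mVi := @measurable_voronoi_interior R.
have m1 : measurable (@voronoi_cell R `\` @voronoi_interior R) by exact: measurableD.
pose S := [set X : quat R | sqn X = 1 - 1 / t ^+ 4].
have mS : measurable S.
  rewrite (_ : S = sqn @^-1` [set 1 - 1 / t ^+ 4])//.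
  have mq := measurable_sqn (@measurable_id _ (quat R) setT).
  by rewrite -[X in measurable X]setTI; exact: mq.
apply/eqP; rewrite eq_le measure_ge0 andbT.
apply: (@le_trans _ _ (lam ((@voronoi_cell R `\` @voronoi_interior R) `|` S))).
  apply: le_measure; rewrite ?inE; [exact: measurableD|exact: measurableU|].
  move=> X [/= [t0 VX c] nX]; have [VX'|] := pselect (voronoi_interior X); last by left.
  right; rewrite /S /=; apply/eqP; rewrite eq_le c andbT leNgt; apply/negP => c'.
  by apply: nX; split.
apply: le_trans (measureU2 lam m1 mS) _.
rewrite -[X in (_ <= X)%E]adde0; apply: leeD.
  by rewrite le_eqVlt; apply/orP; left; apply/eqP; exact: voronoi_boundary_null.
by rewrite le_eqVlt; apply/orP; left; apply/eqP; exact: sphere_null.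
Qed.

Lemma shape_slice_strictly_reduced t :
  shape_slice (@strictly_reduced_shape R) t = shape_slice (@reduced_shape R) t.
Proof.
have mr := measurable_slice1 t (@measurable_reduced_shape R).
have ms := measurable_slice1 t (@measurable_strictly_reduced_shape R).
rewrite /shape_slice; apply/esym; apply: etrans (measureDI lam mr ms) _.
apply: etrans (add0e _); congr (_ + lam _)%E; first exact: shape_slice_boundary.
by apply: setIidr => X; exact: strictly_reduced_sub.
Qed.

Lemma shape_slice_reduced_le t : (shape_slice (@reduced_shape R) t <= (2^-1)%:E)%E.
Proof.
rewrite -(@voronoi_volume R); apply: le_measure; rewrite ?inE.
- exact: measurable_slice1 (@measurable_reduced_shape R).
- exact: measurable_voronoi.
by move=> X [].
Qed.

Lemma shape_slice_reduced_le1 t : 0 < t <= 1 ->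
  shape_slice (@reduced_shape R) t = (2^-1)%:E.
Proof.
move=> /andP[t0 t1]; rewrite -(@voronoi_volume R); congr (lam _).
apply/seteqP; split=> X; first by case.
move=> VX; split=> //=; apply: le_trans (sqn_ge0 X).
rewrite subr_le0 div1r invf_ge1 ?exprn_gt0// exprn_ile1// ltW//.
Qed.

Lemma shape_slice_reduced_ge2 t : 2 <= t -> shape_slice (@reduced_shape R) t = 0%E.
Proof.
move=> t2; rewrite /shape_slice (_ : [set _ | _] = set0) ?measure0//.
apply/seteqP; split=> X //= -[/= _ /voronoi_sqn X2 c].
(* Now [1 - 1/t^4 >= 15/16], which exceeds the bound 1/2 on [|X|^2]. *)
have : t ^+ 4 >= 2 ^+ 4 by rewrite lerXn2r ?nnegrE//; lra.
by rewrite -(@lef_pV2 _ (t ^+ 4)) ?posrE ?exprn_gt0//; lra.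
Qed.

Definition reduced_volume A : \bar R :=
  (\int[mu]_(t in A) ((power_density t)%:E * shape_slice (@reduced_shape R) t))%E.

Let g t : \bar R := ((power_density t)%:E * shape_slice (@reduced_shape R) t)%E.

Lemma measurable_reduced_density : measurable_fun setT g.
Proof.
apply: emeasurable_funM; first exact: measurable_power_density.
exact: measurable_shape_slice (@measurable_reduced_shape R).
Qed.

Lemma reduced_density_ge0 t : (0 <= g t)%E.
Proof. by rewrite mule_ge0 ?lee_fin ?power_density_ge0 ?shape_slice_ge0. Qed.

Lemma shape_volume_restrict Y A : measurable Y -> measurable A ->
  (forall t, shape_slice Y t = shape_slice (@reduced_shape R) t) ->
  shape_volume (restrict_shape Y A) = ((8 * @kappa R)%:E * reduced_volume A)%E.
Proof.
move=> mY mA YE; have k0 := @kappa_gt0 R.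
rewrite /reduced_volume integral_mkcond -ge0_integralZl//; last 3 first.
- apply/(measurable_restrictT _ _).1 => //; exact: measurable_funTS measurable_reduced_density.
- by move=> t _; rewrite erestrict_ge0// => ? _; exact: reduced_density_ge0.
- by rewrite lee_fin mulr_ge0// ltW.
apply: eq_integral => t _; rewrite shape_slice_restrict epatch_indic YE.
rewrite /radial_density /power_density; case: ifP => _; last by rewrite !mul0e mule0.
by rewrite EFinM -!muleA; congr (_ * (_ * _))%E; rewrite muleC.
Qed.

Lemma reduced_volume_gt0 : (0 < reduced_volume setT)%E.
Proof.
pose I : set R := `]2^-1, 1[%classic.
have mI : measurable I by exact: measurable_itv.
(* Between 1/2 and 1 the slice has volume 1/2 and [t^7 >= 2^-7], hence the bound [2^-8]. *)
apply: (@lt_le_trans _ _ (\int[mu]_t (2^-1 ^+ 8 * \1_I t)%:E)%E).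
  under eq_integral do rewrite EFinM.
  rewrite ge0_integralZl//; last first.
    by apply/measurable_EFinP; exact: measurable_indic.
  have -> : (\int[mu]_t (\1_I t)%:E = (2^-1)%:E)%E.
    rewrite integral_indic// setIT /I [LHS]lebesgue_measure_itv/= lte_fin ifT; last by lra.
    by rewrite -EFinD; congr EFin; lra.
  by rewrite -EFinM lte_fin mulr_gt0// exprn_gt0.
apply: ge0_le_integral => //.
- by apply/measurable_EFinP; apply: measurable_funM => //; exact: measurable_indic.
- exact: measurable_reduced_density.
move=> t _; rewrite indicE; have [|] := boolP (t \in I); last first.
  by rewrite mulr0 => _; exact: reduced_density_ge0.
rewrite inE /I /= in_itv/= => /andP[t1 t2]; have t0 : 0 < t by lra.
rewrite shape_slice_reduced_le1; last by rewrite t0 ltW.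
rewrite /power_density t0 -EFinM lee_fin mulr1 exprSr ler_pM2r//.
by rewrite lerXn2r ?nnegrE ?invr_ge0// ltW.
Qed.

Lemma reduced_volume_lty : (reduced_volume setT < +oo)%E.
Proof.
pose I : set R := `]0, 2[%classic.
have mI : measurable I by exact: measurable_itv.
apply: (@le_lt_trans _ _ (\int[mu]_t (2 ^+ 7 * \1_I t)%:E)%E); last first.
  under eq_integral do rewrite EFinM.
  rewrite ge0_integralZl//; last first.
    by apply/measurable_EFinP; exact: measurable_indic.
  have -> : (\int[mu]_t (\1_I t)%:E = 2%:E)%E.
    rewrite integral_indic// setIT /I [LHS]lebesgue_measure_itv/= lte_fin ifT//.
    by rewrite -EFinD subr0.
  by rewrite -EFinM ltry.
apply: ge0_le_integral => //.
- by move=> t _; exact: reduced_density_ge0.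
- exact: measurable_reduced_density.
- by apply/measurable_EFinP; apply: measurable_funM => //; exact: measurable_indic.
move=> t _; rewrite /power_density; case: ifPn => [t0|_]; last first.
  by rewrite mul0e lee_fin mulr_ge0.
have [t2|t2] := leP 2 t.
  by rewrite shape_slice_reduced_ge2// mule0 lee_fin mulr_ge0.
rewrite indicE mem_set ?mulr1; last by rewrite /I /= in_itv/= t0.
apply: (@le_trans _ _ ((t ^+ 7)%:E * (2^-1)%:E)%E).
  by rewrite lee_wpmul2l ?shape_slice_reduced_le// lee_fin exprn_ge0// ltW.
rewrite -EFinM lee_fin; have : t ^+ 7 <= 2 ^+ 7 by rewrite lerXn2r ?nnegrE//; exact: ltW.
have : 0 <= t ^+ 7 by rewrite exprn_ge0// ltW.
by move: (t ^+ 7) (2 ^+ 7) => a b; lra.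
Qed.

Lemma reduced_volume_vol_Gamma : reduced_volume setT = (vol_Gamma R)%:E.
Proof.
have fin : reduced_volume setT \is a fin_num.
  by rewrite ge0_fin_numE ?reduced_volume_lty// ltW// reduced_volume_gt0.
by rewrite -(fineK fin) vol_GammaE.
Qed.

End ReducedVolume.

Section ShortestLengthLaw.
Context {R : realType}.
Local Notation sqn := (@quat_sqnorm R).
Local Notation vec := (quat R * quat R)%type.
Local Notation mat := (vec * vec)%type.
Local Notation counting := (@counting mat R).
Variable P : probability (coset_borel R) R.
Hypothesis P_invariant : left_invariant P.
Local Notation m := (base_measure P).
Implicit Types (q : coset_space R) (x y : mat) (A : set R) (Y : set (R * quat R)).

Let len q : R := shortest_length (coset_lattice q).

Definition strict_bases A : set mat :=
  with_shape (restrict_shape (@strictly_reduced_shape R) A).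

Definition boundary_bases : set mat :=
  with_shape (@reduced_shape R `\` @strictly_reduced_shape R).

Lemma measurable_strict_bases A : measurable A -> measurable (strict_bases A).
Proof.
move=> mA; apply: measurable_with_shape; apply: measurable_restrict_shape => //.
exact: measurable_strictly_reduced_shape.
Qed.

Lemma measurable_boundary_shape :
  measurable (@reduced_shape R `\` @strictly_reduced_shape R).
Proof.
apply: measurableD; first exact: measurable_reduced_shape.
exact: measurable_strictly_reduced_shape.
Qed.

(** Right multiplication by these matrices sweeps out all strictly reduced bases of a lattice from
    one of them. *)
Definition diag_units : set mat :=
  (fun p : quat R * quat R => diag_mat p.1 p.2) @` (hurwitz_units `*` hurwitz_units).

Definition diag_count : R := (#|` fset_set diag_units|)%:R.

Lemma counting_diag_units : counting diag_units = diag_count%:E.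
Proof.
apply: counting_finite; apply: finite_image.
by apply: finite_setX; exact: finite_hurwitz_units.
Qed.

Lemma diag_count_gt0 : 0 < diag_count.
Proof.
have : (1 <= counting diag_units)%E.
  apply: counting_gt0; exists (diag_mat 1 1); exists (1, 1) => //.
  by split; split; rewrite ?sqn1//; exact: hurwitz1.
by rewrite counting_diag_units lee_fin; exact: lt_le_trans.
Qed.

Lemma coset_count_strict q x A : bases q x ->
  with_shape (@strictly_reduced_shape R) x -> A (len q) ->
  coset_count q (strict_bases A) = diag_count%:E.
Proof.
move=> qx sx Aq; have x1 := bases_norm qx.
rewrite -counting_diag_units -(counting_mat_image diag_units (mat_mul_injl x1)).
have lenx : len q = col_length x.
  exact: shortest_length_reduced qx (with_shapeS (@strictly_reduced_sub R) sx).
rewrite /coset_count (_ : strict_bases A `&` bases q = mat_mul x @` diag_units)//.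
apply/seteqP; split=> [y [[y1 [Yy _]] qy]|_ [_ [[a b] [/= ha hb] <-] <-]].
  have [u Gu yu] := (basesP _ qx).1 qy.
  have sy : with_shape (@strictly_reduced_shape R) (mat_mul x u) by rewrite -yu.
  have [a [b [ha hb uE]]] := strictly_reduced_orbit sx Gu sy.
  by exists u => //; exists (a, b) => //; rewrite uE.
have [y1 Yy] := strictly_reduced_diag sx ha hb.
split; last by apply/(basesP _ qx); exists (diag_mat a b) => //;
  exact: (hurwitz_gamma_diag ha.1 hb.1 ha.2 hb.2).
split=> //; split=> //=; rewrite col_length_diag; last exact: ha.2.
by rewrite -lenx.
Qed.

Lemma coset_count_strict0 q A : ~ A (len q) -> coset_count q (strict_bases A) = 0%E.
Proof.
move=> nA; rewrite /coset_count (_ : _ `&` _ = set0) ?measure0//.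
apply/seteqP; split=> y //= [[y1 [Yy Ay]] qy]; apply: nA.
rewrite /len (shortest_length_reduced qy)//.
by split=> //; exact: strictly_reduced_sub.
Qed.

Lemma coset_count_strict_le q A :
  (coset_count q (strict_bases A) <= diag_count%:E * (\1_(len @^-1` A) q)%:E)%E.
Proof.
have [Aq|nA] := pselect (A (len q)); last first.
  by rewrite coset_count_strict0// mule_ge0// lee_fin ltW// diag_count_gt0.
rewrite indicE mem_set// mule1.
have [[x [qx sx]]|none] := pselect (exists x, bases q x /\ with_shape (@strictly_reduced_shape R) x).
  by rewrite (coset_count_strict qx sx Aq).
rewrite /coset_count (_ : _ `&` _ = set0) ?measure0 ?lee_fin ?ltW ?diag_count_gt0//.
by apply/seteqP; split=> y //= [[y1 [Yy Ay]] qy]; apply: none; exists y.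
Qed.

(** A coset without a strictly reduced basis still has a reduced one, which lies on the boundary;
    the second term pays for it and integrates to zero. *)
Lemma coset_count_strict_ge q :
  (diag_count%:E <= coset_count q (strict_bases setT) +
    diag_count%:E * coset_count q boundary_bases)%E.
Proof.
have c0 := diag_count_gt0.
have [x qx [x1 rx]] := exists_reduced_basis q.
have [sx|nsx] := pselect (strictly_reduced_shape (col_length x, gram_coef x)).
  rewrite (coset_count_strict (A := setT) qx)//.
  by rewrite leeDl// mule_ge0 ?coset_count_ge0// lee_fin ltW.
apply: (@le_trans _ _ (diag_count%:E * coset_count q boundary_bases)%E).
  rewrite -[X in (X <= _)%E]mule1; apply: lee_wpmul2l; first by rewrite lee_fin ltW.
  by rewrite /coset_count; apply: counting_gt0; exists x; split.
by rewrite leeDr// coset_count_ge0.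
Qed.

Lemma base_measure_shape : exists2 k : R, 0 < k & forall Y, measurable Y ->
  (forall p, Y p -> 0 < p.1) -> m (with_shape Y) = (k%:E * shape_volume Y)%E.
Proof.
have mD := @measurable_reduced_shape R.
have D0 : forall p, @reduced_shape R p -> 0 < p.1 by move=> p [].
have [w0 wy] := @cone_weight_integral R.
have sv : shape_volume (@reduced_shape R) = ((8 * @kappa R)%:E * (vol_Gamma R)%:E)%E.
  rewrite -reduced_volume_vol_Gamma -(shape_volume_restrict mD measurableT (fun=> erefl)).
  by congr shape_volume; rewrite /restrict_shape preimage_setT setIT.
have v0 : 0 < vol_Gamma R.
  by rewrite -lte_fin -reduced_volume_vol_Gamma reduced_volume_gt0.
have k0 := @kappa_gt0 R.
have wfin : (\int[@quat_lebesgue R]_z cone_weight z)%E \is a fin_num.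
  by rewrite ge0_fin_numE// ltW.
set w := fine (\int[@quat_lebesgue R]_z cone_weight z)%E.
have wE : (\int[@quat_lebesgue R]_z cone_weight z)%E = w%:E by rewrite fineK.
have w1 : 0 < w by rewrite -lte_fin -wE.
have vol Y : measurable Y -> (forall p, Y p -> 0 < p.1) ->
    mat_lebesgue (thicken (with_shape Y)) = (w%:E * shape_volume Y)%E.
  by move=> mY Y0; rewrite -(integral_radius mY) -wE; exact: mat_lebesgue_thicken.
have mD1 : measurable (with_shape (@reduced_shape R)) by exact: measurable_with_shape.
have LD : mat_lebesgue (thicken (with_shape (@reduced_shape R))) =
    (w * (8 * kappa * vol_Gamma R))%:E.
  by rewrite (vol _ mD D0) sv -!EFinM.
(* The reduced bases serve as reference set: their cone has positive finite volume because
   [vol_Gamma] is positive and finite, and their measure is at least 1 because every lattice has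
   such a basis. *)
have [] := @base_measure_thicken _ P P_invariant _ mD1; last first.
- move=> k k1 kE; exists (k * w); first exact: mulr_gt0.
  move=> Y mY Y0; apply: etrans (kE _ (measurable_with_shape mY)) _.
  by rewrite (vol _ mY Y0) muleA EFinM.
- by rewrite LD ltry.
- by rewrite LD lte_fin !mulr_gt0.
apply: (@lt_le_trans _ _ 1%E) => //.
have <- : (\int[P]_q (cst 1 q) = 1 :> \bar R)%E.
  by rewrite integral_cst// [X in (_ * X)%E](@probability_setT _ _ _ P) mul1e.
apply: ge0_le_integral => //; first exact: measurable_coset_count.
move=> q _; apply: counting_gt0; have [x qx sx] := exists_reduced_basis q.
by exists x.
Qed.

Lemma measurable_length_preimage A : measurable A ->
  measurable (len @^-1` A : set (coset_borel R)).
Proof.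
move=> mA; rewrite -[X in measurable X]setTI.
exact: (@measurable_coset_length R).
Qed.

Lemma base_measure_strict_le A : measurable A ->
  (m (strict_bases A) <= diag_count%:E * P (len @^-1` A))%E.
Proof.
move=> mA; have mp := measurable_length_preimage mA.
have <- : (\int[P]_q (diag_count%:E * (\1_(len @^-1` A) q)%:E) =
    diag_count%:E * P (len @^-1` A))%E.
  rewrite ge0_integralZl//; last 2 first.
  - by apply/measurable_EFinP; exact: measurable_indic.
  - by rewrite lee_fin ltW// diag_count_gt0.
  by rewrite integral_indic// setIT.
apply: ge0_le_integral => //.
- by apply: measurable_coset_count; exact: measurable_strict_bases.
- by apply/measurable_EFinP; apply: measurable_funM => //; exact: measurable_indic.
by move=> q _; exact: coset_count_strict_le.
Qed.

Lemma base_measure_boundary : m boundary_bases = 0%E.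
Proof.
have [k k0 kE] := base_measure_shape.
apply: etrans (kE _ measurable_boundary_shape _) _; first by move=> p [[]].
rewrite /shape_volume integral0_eq ?mule0// => t _.
by rewrite shape_slice_boundary mule0.
Qed.

Lemma base_measure_strict_ge : (diag_count%:E <= m (strict_bases setT))%E.
Proof.
have mb : measurable boundary_bases.
  by apply: measurable_with_shape; exact: measurable_boundary_shape.
have ms := measurable_strict_bases measurableT.
have c0 := diag_count_gt0.
have <- : (\int[P]_q (cst diag_count%:E q) = diag_count%:E)%E.
  by rewrite integral_cst// [X in (_ * X)%E](@probability_setT _ _ _ P) mule1.
have <- : (\int[P]_q (coset_count q (strict_bases setT) +
    diag_count%:E * coset_count q boundary_bases) = m (strict_bases setT))%E.
  have mc E : measurable E -> measurable_fun setT (fun q : coset_borel R => coset_count q E).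
    exact: measurable_coset_count.
  have cge E (q : coset_borel R) : setT q -> (0 <= coset_count q E)%E.
    by move=> _; exact: coset_count_ge0.
  have bge (q : coset_borel R) : setT q -> (0 <= diag_count%:E * coset_count q boundary_bases)%E.
    by move=> _; rewrite mule_ge0 ?cge// lee_fin ltW.
  have mcb : measurable_fun setT
      (fun q : coset_borel R => diag_count%:E * coset_count q boundary_bases)%E.
    by apply: emeasurable_funM => //; exact: mc.
  rewrite (ge0_integralD _ measurableT (cge _) (mc _ ms) bge mcb).
  rewrite (ge0_integralZl _ measurableT (mc _ mb) (cge _)); last first.
    by rewrite lee_fin ltW.
  rewrite -[RHS]adde0; congr (_ + _)%E; rewrite -[RHS](mule0 diag_count%:E).
  by congr (_ * _)%E; exact: base_measure_boundary.
apply: ge0_le_integral => //.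
- by move=> q _; rewrite /cst lee_fin ltW.
- apply: emeasurable_funD; first exact: measurable_coset_count.
  by apply: emeasurable_funM => //; exact: measurable_coset_count.
by move=> q _; exact: coset_count_strict_ge.
Qed.

(** The upper bounds for [A] and for its complement add up to [diag_count], which is also a lower
    bound for the sum of the two measures; so both are equalities. *)
Lemma base_measure_strict A : measurable A ->
  m (strict_bases A) = (diag_count%:E * P (len @^-1` A))%E.
Proof.
move=> mA; have mC := measurableC mA.
have c0 := diag_count_gt0.
have := base_measure_strict_le mA; have := base_measure_strict_le mC.
have := base_measure_strict_ge.
have -> : m (strict_bases setT) = (m (strict_bases A) + m (strict_bases (~` A)))%E.
  rewrite -measureU//; [|exact: measurable_strict_bases mA
    |exact: measurable_strict_bases mC|]; last first.
    by apply/seteqP; split=> x //= [[_ [_ h]] [_ [_ h']]].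
  congr (m _); apply/seteqP; split=> x.
    by move=> [x1 [Yx _]]; have [?|?] := pselect (A (col_length x)); [left|right].
  by move=> [[x1 [Yx _]]|[x1 [Yx _]]].
have : (P (len @^-1` A) + P (len @^-1` (~` A)) = 1)%E.
  rewrite -(@probability_setT _ _ _ P) -measureU//;
    [|exact: measurable_length_preimage mA|exact: measurable_length_preimage mC|].
    by congr (P _); apply/seteqP; split=> q //= _; have [?|?] := pselect (A (len q)); [left|right].
  by apply/seteqP; split=> q //= [].
have pA : P (len @^-1` A) \is a fin_num.
  by apply: fin_num_measure; exact: measurable_length_preimage mA.
have pC : P (len @^-1` (~` A)) \is a fin_num.
  by apply: fin_num_measure; exact: measurable_length_preimage mC.
have a0 := measure_ge0 m (strict_bases A); have b0 := measure_ge0 m (strict_bases (~` A)).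
rewrite -(fineK pA) -(fineK pC); move: (fine _) (fine _) => p p'.
move: (m (strict_bases A)) (m (strict_bases (~` A))) a0 b0 => a b.
rewrite -!EFinM -EFinD => a0 b0 [pp].
case: a a0 => [a| |]//; case: b b0 => [b| |]// _ _.
rewrite -EFinD !lee_fin => h1 h2 h3; congr EFin.
have := congr1 ( *%R diag_count) pp; rewrite mulrDr mulr1.
by lra.
Qed.

Lemma shortest_length_law A : measurable A ->
  P (len @^-1` A) = ((vol_Gamma R)^-1%:E * reduced_volume A)%E.
Proof.
move=> mA; have c0 := diag_count_gt0; have k0 := @kappa_gt0 R.
have [k k1 kE] := base_measure_shape.
have ms := @measurable_strictly_reduced_shape R.
have law B : measurable B ->
    (diag_count%:E * P (len @^-1` B) = (k * (8 * kappa))%:E * reduced_volume B)%E.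
  move=> mB; rewrite -base_measure_strict//.
  apply: etrans (kE _ (measurable_restrict_shape ms mB) _) _; first by move=> p [[]].
  rewrite shape_volume_restrict//; last exact: shape_slice_strictly_reduced.
  by rewrite muleA EFinM.
have v0 : 0 < vol_Gamma R.
  by rewrite -lte_fin -reduced_volume_vol_Gamma reduced_volume_gt0.
(* Taking the whole line for [B] evaluates the product of the unknown constants. *)
have cE : diag_count = k * (8 * kappa) * vol_Gamma R.
  have := law _ measurableT; rewrite preimage_setT [X in (_ * X)%E = _](@probability_setT _ _ _ P).
  by rewrite mule1 reduced_volume_vol_Gamma -EFinM => -[].
have := law _ mA; rewrite cE.
have pA : P (len @^-1` A) \is a fin_num.
  by apply: fin_num_measure; exact: measurable_length_preimage mA.
rewrite -(fineK pA); move: (fine _) (reduced_volume A) => p [r| |].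
- rewrite -!EFinM => -[e]; congr EFin.
  have K0 : k * (8 * kappa) != 0 by rewrite gt_eqF// !mulr_gt0.
  apply: (mulfI (x := vol_Gamma R)); first by rewrite gt_eqF.
  rewrite mulrA divff ?gt_eqF// mul1r; apply: (mulfI K0).
  by rewrite mulrA.
- by rewrite gt0_muley ?lte_fin ?mulr_gt0// -EFinM.
- by rewrite gt0_muleNy ?lte_fin ?mulr_gt0// -EFinM.
Qed.

End ShortestLengthLaw.

Theorem proposition25 (R : realType) (P : probability (coset_borel R) R)
    (P_invariant : left_invariant P) :
  exists f : R -> R,
    is_pdf P (fun q => shortest_length (coset_lattice q)) f /\
    forall t : R, 0 < t < 1 -> f t = 1 / vol_Gamma R * (t ^+ 7 / 2).
Proof.
have v0 : 0 < vol_Gamma R.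
  by rewrite -lte_fin -reduced_volume_vol_Gamma reduced_volume_gt0.
have sfin t : shape_slice (@reduced_shape R) t \is a fin_num.
  rewrite ge0_fin_numE ?shape_slice_ge0//.
  exact: le_lt_trans (shape_slice_reduced_le t) (ltry _).
(* Slices have volume at most 1/2, so [fine] loses nothing; [power_density] makes the density vanish
   for [t <= 0]. *)
exists (fun t => (vol_Gamma R)^-1 * (power_density t * fine (shape_slice (@reduced_shape R) t))).
split; last first.
  move=> t /andP[t0 t1]; rewrite shape_slice_reduced_le1; last by rewrite t0 ltW.
  by rewrite /power_density t0 /= div1r.
split.
- exact: measurable_coset_length.
- apply: measurable_funM => //; apply: measurable_funM.
    by apply/measurable_EFinP; exact: measurable_power_density.
  apply: measurableT_comp => //.
  exact: measurable_shape_slice (@measurable_reduced_shape R).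
- move=> t; apply: mulr_ge0; first by rewrite invr_ge0 ltW.
  by rewrite mulr_ge0 ?power_density_ge0// fine_ge0// shape_slice_ge0.
move=> A mA; rewrite (shortest_length_law P_invariant mA) /reduced_volume.
rewrite -ge0_integralZl//; last 3 first.
- exact: measurable_funTS (@measurable_reduced_density R).
- by move=> t _; exact: reduced_density_ge0.
- by rewrite lee_fin invr_ge0 ltW.
by apply: eq_integral => t _; rewrite !EFinM fineK.
Qed.
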